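(* Fix $\alpha>0$. For every positive integer $d$ (large enough that $\lfloor \alpha d^2\rfloor\geq 1$), let $W_d$ be a $(d^2,\lfloor \alpha d^2 \rfloor)$-Wishart matrix (real or complex), and let $Y_d=W_d^\Gamma$ be the partial transposition of $W_d$. Then for every interval $I \subset \mathbb{R}$ and every $\varepsilon >0$, \[ \lim_{d \to \infty} \mathbf{P} \left( \left| N_{Y_d}(I) - \mu_{SC(1,1/\alpha)}(I) \right| > \varepsilon \right) = 0 .\]
   Context: A $(n,p)$-Wishart matrix is a random $n\times n$ matrix $W=\frac1p GG^\dagger$, where $G$ is an $n\times p$ matrix with independent $N(0,1)$ entries, either all real or all complex. A complex $N(0,1)$ variable has independent real and imaginary parts, each real $N(0,\frac12)$. The result is asserted in both the real and the complex case. For $n=d^2$, an $n\times n$ matrix $A$ is viewed as a $d\times d$ block matrix with $d\times d$ blocks, with entries $A_{i,j}^{k,l}$ ($i,j,k,l\in\{1,\dots,d\}$): $i$ is the block row index, $j$ the block column index, $k$ the row index and $l$ the column index inside block $(i,j)$. The partial transposition $A^\Gamma$ is obtained by transposing each block: $(A^\Gamma)_{i,j}^{k,l}=A_{i,j}^{l,k}$. For a Hermitian $n\times n$ matrix $A$ with eigenvalues $\lambda_1,\dots,\lambda_n$ (with multiplicity), $N_A=\frac1n\sum_{i=1}^n\delta_{\lambda_i}$, so $N_A(I)$ is the proportion of eigenvalues in $I$. For $m\in\mathbb{R}$, $\sigma>0$, $\mu_{SC(m,\sigma^2)}$ is the semicircular distribution with support $[m-2\sigma,m+2\sigma]$ and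 density $\frac{1}{2\pi\sigma^2}\sqrt{4\sigma^2-(x-m)^2}$ there. *)

(* Defs.v *)
From HB Require Import structures.
From mathcomp Require Import all_boot all_order all_algebra.
From mathcomp Require Import all_classical all_reals all_analysis.
From mathcomp Require Import complex mxtens.

Set Implicit Arguments.
Unset Strict Implicit.
Unset Printing Implicit Defensive.

Import Order.TTheory GRing.Theory Num.Theory.
Import numFieldNormedType.Exports.

Local Open Scope classical_set_scope.
Local Open Scope ring_scope.
Local Open Scope complex_scope.
Local Open Scope sesquilinear_scope.

Section probability.
Context (disp : measure_display) (T : measurableType disp) (R : realType)
  (P : probability T R).

Definition mutually_independent (disp' : measure_display)
    (T' : measurableType disp') (I : finType) (X : I -> T -> T') : Prop :=
  forall (J : {set I}) (A : I -> set T'), (forall i, measurable (A i)) ->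
    P (\bigcap_(i in [set` J]) (X i @^-1` A i)) =
    (\prod_(i in J) P (X i @^-1` A i))%E.

Definition independent2 (X Y : T -> R) : Prop :=
  forall A B : set R, measurable A -> measurable B ->
    P (X @^-1` A `&` Y @^-1` B) = (P (X @^-1` A) * P (Y @^-1` B))%E.

(* [v] is the variance, whereas [normal_prob] takes the standard deviation. *)
Definition is_normal (m v : R) (X : T -> R) : Prop :=
  measurable_fun setT X /\
  forall A : set R, measurable A ->
    P (X @^-1` A) = normal_prob m (Num.sqrt v) A.

Definition is_real_std_normal (X : T -> R[i]) : Prop :=
  (forall t, complex.Im (X t) = 0) /\
  is_normal 0 1 (fun t => complex.Re (X t)).

Definition is_complex_std_normal (X : T -> R[i]) : Prop :=
  [/\ is_normal 0 2^-1 (fun t => complex.Re (X t)),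
      is_normal 0 2^-1 (fun t => complex.Im (X t)) &
      independent2 (fun t => complex.Re (X t)) (fun t => complex.Im (X t))].

Variant entry_kind := real_entries | complex_entries.

Definition is_std_normal (k : entry_kind) (X : T -> R[i]) : Prop :=
  match k with
  | real_entries => is_real_std_normal X
  | complex_entries => is_complex_std_normal X
  end.

(* [R[i]] carries no measurable structure in the library; its Borel sigma-algebra
   is that of [R * R]. *)
Definition is_gaussian_matrix (k : entry_kind) (n p : nat)
    (G : T -> 'M[R[i]]_(n, p)) : Prop :=
  (forall i j, is_std_normal k (fun t => G t i j)) /\
  mutually_independent (fun (ij : 'I_n * 'I_p) (t : T) =>
    (complex.Re (G t ij.1 ij.2), complex.Im (G t ij.1 ij.2))).

(* Real Wishart matrices are viewed inside ['M[R[i]]_n]. *)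
Definition is_wishart (k : entry_kind) (n p : nat) (W : T -> 'M[R[i]]_n) : Prop :=
  exists2 G : T -> 'M[R[i]]_(n, p), is_gaussian_matrix k G &
    forall t, W t = p%:R^-1 *: (G t *m (G t)^t*).

End probability.

(* The row (resp. column) with index [k] inside block row (resp. column) [i] has
   global index [mxtens_index (i, k) = i * d + k]. *)
Definition partial_transpose (K : Type) (d : nat) (A : 'M[K]_(d ^ 2)) :
    'M[K]_(d ^ 2) :=
  \matrix_(a < d * d, b < d * d)
    let: (i, k) := mxtens_unindex a in
    let: (j, l) := mxtens_unindex b in
    A (mxtens_index (i, l)) (mxtens_index (j, k)).

Lemma partial_transposeE (K : Type) (d : nat) (A : 'M[K]_(d ^ 2))
    (i j k l : 'I_d) :
  partial_transpose A (mxtens_index (i, k)) (mxtens_index (j, l)) =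
  A (mxtens_index (i, l)) (mxtens_index (j, k)).
Proof. by rewrite mxE !mxtens_indexK. Qed.

(* For Hermitian [A] the entries of [spectral_diag A] are the eigenvalues of [A]
   with multiplicity, and they are real. *)
Definition empirical_spectral_measure (R : realType) (n : nat) (A : 'M[R[i]]_n)
    (I : set R) : R :=
  n%:R^-1 * \sum_(i < n) \1_I (complex.Re (spectral_diag A 0 i)).

(* [v] is the variance, i.e. the squared half radius of the support. *)
Definition semicircle_pdf (R : realType) (m v x : R) : R :=
  if x \in `[m - 2 * Num.sqrt v, m + 2 * Num.sqrt v]
  then (2 * pi * v)^-1 * Num.sqrt (4 * v - (x - m) ^+ 2)
  else 0.

Definition semicircle (R : realType) (m v : R) (I : set R) : \bar R :=
  (\int[lebesgue_measure]_(x in I) (semicircle_pdf m v x)%:E)%E.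

(* Main.v *)
(** Let [n = d ^ 2], [c = n / p], and let [H = Y - 1] be the average of the [p] centered
    partial transposes [Z_s] of the rank one matrices built from the columns of the
    Gaussian matrix. Up to a diagonal correction the entries of [Z_s] have the
    covariance of a GUE (GOE in the real case) matrix. Hence, with [m] the normalized
    trace of the resolvent of [H] at [z], comparing that resolvent with the one where
    [Z_s], which is independent of the rest, has been removed shows that the defect
    [D = 1 + z m + c m ^ 2] satisfies [E |D| ^ 2 = O (d ^ (-1/2))]; Frobenius norms
    suffice to control the remainders. By Chebyshev's inequality [D] is small at
    finitely many points [z = E + i eta] simultaneously.

    With [v = 1 / alpha], [w = 2 v m + z] solves [w ^ 2 = z ^ 2 - 4 v + 4 v D], so
    [Im w >= sqrt (4 v - E ^ 2)] as soon as [4 v |D| <= eta ^ 2]: the spectral measure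
    smoothed by the Poisson kernel dominates the semicircle density up to [O (eta)].
    Riemann sums over a grid turn this into [N(I) >= mu(I) - eps] for every interval
    [I], and applying it to both components of the complement of [I] gives the upper
    bound. The spectral counts are random variables because they are limits of traces
    of rational functions of [Y]. *)

From HB Require Import structures.
From mathcomp Require Import all_boot all_order all_algebra.
From mathcomp Require Import all_classical all_reals all_analysis.
From mathcomp Require Import measurable_realfun complex mxtens.
From mathcomp Require Import ring lra.
Require Import Defs.

Import Order.TTheory GRing.Theory Num.Theory.
Import numFieldNormedType.Exports.

Local Open Scope classical_set_scope.
Local Open Scope ring_scope.
Local Open Scope complex_scope.
Local Open Scope sesquilinear_scope.

Set Implicit Arguments.
Unset Strict Implicit.
Unset Printing Implicit Defensive.

Import Normc.

(** * Frobenius norms and resolvents *)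

Section complex_modulus.
Variable R : realType.
Implicit Types x y : R[i].

Lemma complex_eqP x y :
  complex.Re x = complex.Re y -> complex.Im x = complex.Im y -> x = y.
Proof. by case: x y => [? ?] [? ?] /= -> ->. Qed.

Lemma ReM x y : complex.Re (x * y) =
  complex.Re x * complex.Re y - complex.Im x * complex.Im y.
Proof. by case: x y => [? ?] [? ?]. Qed.

Lemma ImM x y : complex.Im (x * y) =
  complex.Re x * complex.Im y + complex.Im x * complex.Re y.
Proof. by case: x y => [? ?] [? ?]. Qed.

Lemma Re_realM (a : R) x : complex.Re (a%:C * x) = a * complex.Re x.
Proof. by rewrite ReM /= mul0r subr0. Qed.

Lemma Im_realM (a : R) x : complex.Im (a%:C * x) = a * complex.Im x.
Proof. by rewrite ImM /= mul0r addr0. Qed.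

Lemma ReJ x : complex.Re (Num.conj x) = complex.Re x.
Proof. by case: x. Qed.

Lemma ImJ x : complex.Im (Num.conj x) = - complex.Im x.
Proof. by case: x. Qed.

Lemma normc_ge0 x : 0 <= normc x.
Proof. exact: (@normr_ge0 R (Rcomplex R)). Qed.

Lemma sqr_normcE x : normc x ^+ 2 = complex.Re x ^+ 2 + complex.Im x ^+ 2.
Proof. by case: x => a b; rewrite sqr_sqrtr // addr_ge0 ?sqr_ge0. Qed.

Lemma normcJ x : normc (Num.conj x) = normc x.
Proof. by have [] := normcJ x. Qed.

Lemma normc_real (a : R) : normc a%:C = `|a|.
Proof. by rewrite /= expr0n addr0 sqrtr_sqr. Qed.

Lemma normc_nat (k : nat) : normc (k%:R : R[i]) = k%:R.
Proof. by rewrite -(rmorph_nat (real_complex R)) normc_real normr_nat. Qed.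

Lemma normr_Re_le x : `|complex.Re x| <= normc x.
Proof. by rewrite -lecR; exact: normc_ge_Re. Qed.

Lemma normr_Im_le x : `|complex.Im x| <= normc x.
Proof.
by rewrite -[leLHS]sqrtr_sqr; case: x => a b /=; rewrite ler_wsqrtr // lerDr sqr_ge0.
Qed.

Lemma Re_le_normc x : complex.Re x <= normc x.
Proof. exact: le_trans (ler_norm _) (normr_Re_le _). Qed.

Lemma normc_sum_le (I : Type) (r : seq I) (Q : pred I) (F : I -> R[i]) :
  normc (\sum_(i <- r | Q i) F i) <= \sum_(i <- r | Q i) normc (F i).
Proof. exact: (@ler_norm_sum R (Rcomplex R)). Qed.

Lemma mul_conjc x : x * Num.conj x = (normc x ^+ 2)%:C.
Proof. by rewrite rmorphXn; exact/esym/sqr_normc. Qed.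

End complex_modulus.

Lemma eq_ler (R : numDomainType) (a b : R) : a = b -> a <= b.
Proof. by move=> ->. Qed.

Lemma ler_of_sqr (R : realDomainType) (a b : R) : 0 <= b -> a ^+ 2 <= b ^+ 2 -> a <= b.
Proof.
move=> b0; have [a0|/ltW a0 _] := leP 0 a; last exact: le_trans b0.
by rewrite ler_sqr ?nnegrE.
Qed.

Lemma cauchy_schwarz_sum (R : realDomainType) (I : Type) (s : seq I) (Q : pred I)
    (a b : I -> R) :
  (\sum_(i <- s | Q i) a i * b i) ^+ 2 <=
  (\sum_(i <- s | Q i) a i ^+ 2) * (\sum_(i <- s | Q i) b i ^+ 2).
Proof.
rewrite -subr_ge0 -(pmulr_lge0 _ (ltr0Sn R 1)).
have -> : ((\sum_(i <- s | Q i) a i ^+ 2) * (\sum_(i <- s | Q i) b i ^+ 2)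
    - (\sum_(i <- s | Q i) a i * b i) ^+ 2) * 2
  = \sum_(i <- s | Q i) \sum_(j <- s | Q j) (a i * b j - a j * b i) ^+ 2.
  rewrite [in LHS]expr2 !big_distrlr /= mulrBl !(mulr_natr _ 2) !mulr2n.
  rewrite [X in _ + X - _]exchange_big -!big_split -sumrB /=.
  apply: eq_bigr => i _; rewrite -!big_split -sumrB /=.
  by apply: eq_bigr => j _; ring.
by apply: sumr_ge0 => i _; apply: sumr_ge0 => j _; apply: sqr_ge0.
Qed.

Section hermitian_matrices.
Variables (R : realType) (n : nat).
Implicit Types A B : 'M[R[i]]_n.

Lemma hermsymmxP A : reflect (A ^t* = A) (A \is hermsymmx).
Proof.
by apply: (iffP (@is_hermitianmxP _ _ _ _ A)); rewrite expr0 scale1r => /esym.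
Qed.

Lemma hermsymmx_zmod_closed : zmod_closed (hermsymmx : {pred 'M[R[i]]_n}).
Proof.
split=> [|A B]; first by apply/hermsymmxP; rewrite trmx0 map_mx0.
by move=> /hermsymmxP hA /hermsymmxP hB; apply/hermsymmxP; rewrite linearB map_mxB hA hB.
Qed.

HB.instance Definition _ := GRing.isZmodClosed.Build 'M[R[i]]_n
  (hermsymmx : {pred 'M[R[i]]_n}) hermsymmx_zmod_closed.

Lemma hermsymmx1 : (1%:M : 'M[R[i]]_n) \is hermsymmx.
Proof. by apply/hermsymmxP; rewrite trmx1 map_mx1. Qed.

Lemma hermsymmxZ (a : R) A : A \is hermsymmx -> a%:C *: A \is hermsymmx.
Proof.
move=> /hermsymmxP hA; apply/hermsymmxP; rewrite linearZ map_mxZ hA.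
by congr (_ *: _); exact: conjc_real.
Qed.

Lemma hermsymmx_real_scalar (a : R) : (a%:C%:M : 'M[R[i]]_n) \is hermsymmx.
Proof. by rewrite -scalemx1 hermsymmxZ // hermsymmx1. Qed.

End hermitian_matrices.

Section frobenius.
Variable R : realType.

Definition frob (m n : nat) (A : 'M[R[i]]_(m, n)) : R :=
  Num.sqrt (\sum_i \sum_j normc (A i j) ^+ 2).

Lemma frob_ge0 m n (A : 'M[R[i]]_(m, n)) : 0 <= frob A.
Proof. exact: sqrtr_ge0. Qed.

Lemma sqr_frob m n (A : 'M[R[i]]_(m, n)) :
  frob A ^+ 2 = \sum_i \sum_j normc (A i j) ^+ 2.
Proof.
by rewrite sqr_sqrtr //; do 2!(apply: sumr_ge0 => ? _); apply: sqr_ge0.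
Qed.

Lemma sqr_frob_pair m n (A : 'M[R[i]]_(m, n)) :
  frob A ^+ 2 = \sum_(ij : 'I_m * 'I_n) normc (A ij.1 ij.2) ^+ 2.
Proof. by rewrite sqr_frob pair_bigA. Qed.

Lemma normc_entry_le_frob m n (A : 'M[R[i]]_(m, n)) i j : normc (A i j) <= frob A.
Proof.
apply: ler_of_sqr (frob_ge0 _) _; rewrite sqr_frob_pair (bigD1 (i, j)) //=.
by rewrite lerDl sumr_ge0 // => ij _; exact: sqr_ge0.
Qed.

Lemma frob0 m n : frob (0 : 'M[R[i]]_(m, n)) = 0.
Proof.
rewrite /frob big1 ?sqrtr0 // => i _; rewrite big1 // => j _.
by rewrite mxE normc0 expr0n.
Qed.

Lemma frob0_eq0 m n (A : 'M[R[i]]_(m, n)) : frob A = 0 -> A = 0.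
Proof.
move=> A0; apply/matrixP => i j; rewrite mxE; apply: eq0_normc; apply/eqP.
by rewrite eq_le normc_ge0 andbT -A0 normc_entry_le_frob.
Qed.

Lemma sum_normcM_le m n (A B : 'M[R[i]]_(m, n)) :
  \sum_i \sum_j normc (A i j) * normc (B i j) <= frob A * frob B.
Proof.
apply: ler_of_sqr; first by rewrite mulr_ge0 ?frob_ge0.
rewrite exprMn !sqr_frob_pair pair_bigA.
exact: (cauchy_schwarz_sum _ _ (fun ij => normc (A ij.1 ij.2))
                               (fun ij => normc (B ij.1 ij.2))).
Qed.

Lemma frobD m n (A B : 'M[R[i]]_(m, n)) : frob (A + B) <= frob A + frob B.
Proof.
apply: ler_of_sqr; first by rewrite addr_ge0 ?frob_ge0.
pose a (ij : 'I_m * 'I_n) := normc (A ij.1 ij.2).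
pose b (ij : 'I_m * 'I_n) := normc (B ij.1 ij.2).
apply: (@le_trans _ _ (\sum_ij (a ij + b ij) ^+ 2)).
  rewrite sqr_frob_pair; apply: ler_sum => ij _.
  by rewrite mxE ler_sqr ?nnegrE ?addr_ge0 ?normc_ge0 ?le_normcD.
under eq_bigr => ij _ do rewrite sqrrD.
rewrite !big_split /= -mulr2n -!sqr_frob_pair sqrrD lerD2r lerD2l lerMn2r /=.
by rewrite -(pair_bigA _ (fun i j => a (i, j) * b (i, j))) sum_normcM_le.
Qed.

Lemma frob_trC m n (A : 'M[R[i]]_(m, n)) : frob (A ^t*) = frob A.
Proof.
rewrite /frob exchange_big; congr Num.sqrt.
by do 2!(apply: eq_bigr => ? _); rewrite !mxE normcJ.
Qed.

Lemma frob_tr m n (A : 'M[R[i]]_(m, n)) : frob (A ^T) = frob A.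
Proof.
rewrite /frob exchange_big; congr Num.sqrt.
by do 2!(apply: eq_bigr => ? _); rewrite !mxE.
Qed.

Lemma frobZ m n (a : R[i]) (A : 'M[R[i]]_(m, n)) :
  frob (a *: A) = normc a * frob A.
Proof.
apply: (@pexpIrn _ 2); rewrite ?nnegrE ?mulr_ge0 ?normc_ge0 ?frob_ge0 //.
rewrite exprMn !sqr_frob mulr_sumr; apply: eq_bigr => i _.
by rewrite mulr_sumr; apply: eq_bigr => j _; rewrite mxE normcM exprMn.
Qed.

Lemma frobN m n (A : 'M[R[i]]_(m, n)) : frob (- A) = frob A.
Proof. by rewrite -scaleN1r frobZ normcN normc1 mul1r. Qed.

Lemma frob1 n : frob (1%:M : 'M[R[i]]_n) = Num.sqrt n%:R.
Proof.
congr Num.sqrt; rewrite (eq_bigr (fun=> 1)); last first.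
  move=> i _; rewrite (bigD1 i) //= big1 => [|j ji]; rewrite mxE ?eqxx.
    by rewrite normc1 expr1n addr0.
  by rewrite eq_sym (negPf ji) normc0 expr0n.
by rewrite sumr_const card_ord.
Qed.

Lemma normc_mxtraceM_le m n (A : 'M[R[i]]_(m, n)) (B : 'M[R[i]]_(n, m)) :
  normc (\tr (A *m B)) <= frob A * frob B.
Proof.
rewrite -(frob_tr B); apply: le_trans (sum_normcM_le _ _).
apply: le_trans (normc_sum_le _ _ _) _; apply: ler_sum => i _.
rewrite mxE; apply: le_trans (normc_sum_le _ _ _) _.
by apply: ler_sum => j _; rewrite normcM !mxE.
Qed.

Lemma frobM m n p (A : 'M[R[i]]_(m, n)) (B : 'M[R[i]]_(n, p)) :
  frob (A *m B) <= frob A * frob B.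
Proof.
apply: ler_of_sqr; first by rewrite mulr_ge0 ?frob_ge0.
rewrite exprMn (sqr_frob A) -(frob_tr B) (sqr_frob B^T) sqr_frob mulr_suml.
apply: ler_sum => i _; rewrite mulr_sumr; apply: ler_sum => k _.
under [X in _ <= _ * X]eq_bigr => j _ do rewrite mxE.
apply: le_trans (cauchy_schwarz_sum _ _ (fun j => normc (A i j)) _).
rewrite ler_sqr ?nnegrE ?normc_ge0 ?sumr_ge0 // => [|j _].
  rewrite mxE; apply: le_trans (normc_sum_le _ _ _) _.
  by apply: ler_sum => j _; rewrite normcM.
by rewrite mulr_ge0 ?normc_ge0.
Qed.

Lemma mxtrace_trCM m n (A : 'M[R[i]]_(m, n)) :
  \tr (A ^t* *m A) = (frob A ^+ 2)%:C.
Proof.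
rewrite sqr_frob exchange_big /= rmorph_sum /=; apply: eq_bigr => i _.
rewrite mxE rmorph_sum /=; apply: eq_bigr => j _.
by rewrite !mxE mulrC mul_conjc.
Qed.

Lemma frob_gramC m n (M : 'M[R[i]]_(m, n)) : frob (M ^t* *m M) = frob (M *m M ^t*).
Proof.
apply: (@pexpIrn _ 2); rewrite ?nnegrE ?frob_ge0 //.
apply: (@complexI R); rewrite -!mxtrace_trCM !trmx_mul !map_mxM.
have -> : (M ^t*)^T ^ (Num.conj) = M by exact: trmxCK.
by rewrite mxtrace_mulC -!mulmxA mxtrace_mulC -!mulmxA.
Qed.

Lemma sqr_frob_gram m n (M : 'M[R[i]]_(m, n)) :
  (frob (M *m M ^t*) ^+ 2)%:C =
  \sum_i \sum_j \sum_k \sum_l M i k * Num.conj (M j k) * (M j l * Num.conj (M i l)).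
Proof.
rewrite sqr_frob rmorph_sum; apply: eq_bigr => i _; rewrite rmorph_sum.
apply: eq_bigr => j _; rewrite /= -mul_conjc mxE rmorph_sum big_distrlr /=.
apply: eq_bigr => k _; apply: eq_bigr => l _.
by rewrite !mxE rmorphM /= conjCK [Num.conj (M i l) * _]mulrC.
Qed.

(* Bounds the operator norm of [A] by [frob (A^* A)], which is much smaller
   than [frob A ^+ 2] for a Gaussian matrix. *)
Lemma sqr_frobM_le m n p (A : 'M[R[i]]_(m, n)) (B : 'M[R[i]]_(n, p)) :
  frob (A *m B) ^+ 2 <= frob (A ^t* *m A) * frob B ^+ 2.
Proof.
rewrite -(ger0_norm (sqr_ge0 (frob (A *m B)))) -normc_real -mxtrace_trCM.
rewrite trmx_mul map_mxM -mulmxA mxtrace_mulC -!mulmxA mulmxA.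
apply: le_trans (normc_mxtraceM_le _ _) _.
rewrite ler_wpM2l ?frob_ge0 // expr2 -{2}(frob_trC B); exact: frobM.
Qed.

End frobenius.

Section resolvent.
Variables (R : realType) (n : nat).
Implicit Types (H B : 'M[R[i]]_n) (z : R[i]).

Definition resolvent H z : 'M[R[i]]_n := invmx (H - z%:M).

Lemma trC_shift H z : H \is hermsymmx -> (H - z%:M) ^t* = H - (Num.conj z)%:M.
Proof. by move=> /hermsymmxP hH; rewrite linearB /= map_mxB hH tr_scalar_mx map_scalar_mx. Qed.

Lemma shift_gram H z : H \is hermsymmx ->
  (H - z%:M) ^t* *m (H - z%:M) =
  (H - (complex.Re z)%:C%:M) ^t* *m (H - (complex.Re z)%:C%:M) + (complex.Im z ^+ 2)%:C%:M.
Proof.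
have realJ : Num.conj (complex.Re z)%:C = (complex.Re z)%:C by exact: conjc_real.
move=> hH; rewrite !trC_shift // realJ.
rewrite !mulmxBl !mulmxBr !mul_scalar_mx !mul_mx_scalar !scale_scalar_mx.
have conjE : Num.conj z = 2 * (complex.Re z)%:C - z.
  by apply: complex_eqP; rewrite ?ReJ ?ImJ raddfB ?ReM ?ImM /=; ring.
have conjM : Num.conj z * z = (complex.Re z)%:C * (complex.Re z)%:C + (complex.Im z ^+ 2)%:C.
  by rewrite mulrC mul_conjc sqr_normcE rmorphD expr2 rmorphM.
by apply/matrixP => i j; rewrite !mxE conjM conjE; case: (i == j); rewrite ?mulr1n ?mulr0n; ring.
Qed.

Lemma sqr_frob_shift m H z (B : 'M[R[i]]_(n, m)) : H \is hermsymmx ->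
  frob ((H - z%:M) *m B) ^+ 2 =
  frob ((H - (complex.Re z)%:C%:M) *m B) ^+ 2 + complex.Im z ^+ 2 * frob B ^+ 2.
Proof.
move=> hH; apply: (@complexI R); rewrite rmorphD (rmorphM _ (_ ^+ 2)) /= -!mxtrace_trCM.
rewrite -mxtraceZ -mxtraceD; congr (\tr _).
rewrite !trmx_mul !map_mxM -!mulmxA scalemxAr -mulmxDr; congr (_ *m _).
by rewrite !mulmxA -mul_scalar_mx -mulmxDl shift_gram.
Qed.

Lemma hermitian_shift_unit H z : H \is hermsymmx -> complex.Im z != 0 ->
  H - z%:M \in unitmx.
Proof.
move=> hH z0; rewrite -row_full_unit -cokermx_eq0; apply/eqP/frob0_eq0.
have := sqr_frob_shift z (cokermx (H - z%:M)) hH; rewrite mulmx_coker frob0 expr0n /=.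
move=> /esym/eqP; rewrite -exprMn paddr_eq0 ?sqr_ge0 // => /andP[_].
by rewrite sqrf_eq0 mulf_eq0 (negPf z0) => /eqP.
Qed.

Lemma frob_resolventMl m H z (B : 'M[R[i]]_(n, m)) :
  H \is hermsymmx -> complex.Im z != 0 ->
  frob (resolvent H z *m B) <= `|complex.Im z|^-1 * frob B.
Proof.
move=> hH z0; rewrite mulrC ler_pdivlMr ?normr_gt0 //.
apply: ler_of_sqr (frob_ge0 _) _.
rewrite -{2}(mulKVmx (hermitian_shift_unit hH z0) B) sqr_frob_shift //.
by rewrite exprMn real_normK ?num_real // mulrC lerDr sqr_ge0.
Qed.

Lemma resolvent_trC H z : H \is hermsymmx -> (resolvent H z) ^t* = resolvent H (Num.conj z).
Proof. by move=> hH; rewrite /resolvent trmx_inv map_invmx trC_shift. Qed.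

Lemma frob_resolventMr m H z (B : 'M[R[i]]_(m, n)) :
  H \is hermsymmx -> complex.Im z != 0 ->
  frob (B *m resolvent H z) <= `|complex.Im z|^-1 * frob B.
Proof.
move=> hH z0; rewrite -frob_trC -(frob_trC B) trmx_mul map_mxM resolvent_trC //.
by apply: le_trans (frob_resolventMl _ hH _) _; rewrite ImJ ?oppr_eq0 // normrN.
Qed.

Lemma frob_resolvent H z : H \is hermsymmx -> complex.Im z != 0 ->
  frob (resolvent H z) <= `|complex.Im z|^-1 * Num.sqrt n%:R.
Proof. by move=> hH z0; rewrite -[resolvent H z]mulmx1 -frob1 frob_resolventMl. Qed.

Lemma resolvent_sub H1 H2 z :
  H1 \is hermsymmx -> H2 \is hermsymmx -> complex.Im z != 0 ->
  resolvent H1 z = resolvent H2 z - resolvent H2 z *m (H1 - H2) *m resolvent H1 z.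
Proof.
move=> H1_herm H2_herm z0.
have -> : H1 - H2 = (H1 - z%:M) - (H2 - z%:M) by rewrite opprB addrA addrNK.
rewrite mulmxBr mulmxBl mulVmx ?hermitian_shift_unit // mul1mx.
by rewrite -mulmxA mulmxV ?hermitian_shift_unit // mulmx1 opprB addrC subrK.
Qed.

Lemma mulmx_resolvent H z : H \is hermsymmx -> complex.Im z != 0 ->
  H *m resolvent H z = 1%:M + z *: resolvent H z.
Proof.
move=> hH z0; rewrite -mul_scalar_mx -[1%:M](mulmxV (hermitian_shift_unit hH z0)).
by rewrite -mulmxDl subrK.
Qed.

Lemma normc_mxtrace_resolvent H z : H \is hermsymmx -> complex.Im z != 0 ->
  normc (\tr (resolvent H z)) <= `|complex.Im z|^-1 * n%:R.
Proof.
move=> hH z0; rewrite -[resolvent H z]mulmx1.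
apply: le_trans (normc_mxtraceM_le _ _) _; rewrite frob1.
rewrite -[X in _ <= _ * X]sqr_sqrtr ?ler0n // expr2 mulrA.
by rewrite ler_wpM2r ?sqrtr_ge0 ?frob_resolvent.
Qed.

End resolvent.

(** * Independence and expectation of complex random variables *)

Section product_of_independent.
Local Open Scope ereal_scope.

Lemma integral_prod_mul (d1 d2 : measure_display) (T1 : measurableType d1)
    (T2 : measurableType d2) (R : realType)
    (m1 : {sigma_finite_measure set T1 -> \bar R})
    (m2 : {sigma_finite_measure set T2 -> \bar R}) (f : T1 -> R) (g : T2 -> R) :
  m1.-integrable setT (EFin \o f) -> m2.-integrable setT (EFin \o g) ->
  (m1 \x m2).-integrable setT (fun z => (f z.1 * g z.2)%:E) /\
  \int[m1 \x m2]_z (f z.1 * g z.2)%:E = (\int[m1]_x (f x)%:E) * (\int[m2]_y (g y)%:E).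
Proof.
move=> f_int g_int.
have [/measurable_EFinP mf f_lty] := integrableP _ _ _ f_int.
have [/measurable_EFinP mg g_lty] := integrableP _ _ _ g_int.
have fg_int : (m1 \x m2).-integrable setT (fun z => (f z.1 * g z.2)%:E).
  apply/integrable12ltyP.
    apply/measurable_EFinP/measurable_funM.
      exact: (measurableT_comp mf measurable_fst).
    exact: (measurableT_comp mg measurable_snd).
  under eq_integral => x _.
    under eq_integral => y _ do rewrite /= normrM EFinM.
    rewrite ge0_integralZl //; last by do 2!apply: measurableT_comp => //.
    over.
  rewrite /= ge0_integralZr //; last by exact: integral_ge0.
    apply: lte_mul_pinfty => //; first exact: integral_ge0.
    by rewrite ge0_fin_numE //; exact: integral_ge0.
  by do 2!apply: measurableT_comp => //.
split=> //; rewrite -integral12_prod_meas1 //.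
rewrite -[X in _ = _ * X](fineK (integrable_fin_num _ g_int)) // -integralZr //.
apply: eq_integral => x _; rewrite /fubini_F /= fineK ?integrable_fin_num //.
by under eq_integral do rewrite EFinM; rewrite integralZl.
Qed.

Context (disp : measure_display) (T : measurableType disp) (R : realType)
  (P : probability T R).

Lemma joint_law_independent2 (X Y : {RV P >-> R}) (Z : {RV P >-> (R * R)%type}) :
  independent2 P X Y -> (forall t, Z t = (X t, Y t)) ->
  forall A, measurable A -> (distribution P X \x distribution P Y) A = distribution P Z A.
Proof.
move=> XY_indep ZE A mA; apply: product_measure_unique mA => B C mB mC.
rewrite -[RHS]XY_indep //; congr (P _); apply/seteqP.
by split=> t; rewrite /= ZE.
Qed.

Lemma expectation_mul_independent2 (X Y : T -> R) :
  independent2 P X Y ->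
  P.-integrable setT (EFin \o X) -> P.-integrable setT (EFin \o Y) ->
  P.-integrable setT (EFin \o (fun t => X t * Y t)%R) /\
  (\int[P]_t (X t * Y t) = (\int[P]_t X t) * (\int[P]_t Y t))%R.
Proof.
move=> XY_indep iX iY.
have /measurable_EFinP mX := measurable_int _ iX.
have /measurable_EFinP mY := measurable_int _ iY.
have mXY : measurable_fun setT (fun t => (X t, Y t)) by apply/measurable_fun_pairP; split.
pose X' : {RV P >-> R} := HB.pack X (isMeasurableFun.Build _ _ _ _ _ mX).
pose Y' : {RV P >-> R} := HB.pack Y (isMeasurableFun.Build _ _ _ _ _ mY).
pose Z' : {RV P >-> (R * R)%type} :=
  HB.pack (fun t => (X t, Y t)) (isMeasurableFun.Build _ _ _ _ _ mXY).
have law := @joint_law_independent2 X' Y' Z' XY_indep (fun=> erefl).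
have iX' : (distribution P X').-integrable setT (EFin \o id).
  by apply: (integrable_pushforward mX) => //; apply/measurable_EFinP.
have iY' : (distribution P Y').-integrable setT (EFin \o id).
  by apply: (integrable_pushforward mY) => //; apply/measurable_EFinP.
have [iZ' EZ'] := integral_prod_mul iX' iY'.
have mul_meas : measurable_fun setT (fun z : R * R => (z.1 * z.2)%:E).
  by apply/measurable_EFinP/measurable_funM.
have iXY : P.-integrable setT (EFin \o (fun t => X t * Y t)%R).
  apply/integrableP; split; first by apply/measurable_EFinP/measurable_funM.
  have [_] := integrableP _ _ _ iZ'.
  rewrite (eq_measure_integral (distribution P Z')) => [|A mA _]; last exact: law.
  by rewrite ge0_integral_distribution //; apply: measurableT_comp.
split=> //; rewrite /Rintegral -fineM; [|exact: integrable_fin_num..]; congr fine.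
rewrite -(integral_distribution (X := X') (f := EFin)) //.
rewrite -(integral_distribution (X := Y') (f := EFin)) // -[RHS]EZ'.
rewrite (eq_measure_integral (distribution P Z')) => [|A mA _]; last exact: law.
by rewrite integral_distribution.
Qed.

Lemma independent_g_sigma_algebra (G : set (set T)) (C : set T) :
  setI_closed G -> G setT -> G `<=` measurable -> measurable C ->
  (forall B, G B -> P (B `&` C) = P B * P C) ->
  forall B, <<s G >> B -> P (B `&` C) = P B * P C.
Proof.
move=> GI GT Gm mC GC B GB.
have PC : P C = (fine (P C))%:E by rewrite fineK // fin_num_measure.
have PC_ge0 : (0 <= fine (P C))%R by rewrite fine_ge0.
have := @g_sigma_algebra_measure_unique _ R T G Gm (fun=> setT) (fun=> GT) _
  (mrestr P mC) (mscale (NngNum PC_ge0) P) GI _ _ _ GB.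
rewrite /= /mrestr /mscale /= => ->; first by rewrite muleC -PC.
- by apply/seteqP; split => // t _; exists 0%N.
- by move=> A GA; rewrite GC // muleC -PC.
- by move=> _; rewrite setTI PC ltry.
Qed.

End product_of_independent.

Section cylinders.
Context (disp : measure_display) (T : measurableType disp) (R : realType)
  (P : probability T R).
Context (disp' : measure_display) (T' : measurableType disp') (I : finType)
  (X : I -> T -> T').
Implicit Types J K : {set I}.

Definition cylinders J : set (set T) :=
  [set B | exists2 A : I -> set T', (forall i, measurable (A i)) &
     B = \bigcap_(i in [set` J]) (X i @^-1` A i)].

Definition sub_sigma J : measurableType _ := g_sigma_algebraType (cylinders J).

Lemma cylinders_setI J : setI_closed (cylinders J).
Proof.
move=> _ _ [A mA ->] [B mB ->]; exists (fun i => A i `&` B i).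
  by move=> i; apply: measurableI.
by rewrite -bigcapI; apply: eq_bigcapr => i _; rewrite preimage_setI.
Qed.

Lemma cylinders_setT J : cylinders J setT.
Proof.
exists (fun=> setT) => //.
by apply/esym/seteqP; split => // t _ i _.
Qed.

Lemma measurable_sub_sigma J i : i \in J ->
  measurable_fun setT (X i : sub_sigma J -> T').
Proof.
move=> iJ _ A mA; rewrite setTI; apply: sub_sigma_algebra.
exists (fun j => if j == i then A else setT).
  by move=> j; case: ifP.
apply/seteqP; split => t /=.
  by move=> At j _ /=; case: eqP => [->|].
by move=> /(_ i iJ) /=; rewrite eqxx.
Qed.

Hypothesis mX : forall i, measurable_fun setT (X i).

Lemma cylinders_measurable J : cylinders J `<=` measurable.
Proof.
move=> _ [A mA ->]; apply: fin_bigcap_measurable => [|i _].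
  exact: finite_finset.
by rewrite -[_ @^-1` _]setTI; apply: mX.
Qed.

Lemma sub_sigma_measurable J (A : set T) :
  measurable (A : set (sub_sigma J)) -> measurable A.
Proof.
by move=> mA; apply: (smallest_sub (@sigma_algebra_measurable _ T)
  (@cylinders_measurable J)).
Qed.

Lemma sub_sigma_measurable_fun d2 (U : measurableType d2) J (f : T -> U) :
  measurable_fun setT (f : sub_sigma J -> U) -> measurable_fun setT f.
Proof. by move=> mf _ A mA; apply: (@sub_sigma_measurable J); apply: mf. Qed.

Hypothesis X_indep : mutually_independent P X.

Lemma cylinders_independent J K (A B : set T) : [disjoint J & K]%B ->
  cylinders J A -> cylinders K B -> P (A `&` B) = (P A * P B)%E.
Proof.
move=> JK [U mU ->] [V mV ->]; pose W i := if i \in J then U i else V i.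
have mW i : measurable (W i) by rewrite /W; case: ifP.
have UE : \bigcap_(i in [set` J]) X i @^-1` U i = \bigcap_(i in [set` J]) X i @^-1` W i.
  by apply: eq_bigcapr => i /= iJ; rewrite /W iJ.
have VE : \bigcap_(i in [set` K]) X i @^-1` V i = \bigcap_(i in [set` K]) X i @^-1` W i.
  by apply: eq_bigcapr => i /= iK; rewrite /W (disjointFl JK iK).
rewrite UE VE -bigcap_setU.
have -> : [set` J] `|` [set` K] = [set` J :|: K].
  by apply/seteqP; split => i /=; rewrite inE => /orP.
rewrite !X_indep // (eq_bigl [in [predU J & K]]); last by move=> i; rewrite !inE.
by rewrite bigU.
Qed.

Lemma sub_sigma_independent J K (A B : set T) : [disjoint J & K]%B ->
  measurable (A : set (sub_sigma J)) -> measurable (B : set (sub_sigma K)) ->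
  P (A `&` B) = (P A * P B)%E.
Proof.
move=> JK mA mB; apply: (independent_g_sigma_algebra (@cylinders_setI J)
  (cylinders_setT J) (@cylinders_measurable J) (sub_sigma_measurable mB)) mA => C cylC.
rewrite setIC muleC.
apply: (independent_g_sigma_algebra (@cylinders_setI K)
  (cylinders_setT K) (@cylinders_measurable K) (cylinders_measurable cylC)) mB => D cylD.
by rewrite muleC setIC; apply: cylinders_independent JK cylC cylD.
Qed.

Lemma sub_sigma_independent2 J K (f g : T -> R) : [disjoint J & K]%B ->
  measurable_fun setT (f : sub_sigma J -> R) ->
  measurable_fun setT (g : sub_sigma K -> R) -> independent2 P f g.
Proof.
move=> JK mf mg A B mA mB; apply: sub_sigma_independent JK _ _.
  by rewrite -[_ @^-1` _]setTI; exact: mf.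
by rewrite -[_ @^-1` _]setTI; exact: mg.
Qed.

End cylinders.

Section complex_measurability.
Context (R : realType).

Lemma measurable_invr : measurable_fun setT (@GRing.inv R).
Proof.
rewrite -(setvU [set 0 : R]); apply/measurable_funU => //; first exact: measurableC.
split; last exact: measurable_fun_set1.
apply: open_continuous_measurable_fun; first by rewrite openC; exact: closed_eq.
by move=> x; rewrite inE => /eqP x0; exact: inv_continuous.
Qed.

Lemma measurable_sqrtr : measurable_fun setT (@Num.sqrt R).
Proof. by apply: continuous_measurable_fun; exact: sqrt_continuous. Qed.

Definition cmeasurable (d : measure_display) (D : measurableType d)
    (f : D -> R[i]) : Prop :=
  measurable_fun setT (fun t => complex.Re (f t)) /\
  measurable_fun setT (fun t => complex.Im (f t)).

Context (d : measure_display) (D : measurableType d).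
Implicit Types f g : D -> R[i].

Lemma cmeasurable_cst (c : R[i]) : cmeasurable (fun _ : D => c).
Proof. by split; apply: measurable_cst. Qed.

Lemma cmeasurableD f g : cmeasurable f -> cmeasurable g ->
  cmeasurable (fun t => f t + g t).
Proof.
move=> [Ref Imf] [Reg Img]; split.
  by under eq_fun do rewrite raddfD; apply: measurable_funD.
by under eq_fun do rewrite raddfD; apply: measurable_funD.
Qed.

Lemma cmeasurableM f g : cmeasurable f -> cmeasurable g ->
  cmeasurable (fun t => f t * g t).
Proof.
move=> [Ref Imf] [Reg Img]; split.
  by under eq_fun do rewrite ReM; apply: measurable_funB; apply: measurable_funM.
by under eq_fun do rewrite ImM; apply: measurable_funD; apply: measurable_funM.
Qed.

Lemma cmeasurableJ f : cmeasurable f -> cmeasurable (fun t => Num.conj (f t)).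
Proof.
move=> [Ref Imf]; split; first by under eq_fun do rewrite ReJ.
by under eq_fun do rewrite ImJ; apply: measurableT_comp.
Qed.

Lemma cmeasurableV f : cmeasurable f -> cmeasurable (fun t => (f t)^-1).
Proof.
move=> [Ref Imf]; pose q t := complex.Re (f t) ^+ 2 + complex.Im (f t) ^+ 2.
have mqV : measurable_fun setT (fun t => (q t)^-1).
  apply: (measurableT_comp measurable_invr).
  by apply: measurable_funD; apply: measurable_funX.
split.
  rewrite (_ : (fun t => _) = (fun t => complex.Re (f t) * (q t)^-1)).
    exact: measurable_funM.
  by apply/funext => t; rewrite /q; case: (f t).
rewrite (_ : (fun t => _) = (fun t => - (complex.Im (f t) * (q t)^-1))).
  by apply: measurableT_comp => //; apply: measurable_funM.
by apply/funext => t; rewrite /q; case: (f t).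
Qed.

Lemma cmeasurable_sum (I : Type) (r : seq I) (Q : pred I) (F : I -> D -> R[i]) :
  (forall i, cmeasurable (F i)) -> cmeasurable (fun t => \sum_(i <- r | Q i) F i t).
Proof.
move=> mF; elim: r => [|i r IH].
  by under eq_fun do rewrite big_nil; apply: cmeasurable_cst.
by under eq_fun do rewrite big_cons; case: (Q i) => //; exact: cmeasurableD.
Qed.

Lemma cmeasurable_prod (I : Type) (r : seq I) (Q : pred I) (F : I -> D -> R[i]) :
  (forall i, cmeasurable (F i)) -> cmeasurable (fun t => \prod_(i <- r | Q i) F i t).
Proof.
move=> mF; elim: r => [|i r IH].
  by under eq_fun do rewrite big_nil; apply: cmeasurable_cst.
by under eq_fun do rewrite big_cons; case: (Q i) => //; exact: cmeasurableM.
Qed.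

Lemma measurable_normc f : cmeasurable f -> measurable_fun setT (fun t => normc (f t)).
Proof.
move=> [Ref Imf]; rewrite (_ : (fun t => _) = (fun t =>
    Num.sqrt (complex.Re (f t) ^+ 2 + complex.Im (f t) ^+ 2))).
  apply: (measurableT_comp measurable_sqrtr).
  by apply: measurable_funD; apply: measurable_funX.
by apply/funext => t; case: (f t).
Qed.

Definition mxmeasurable (m n : nat) (A : D -> 'M[R[i]]_(m, n)) : Prop :=
  forall i j, cmeasurable (fun t => A t i j).

Lemma mxmeasurable_cst m n (A : 'M[R[i]]_(m, n)) : mxmeasurable (fun=> A).
Proof. by move=> i j; apply: cmeasurable_cst. Qed.

Lemma mxmeasurableD m n (A B : D -> 'M[R[i]]_(m, n)) :
  mxmeasurable A -> mxmeasurable B -> mxmeasurable (fun t => A t + B t).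
Proof.
by move=> mA mB i j; under eq_fun do rewrite mxE; apply: cmeasurableD.
Qed.

Lemma mxmeasurableZ m n (c : R[i]) (A : D -> 'M[R[i]]_(m, n)) :
  mxmeasurable A -> mxmeasurable (fun t => c *: A t).
Proof.
move=> mA i j; under eq_fun do rewrite mxE.
by apply: cmeasurableM; first exact: cmeasurable_cst.
Qed.

Lemma mxmeasurable_sum m n (I : Type) (r : seq I) (Q : pred I)
    (F : I -> D -> 'M[R[i]]_(m, n)) :
  (forall i, Q i -> mxmeasurable (F i)) ->
  mxmeasurable (fun t => \sum_(i <- r | Q i) F i t).
Proof.
move=> mF; elim: r => [|i r IH].
  by under eq_fun do rewrite big_nil; apply: mxmeasurable_cst.
under eq_fun do rewrite big_cons; case: (boolP (Q i)) => // Qi.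
by apply: mxmeasurableD => //; exact: mF.
Qed.

Lemma mxmeasurableM m n p (A : D -> 'M[R[i]]_(m, n)) (B : D -> 'M[R[i]]_(n, p)) :
  mxmeasurable A -> mxmeasurable B -> mxmeasurable (fun t => A t *m B t).
Proof.
move=> mA mB i j; under eq_fun do rewrite mxE.
by apply: cmeasurable_sum => k; apply: cmeasurableM.
Qed.

Lemma mxmeasurable_trC m n (A : D -> 'M[R[i]]_(m, n)) :
  mxmeasurable A -> mxmeasurable (fun t => (A t) ^t*).
Proof. by move=> mA i j; under eq_fun do rewrite !mxE; apply: cmeasurableJ. Qed.

Lemma cmeasurable_mxtrace n (A : D -> 'M[R[i]]_n) :
  mxmeasurable A -> cmeasurable (fun t => \tr (A t)).
Proof. by move=> mA; apply: cmeasurable_sum => i; apply: mA. Qed.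

Lemma cmeasurable_det n (A : D -> 'M[R[i]]_n) :
  mxmeasurable A -> cmeasurable (fun t => \det (A t)).
Proof.
move=> mA; apply: cmeasurable_sum => s; apply: cmeasurableM.
  exact: cmeasurable_cst.
by apply: cmeasurable_prod => i; apply: mA.
Qed.

Lemma mxmeasurable_invmx n (A : D -> 'M[R[i]]_n) : (forall t, A t \in unitmx) ->
  mxmeasurable A -> mxmeasurable (fun t => invmx (A t)).
Proof.
move=> uA mA i j; under eq_fun do rewrite /invmx uA !mxE.
apply: cmeasurableM; first exact/cmeasurableV/cmeasurable_det.
apply: cmeasurableM; first exact: cmeasurable_cst.
by apply: cmeasurable_det => k l; under eq_fun do rewrite !mxE.
Qed.

Lemma mxmeasurable_resolvent n (H : D -> 'M[R[i]]_n) (z : R[i]) :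
  (forall t, H t \is hermsymmx) -> complex.Im z != 0 -> mxmeasurable H ->
  mxmeasurable (fun t => resolvent (H t) z).
Proof.
move=> hH z0 mH; apply: mxmeasurable_invmx => [t|]; first exact: hermitian_shift_unit.
by apply: mxmeasurableD => //; exact: mxmeasurable_cst.
Qed.

Lemma measurable_frob m n (A : D -> 'M[R[i]]_(m, n)) :
  mxmeasurable A -> measurable_fun setT (fun t => frob (A t)).
Proof.
move=> mA; apply: (measurableT_comp measurable_sqrtr).
by do 2!(apply: measurable_sum => ?); apply: measurable_funX; apply: measurable_normc.
Qed.

End complex_measurability.

Section complex_expectation.
Context (disp : measure_display) (T : measurableType disp) (R : realType)
  (P : probability T R).

Definition rintegrable (X : T -> R) : Prop := P.-integrable setT (EFin \o X).

Implicit Types (X Y : T -> R) (F G : T -> R[i]) (c : R[i]).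

Lemma rintegrable_cst (a : R) : rintegrable (fun=> a).
Proof. exact: finite_measure_integrable_cst. Qed.

Lemma rintegrableD X Y : rintegrable X -> rintegrable Y ->
  rintegrable (fun t => X t + Y t).
Proof. by move=> iX iY; apply: (integrableD measurableT iX iY). Qed.

Lemma rintegrableZ (a : R) X : rintegrable X -> rintegrable (fun t => a * X t).
Proof. by move=> iX; apply: (integrableZl measurableT _ iX). Qed.

Lemma rintegrable_sum (I : Type) (r : seq I) (Q : pred I) (F : I -> T -> R) :
  (forall i, Q i -> rintegrable (F i)) ->
  rintegrable (fun t => \sum_(i <- r | Q i) F i t).
Proof.
move=> iF; rewrite /rintegrable (_ : _ \o _ = fun t => \sum_(i <- r | Q i) (F i t)%:E)%E.
  exact: integrable_sum.
by apply/funext => t; rewrite /= sumEFin.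
Qed.

Lemma rintegrable_le X Y : measurable_fun setT X -> rintegrable Y ->
  (forall t, `|X t| <= Y t) -> rintegrable X.
Proof.
move=> mX iY XY; apply: le_integrable iY => //; first exact/measurable_EFinP.
by move=> t _ /=; rewrite lee_fin; apply: le_trans (XY t) _; exact: ler_norm.
Qed.

Lemma Rintegral_prob_cst (a : R) : \int[P]_t a = a.
Proof. by rewrite Rintegral_cst // [X in fine X](probability_setT P) mulr1. Qed.

Lemma Rintegral_sum (I : Type) (r : seq I) (Q : pred I) (F : I -> T -> R) :
  (forall i, Q i -> rintegrable (F i)) ->
  \int[P]_t (\sum_(i <- r | Q i) F i t) = \sum_(i <- r | Q i) \int[P]_t F i t.
Proof.
move=> iF; elim: r => [|i r IH].
  by rewrite big_nil; under eq_Rintegral do rewrite big_nil; exact: Rintegral_prob_cst.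
rewrite big_cons; under eq_Rintegral do rewrite big_cons.
case: ifPn => // Qi; rewrite RintegralD ?IH //; first exact: iF.
exact: rintegrable_sum.
Qed.

Definition cintegrable F : Prop :=
  rintegrable (fun t => complex.Re (F t)) /\ rintegrable (fun t => complex.Im (F t)).

Definition cexpectation F : R[i] :=
  (\int[P]_t complex.Re (F t)) +i* (\int[P]_t complex.Im (F t)).

Lemma cintegrable_le F Y : cmeasurable F -> rintegrable Y ->
  (forall t, normc (F t) <= Y t) -> cintegrable F.
Proof.
move=> [mr mi] iY FY; split; apply: rintegrable_le iY _ => // t.
  exact: le_trans (normr_Re_le _) (FY t).
exact: le_trans (normr_Im_le _) (FY t).
Qed.

Lemma cintegrable_bounded (a : R) F : cmeasurable F ->
  (forall t, normc (F t) <= a) -> cintegrable F.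
Proof. by move=> mF; apply: cintegrable_le => //; exact: rintegrable_cst. Qed.

Lemma cintegrable_cst c : cintegrable (fun=> c).
Proof. by split; apply: rintegrable_cst. Qed.

Lemma cexpectation_cst c : cexpectation (fun=> c) = c.
Proof. by case: c => a b; rewrite /cexpectation /= !Rintegral_prob_cst. Qed.

Lemma cexpectation_real X : cexpectation (fun t => (X t)%:C) = (\int[P]_t X t)%:C.
Proof. by rewrite /cexpectation /= Rintegral_prob_cst. Qed.

Lemma cintegrableD F G : cintegrable F -> cintegrable G ->
  cintegrable (fun t => F t + G t).
Proof.
move=> [ReF ImF] [ReG ImG]; split.
  by under eq_fun do rewrite raddfD; apply: rintegrableD.
by under eq_fun do rewrite raddfD; apply: rintegrableD.
Qed.

Lemma cexpectationD F G : cintegrable F -> cintegrable G ->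
  cexpectation (fun t => F t + G t) = cexpectation F + cexpectation G.
Proof.
move=> [ReF ImF] [ReG ImG]; apply: complex_eqP; rewrite raddfD /cexpectation /=.
  by under eq_Rintegral do rewrite raddfD; rewrite RintegralD.
by under eq_Rintegral do rewrite raddfD; rewrite RintegralD.
Qed.

Lemma cintegrableZ c F : cintegrable F -> cintegrable (fun t => c * F t).
Proof.
move=> [ReF ImF]; split.
  by under eq_fun do rewrite ReM -mulNr; apply: rintegrableD; apply: rintegrableZ.
by under eq_fun do rewrite ImM; apply: rintegrableD; apply: rintegrableZ.
Qed.

Lemma cexpectationZ c F : cintegrable F ->
  cexpectation (fun t => c * F t) = c * cexpectation F.
Proof.
move=> [ReF ImF]; apply: complex_eqP; rewrite ?ReM ?ImM /cexpectation /=.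
  under eq_Rintegral do rewrite ReM -mulNr.
  by rewrite RintegralD ?RintegralZl ?mulNr //; exact: rintegrableZ.
under eq_Rintegral do rewrite ImM.
by rewrite RintegralD ?RintegralZl //; exact: rintegrableZ.
Qed.

Lemma cintegrableN F : cintegrable F -> cintegrable (fun t => - F t).
Proof. by move=> iF; under eq_fun do rewrite -mulN1r; exact: cintegrableZ. Qed.

Lemma cexpectationN F : cintegrable F ->
  cexpectation (fun t => - F t) = - cexpectation F.
Proof. by move=> iF; under eq_fun do rewrite -mulN1r; rewrite cexpectationZ // mulN1r. Qed.

Lemma cintegrable_sum (I : Type) (r : seq I) (Q : pred I) (F : I -> T -> R[i]) :
  (forall i, cintegrable (F i)) -> cintegrable (fun t => \sum_(i <- r | Q i) F i t).
Proof.
by move=> iF; split; under eq_fun do rewrite raddf_sum;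
  apply: rintegrable_sum => i _; have [] := iF i.
Qed.

Lemma cexpectation_sum (I : Type) (r : seq I) (Q : pred I) (F : I -> T -> R[i]) :
  (forall i, cintegrable (F i)) ->
  cexpectation (fun t => \sum_(i <- r | Q i) F i t) =
  \sum_(i <- r | Q i) cexpectation (F i).
Proof.
move=> iF; apply: complex_eqP; rewrite raddf_sum /cexpectation /=;
  under eq_Rintegral do rewrite raddf_sum;
  by rewrite Rintegral_sum // => i _; have [] := iF i.
Qed.

Lemma cexpectationJ F : cintegrable F ->
  cexpectation (fun t => Num.conj (F t)) = Num.conj (cexpectation F).
Proof.
move=> [ReF ImF]; apply: complex_eqP; rewrite ?ReJ ?ImJ /cexpectation /=.
  by under eq_Rintegral do rewrite ReJ.
by under eq_Rintegral do rewrite ImJ -mulN1r; rewrite RintegralZl // mulN1r.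
Qed.

Lemma Re_cexpectation_le F (a : R) : cintegrable F ->
  (forall t, complex.Re (F t) <= a) -> complex.Re (cexpectation F) <= a.
Proof.
move=> [ReF _] Fa; rewrite -[leRHS]Rintegral_prob_cst.
by apply: le_Rintegral => //; exact: rintegrable_cst.
Qed.

Context (disp' : measure_display) (T' : measurableType disp') (I : finType)
  (X : I -> T -> T').
Hypotheses (mX : forall i, measurable_fun setT (X i))
  (X_indep : mutually_independent P X).

Lemma cmeasurable_sub_sigma (J : {set I}) F :
  cmeasurable (F : sub_sigma X J -> R[i]) -> cmeasurable F.
Proof.
by move=> [ReF ImF]; split; apply: (sub_sigma_measurable_fun mX (J := J)).
Qed.

Lemma cexpectation_mul_sub_sigma (J K : {set I}) F G : [disjoint J & K]%B ->
  cmeasurable (F : sub_sigma X J -> R[i]) -> cmeasurable (G : sub_sigma X K -> R[i]) ->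
  cintegrable F -> cintegrable G ->
  cintegrable (fun t => F t * G t) /\
  cexpectation (fun t => F t * G t) = cexpectation F * cexpectation G.
Proof.
move=> JK [mF1 mF2] [mG1 mG2] [iF1 iF2] [iG1 iG2].
have mul f g mf mg := @expectation_mul_independent2 _ T R P f g
  (sub_sigma_independent2 mX X_indep JK mf mg).
have [i11 e11] := mul _ _ mF1 mG1 iF1 iG1; have [i12 e12] := mul _ _ mF1 mG2 iF1 iG2.
have [i21 e21] := mul _ _ mF2 mG1 iF2 iG1; have [i22 e22] := mul _ _ mF2 mG2 iF2 iG2.
have ReE t : complex.Re (F t * G t) = complex.Re (F t) * complex.Re (G t)
   + -1 * (complex.Im (F t) * complex.Im (G t)) by rewrite ReM mulN1r.
split.
  split; first by under eq_fun do rewrite ReE; apply/rintegrableD/rintegrableZ.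
  by under eq_fun do rewrite ImM; apply/rintegrableD.
apply: complex_eqP; rewrite ?ReM ?ImM /cexpectation /=.
  under eq_Rintegral do rewrite ReE.
  by rewrite RintegralD ?RintegralZl ?e11 ?e22 ?mulN1r //; exact: rintegrableZ.
by under eq_Rintegral do rewrite ImM; rewrite RintegralD // e12 e21.
Qed.

End complex_expectation.

(** * Gaussian moments *)

Section elementary_inequalities.
Variable R : realDomainType.
Implicit Types x y : R.

Lemma ler_expr_1D x m n : 0 <= x -> (m <= n)%N -> x ^+ m <= 1 + x ^+ n.
Proof.
move=> x0 mn; have [x1|/ltW x1] := leP x 1.
  by rewrite (@le_trans _ _ 1) ?exprn_ile1 // lerDl exprn_ge0.
by rewrite (@le_trans _ _ (x ^+ n)) ?ler_weXn2l // lerDr.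
Qed.

Lemma sqr_add_le x y : (x + y) ^+ 2 <= 2 * (x ^+ 2 + y ^+ 2).
Proof. by rewrite -subr_ge0 (_ : _ - _ = (x - y) ^+ 2) ?sqr_ge0 //; ring. Qed.

Lemma expr4_add_le x y : (x + y) ^+ 4 <= 8 * (x ^+ 4 + y ^+ 4).
Proof.
rewrite -[4%N]/(2 * 2)%N !exprM.
apply: (@le_trans _ _ ((2 * (x ^+ 2 + y ^+ 2)) ^+ 2)).
  by rewrite ler_sqr ?nnegrE ?sqr_add_le ?sqr_ge0 ?mulr_ge0 ?addr_ge0 ?sqr_ge0.
rewrite exprMn (_ : 8 = 2 ^+ 2 * 2); last by ring.
by rewrite -mulrA ler_wpM2l ?sqr_add_le.
Qed.

End elementary_inequalities.

Lemma expR_ge_monomial (R : realType) (x : R) k : 0 <= x -> x ^+ k / k`!%:R <= expR x.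
Proof.
case: k => [|k] x0; first by rewrite expr0 fact0 invr1 mulr1 -expR0 ler_expR.
by apply: le_trans (expR_ge1Dxn k x0); rewrite lerDr.
Qed.

Section density.
Import HBSimple HBNNSimple.
Context (d : measure_display) (T : measurableType d) (R : realType)
  (mu nu : {measure set T -> \bar R}) (h : T -> R).
Hypotheses (h_meas : measurable_fun setT h) (h_ge0 : forall x, 0 <= h x)
  (nuE : forall A, measurable A -> nu A = (\int[mu]_(x in A) (h x)%:E)%E).

Lemma integral_density_nnsfun (g : {nnsfun T >-> R}) :
  (\int[nu]_x (g x)%:E = \int[mu]_x (g x * h x)%:E)%E.
Proof.
have fiber_meas (y : R) : measurable (g @^-1` [set y]) by [].
pose piece y x : R := y * (\1_(g @^-1` [set y]) x * h x).
have piece_ge0 y x : 0 <= piece y x.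
  rewrite /piece indicE; case: (boolP (x \in _)) => [/set_mem /= <-|_].
    by rewrite mul1r mulr_ge0.
  by rewrite mul0r mulr0.
have indic_h_meas y : measurable_fun setT (fun x => \1_(g @^-1` [set y]) x * h x).
  by apply: measurable_funM => //; exact: measurable_indic.
transitivity (\int[mu]_x (\sum_(y \in range g) (piece y x)%:E))%E; last first.
  apply: eq_integral => x _; rewrite fsumEFin //; congr (_%:E).
  by rewrite [in RHS](fimfunE g x) mulr_fsuml; apply: eq_fsbigr => y _; rewrite /piece mulrA.
rewrite ge0_integral_fsum //; last 2 first.
- by move=> y; apply/measurable_EFinP; exact: measurable_funM.
- by move=> y x _; rewrite lee_fin.
rewrite integralT_nnsfun sintegralE; apply: eq_fsbigr => y /set_mem[x _ <-].
rewrite nuE // integral_mkcond -ge0_integralZl //.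
- apply: eq_integral => u _; rewrite /piece EFinM patchE indicE.
  by case: (_ \in _); rewrite ?mul1r ?mul0r.
- apply/(measurable_restrict _ _ _).1 => //; apply/measurable_EFinP.
  exact: measurable_funTS.
- by move=> u _; rewrite patchE; case: ifP => // _; rewrite lee_fin.
- by rewrite lee_fin.
Qed.

Lemma ge0_integral_density (f : T -> R) :
  measurable_fun setT f -> (forall x, 0 <= f x) ->
  (\int[nu]_x (f x)%:E = \int[mu]_x (f x * h x)%:E)%E.
Proof.
move=> f_meas f_ge0; have f_emeas : measurable_fun setT (EFin \o f) by exact/measurable_EFinP.
pose g := nnsfun_approx measurableT f_emeas.
have g_cvg x : (g n x)%:E @[n --> \oo] --> (f x)%:E.
  by apply: cvg_nnsfun_approx => // u _; rewrite lee_fin.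
have g_nd x : nondecreasing_seq (fun n => g n x).
  by move=> m n mn; exact/lefP/nd_nnsfun_approx.
have mono (la : {measure set T -> \bar R}) (k : T -> R) : measurable_fun setT k ->
    (forall x, 0 <= k x) ->
    (\int[la]_x (g n x * k x)%:E @[n --> \oo] --> \int[la]_x (f x * k x)%:E)%E.
  move=> k_meas k_ge0.
  rewrite (_ : (fun x => (f x * k x)%:E) = fun x => limn (fun n => (g n x * k x)%:E)).
    apply: cvg_monotone_convergence => //.
    - by move=> n; apply/measurable_EFinP; exact: measurable_funM.
    - by move=> n x _; rewrite lee_fin mulr_ge0.
    - by move=> x _ m n mn; rewrite lee_fin ler_wpM2r // g_nd.
  apply/funext => x; apply/esym/cvg_lim => //; rewrite EFinM.
  by under eq_fun do rewrite EFinM; apply: cvgeZr.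
have := mono nu (fun=> 1) (measurable_cst _) (fun=> ler01).
under eq_fun do under eq_integral do rewrite mulr1.
under eq_integral do rewrite mulr1.
under eq_fun do rewrite integral_density_nnsfun.
by move=> /cvg_unique; apply => //; exact: mono.
Qed.

End density.

Lemma ge0_integral_normal_prob (R : realType) (m s : R) (f : R -> R) :
  measurable_fun setT f -> (forall x, 0 <= f x) ->
  (\int[normal_prob m s]_x (f x)%:E =
   \int[@lebesgue_measure R]_x (f x * normal_pdf m s x)%:E)%E.
Proof.
move=> f_meas f_ge0.
apply: (@ge0_integral_density _ _ _ lebesgue_measure (normal_prob m s)) => // [|x].
  exact: measurable_normal_pdf.
exact: normal_pdf_ge0.
Qed.

Section centered_normal.
Context (R : realType) (s : R).
Hypothesis s_gt0 : 0 < s.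
Local Notation mu := (@lebesgue_measure R).
Local Notation pdf := (normal_pdf 0 s).

Let s_neq0 : s != 0. Proof. by rewrite gt_eqF. Qed.

Let measurable_pdf : measurable_fun setT pdf.
Proof. exact: measurable_normal_pdf. Qed.

Lemma centered_normal_pdfE (r x : R) : r != 0 ->
  normal_pdf 0 r x = normal_peak r * expR (- x ^+ 2 / (r ^+ 2 *+ 2)).
Proof. by move=> r0; rewrite normal_pdfE //= /normal_fun subr0. Qed.

Lemma centered_normal_pdfN x : pdf (- x) = pdf x.
Proof. by rewrite !centered_normal_pdfE // sqrrN. Qed.

(* [u = 1 / (2 s^2) - 1 / (2 (2 s)^2)] is the gap between the two Gaussian exponents. *)
Lemma normal_pdf_expr_le k : exists2 C, 0 <= C &
  forall x, x ^+ (2 * k) * pdf x <= C * normal_pdf 0 (2 * s) x.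
Proof.
have s2_neq0 : 2 * s != 0 by rewrite mulf_neq0.
pose u := 3 / (8 * s ^+ 2).
have u_gt0 : 0 < u by rewrite divr_gt0 // mulr_gt0 // exprn_gt0.
have peak_gt0 : 0 < normal_peak (2 * s) by exact: normal_peak_gt0.
exists (k`!%:R / u ^+ k * (normal_peak s / normal_peak (2 * s))).
  by rewrite mulr_ge0 ?divr_ge0 ?normal_peak_ge0 ?ler0n ?exprn_ge0 ?(ltW u_gt0).
move=> x; rewrite !centered_normal_pdfE //.
have expE : expR (- x ^+ 2 / ((2 * s) ^+ 2 *+ 2)) =
    expR (- x ^+ 2 / (s ^+ 2 *+ 2)) * expR (u * x ^+ 2).
  rewrite -expRD; congr expR.
  by rewrite /u -(mulr_natl (s ^+ 2)) -(mulr_natl ((2 * s) ^+ 2)); field.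
have pow_le : x ^+ (2 * k) <= k`!%:R / u ^+ k * expR (u * x ^+ 2).
  rewrite mulrAC ler_pdivlMr ?exprn_gt0 // exprM -exprMn [_ * u]mulrC [leRHS]mulrC.
  rewrite -ler_pdivrMr ?ltr0n ?fact_gt0 //; apply: expR_ge_monomial.
  by rewrite mulr_ge0 ?sqr_ge0 ?ltW.
rewrite expE; set E := expR _; set G := expR (u * _) in pow_le *.
rewrite [leRHS](_ : _ = k`!%:R / u ^+ k * G * (normal_peak s * E)); last first.
  by field; rewrite (gt_eqF peak_gt0) expf_neq0 // gt_eqF.
by rewrite ler_wpM2r // mulr_ge0 ?expR_ge0 ?normal_peak_ge0.
Qed.

Lemma integral_normal_expr_lty k : (\int[normal_prob 0 s]_x (x ^+ (2 * k))%:E < +oo)%E.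
Proof.
have pow_ge0 (x : R) : 0 <= x ^+ (2 * k) by rewrite exprM exprn_ge0 ?sqr_ge0.
have [C C0 pdf_le] := normal_pdf_expr_le k.
rewrite ge0_integral_normal_prob //.
apply: (@le_lt_trans _ _ (\int[mu]_x (C%:E * (normal_pdf 0 (2 * s) x)%:E))%E).
  apply: ge0_le_integral => //.
  - by move=> x _; rewrite lee_fin mulr_ge0 ?normal_pdf_ge0.
  - by apply/measurable_EFinP; apply: measurable_funM => //; exact: measurable_funX.
  - by apply/measurable_EFinP; apply: measurable_funM => //; exact: measurable_normal_pdf.
  - by move=> x _; rewrite -EFinM lee_fin.
rewrite ge0_integralZl //.
- by rewrite integral_normal_pdf mule1 ltry.
- by apply/measurable_EFinP; exact: measurable_normal_pdf.
- by move=> x _; rewrite lee_fin normal_pdf_ge0.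
Qed.

Lemma cvg_mul_expR_sqr (a : R) : 0 < a -> x * expR (- x ^+ 2 / a) @[x --> +oo%R] --> (0 : R).
Proof.
move=> a0; apply: (@squeeze_cvgr _ _ _ _ (fun=> 0) (fun x => a * x^-1)); last 2 first.
- exact: cvg_cst.
- rewrite -(mulr0 a); apply: cvgMr; apply/(@gtr0_cvgV0 _ _ _ _ id) => //.
  exact: nbhs_pinfty_gt.
near=> x; have x0 : 0 < x by near: x; exact: nbhs_pinfty_gt.
rewrite mulr_ge0 ?expR_ge0 ?(ltW x0) //= mulNr expRN ler_pdivrMr ?expR_gt0 //.
apply: (@le_trans _ _ (a * x^-1 * (x ^+ 2 / a))); last first.
  rewrite ler_wpM2l ?mulr_ge0 ?invr_ge0 ?(ltW a0) ?(ltW x0) //.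
  by apply: le_trans (expR_ge1Dx _); rewrite lerDr.
by rewrite [leRHS](_ : _ = x) //; field; rewrite !gt_eqF.
Unshelve. all: by end_near. Qed.

Let F (x : R) : R := - (x * (normal_peak s * expR (- x ^+ 2 / (s ^+ 2 *+ 2)))).
Let F' (x : R) : R := (x ^+ 2 / s ^+ 2 - 1) * pdf x.

Let is_derive_F (x : R) : is_derive x 1 F (F' x).
Proof.
rewrite /F /F' centered_normal_pdfE //; apply: is_derive_eq.
by rewrite /GRing.scale /= -(mulr_natl (s ^+ 2)); field.
Qed.

Let continuous_F : continuous F.
Proof.
by move=> x; apply/differentiable_continuous/derivable1_diffP; case: (is_derive_F x).
Qed.

Let continuous_F' : continuous F'.
Proof.
move=> x; apply: cvgM; last exact: continuous_normal_pdf.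
by apply: cvgB; [apply: cvgMl; exact: exprn_continuous|exact: cvg_cst].
Qed.

Let pdf_integrable : mu.-integrable setT (EFin \o pdf).
Proof. exact: integrable_normal_pdf. Qed.

Let sqr_pdf_integrable : mu.-integrable setT (EFin \o (fun x => x ^+ 2 * pdf x)).
Proof.
have sqr_pdf_ge0 x : 0 <= x ^+ 2 * pdf x by rewrite mulr_ge0 ?sqr_ge0 ?normal_pdf_ge0.
apply/integrableP; split; first by apply/measurable_EFinP/measurable_funM.
under eq_integral => x _ do rewrite gee0_abs ?lee_fin //.
rewrite -ge0_integral_normal_prob; [exact: (integral_normal_expr_lty 1)| |].
  exact: measurable_funX.
by move=> x; exact: sqr_ge0.
Qed.

Let F'_integrable : mu.-integrable setT (EFin \o F').
Proof.
rewrite (_ : _ \o _ = (fun x => ((s ^+ 2)^-1)%:E * (x ^+ 2 * pdf x)%:E)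
   \- (EFin \o pdf))%E; last first.
  by apply/funext => x /=; rewrite /F' -EFinM -EFinB; congr EFin; ring.
by apply: integrableB => //; apply: (integrableZl measurableT).
Qed.

(* [F'] changes sign at [s], where the half-line is cut to apply the two versions of the
   fundamental theorem of calculus. *)
Let integral_F' : \int[mu]_(x in `[0, +oo[) F' x = 0.
Proof.
have dF (x : R) : F^`()%classic x = F' x by rewrite derive1E; have [_ ->] := is_derive_F x.
have F_derivable (x : R) : derivable F x 1 by case: (is_derive_F x).
have left : (\int[mu]_(x in `[0%R, s]) (F' x)%:E = (F s)%:E - (F 0)%:E)%E.
  apply: continuous_FTC2 => //.
    by apply: continuous_subspaceT => x; exact: continuous_F'.
  by split => //; [apply: cvg_at_right_filter|apply: cvg_at_left_filter]; exact: continuous_F.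
have right : (\int[mu]_(x in `[s, +oo[) (F' x)%:E = 0%:E - (F s)%:E)%E.
  apply: ge0_continuous_FTC2y => //.
  - move=> x sx; rewrite mulr_ge0 ?normal_pdf_ge0 // subr_ge0.
    have x0 : 0 <= x by exact: le_trans (ltW s_gt0) sx.
    by rewrite ler_pdivlMr ?exprn_gt0 // mul1r ler_sqr ?nnegrE // ltW.
  - by apply: continuous_subspaceT => x; exact: continuous_F'.
  - rewrite /F; under eq_fun do rewrite mulrCA -mulrN.
    rewrite -(mulr0 (normal_peak s)) -oppr0; apply: cvgMr; apply: cvgN.
    by apply: cvg_mul_expR_sqr; rewrite -mulr_natl mulr_gt0 // exprn_gt0.
  - by apply: cvg_at_right_filter; exact: continuous_F.
have -> : `[0%R, +oo[%classic = `[0%R, s]%classic `|` `]s, +oo[%classic :> set R.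
  by rewrite -itv_bndbnd_setU // bnd_simp ltW.
rewrite Rintegral_setU //.
- rewrite Rintegral_itv_obnd_cbnd; last exact: integrableS F'_integrable.
  by rewrite /Rintegral left right /= {2}/F !mul0r; ring.
- by apply: integrableS F'_integrable => //; apply: measurableU.
- apply/disj_setPS => x /= []; rewrite !in_itv /= andbT => /andP[_ xs] sx.
  by move: (le_lt_trans xs sx); rewrite ltxx.
Qed.

Let weighted_symfun_integral (f : R -> R) : (forall x, 0 <= f x) -> continuous f ->
    (forall x, f (- x) = f x) ->
  (\int[mu]_x (f x * pdf x)%:E = 2%:E * \int[mu]_(x in `[0%R, +oo[) (f x * pdf x)%:E)%E.
Proof.
move=> f0 cf fN; rewrite set_itvcy; apply: ge0_symfun_integralT.
- by move=> x; rewrite mulr_ge0 ?normal_pdf_ge0.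
- by move=> x; apply: cvgM; [exact: cf|exact: continuous_normal_pdf].
- by move=> x /=; rewrite fN centered_normal_pdfN.
Qed.

Lemma integral_normal_sqr : (\int[normal_prob 0 s]_x (x ^+ 2)%:E = (s ^+ 2)%:E)%E.
Proof.
rewrite ge0_integral_normal_prob //; last by move=> x; exact: sqr_ge0.
rewrite weighted_symfun_integral //;
  [|by move=> x; exact: sqr_ge0|exact: exprn_continuous|exact: sqrrN].
have pdf1 : (2%:E * \int[mu]_(x in `[0%R, +oo[) (pdf x)%:E = 1)%E.
  rewrite -(@integral_normal_pdf R 0 s) set_itvcy ge0_symfun_integralT //.
  - exact: normal_pdf_ge0.
  - exact: continuous_normal_pdf.
  - by move=> x /=; rewrite centered_normal_pdfN.
have i1 : mu.-integrable `[0, +oo[ (EFin \o pdf) by exact: integrableS pdf_integrable.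
have i2 : mu.-integrable `[0, +oo[ (EFin \o (fun x => x ^+ 2 * pdf x)).
  exact: integrableS sqr_pdf_integrable.
have := integral_F'.
rewrite (_ : F' = (fun x => (s ^+ 2)^-1 * (x ^+ 2 * pdf x) - pdf x)); last first.
  by apply/funext => x; rewrite /F'; ring.
rewrite RintegralB //; last by apply: (integrableZl _ _ i2).
rewrite RintegralZl // /Rintegral => /eqP; rewrite subr_eq0 => /eqP.
move: pdf1; rewrite -(fineK (integrable_fin_num _ i1)) // -(fineK (integrable_fin_num _ i2)) //=.
set a := fine _; set b := fine _; rewrite -!EFinM => -[pdf1] ab; congr EFin.
have -> : 2 * b = s ^+ 2 * (2 * ((s ^+ 2)^-1 * b)) by field.
by rewrite ab pdf1 mulr1.
Qed.

Lemma integral_normal_abs :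
  (\int[normal_prob 0 s]_x `|x|%:E = 2%:E * \int[normal_prob 0 s]_x (Num.max x 0)%:E)%E.
Proof.
rewrite !ge0_integral_normal_prob //; first last.
- by move=> x; rewrite le_max lexx orbT.
- exact: measurable_maxr.
rewrite weighted_symfun_integral //; [|exact: norm_continuous|exact: normrN].
congr (_ * _)%E; rewrite integral_mkcond; apply: eq_integral => x _.
rewrite patchE mem_setE in_itv andbT; case: ifPn => [x0|].
  by rewrite max_l // ger0_norm.
by rewrite -ltNge => x0; rewrite max_r ?mul0r // ltW.
Qed.

End centered_normal.

Section normal_random_variables.
Context (disp : measure_display) (T : measurableType disp) (R : realType)
  (P : probability T R).
Implicit Types X : T -> R.

Lemma ge0_integral_is_normal (m v : R) X (f : R -> R) :
  is_normal P m v X -> measurable_fun setT f -> (forall x, 0 <= f x) ->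
  (\int[P]_t (f (X t))%:E = \int[normal_prob m (Num.sqrt v)]_x (f x)%:E)%E.
Proof.
move=> [mX lawX] mf f0.
have mX' : measurable_fun setT (X : T -> measurableTypeR R) by exact: mX.
pose X' : {mfun T >-> measurableTypeR R} :=
  HB.pack (X : T -> measurableTypeR R) (isMeasurableFun.Build _ _ _ _ _ mX').
have mf' : measurable_fun setT (EFin \o f : measurableTypeR R -> \bar R).
  exact/measurable_EFinP.
transitivity (\int[distribution P X']_y (EFin \o f) y)%E.
  by rewrite ge0_integral_distribution // => x; rewrite lee_fin.
by rewrite [LHS](eq_measure_integral (normal_prob m (Num.sqrt v))) // => A mA _; exact: lawX.
Qed.

Definition centered_normal_moment (v : R) (k : nat) : R :=
  fine (\int[normal_prob 0 (Num.sqrt v)]_x (x ^+ k)%:E)%E.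

Variables (v : R) (X : T -> R).
Hypotheses (v_gt0 : 0 < v) (X_normal : is_normal P 0 v X).

Let sqrt_v_gt0 : 0 < Num.sqrt v. Proof. by rewrite sqrtr_gt0. Qed.

Let integral_even_pow k : (\int[P]_t (X t ^+ (2 * k))%:E =
  \int[normal_prob 0 (Num.sqrt v)]_x (x ^+ (2 * k))%:E)%E.
Proof.
apply: (ge0_integral_is_normal (f := fun x => x ^+ (2 * k)) X_normal).
  exact: measurable_funX.
by move=> x; rewrite exprM exprn_ge0 ?sqr_ge0.
Qed.

Lemma is_normal_expr_integrable k : rintegrable P (fun t => X t ^+ (2 * k)).
Proof.
have [mX _] := X_normal.
have pow_ge0 t : 0 <= X t ^+ (2 * k) by rewrite exprM exprn_ge0 ?sqr_ge0.
apply/integrableP; split; first by apply/measurable_EFinP; exact: measurable_funX.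
under eq_integral => t _ do rewrite gee0_abs ?lee_fin //.
by rewrite integral_even_pow integral_normal_expr_lty.
Qed.

Lemma is_normal_integrable : rintegrable P X.
Proof.
have [mX _] := X_normal.
apply: (rintegrable_le mX (Y := fun t => 1 + X t ^+ 2)) => [|t].
  by apply: rintegrableD; [exact: rintegrable_cst|exact: (is_normal_expr_integrable 1)].
by rewrite -(real_normK (num_real _)) -[leLHS]expr1 ler_expr_1D.
Qed.

Lemma is_normal_moment k : \int[P]_t (X t ^+ (2 * k)) = centered_normal_moment v (2 * k).
Proof. by rewrite /Rintegral integral_even_pow. Qed.

Lemma is_normal_variance : \int[P]_t (X t ^+ 2) = v.
Proof.
rewrite (is_normal_moment 1) /centered_normal_moment integral_normal_sqr //=.
by rewrite sqr_sqrtr // ltW.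
Qed.

(* [x = 2 max(x, 0) - |x|], and by symmetry both terms have the same mean. *)
Lemma is_normal_mean : \int[P]_t X t = 0.
Proof.
have [mX _] := X_normal; have iX := is_normal_integrable.
have mmax : measurable_fun setT (fun x : R => Num.max x 0) by apply: measurable_maxr.
have max_ge0 (x : R) : 0 <= Num.max x 0 by rewrite le_max lexx orbT.
have iabs : rintegrable P (fun t => `|X t|) by exact: integrable_norm.
have imax : rintegrable P (fun t => Num.max (X t) 0).
  apply: rintegrable_le iabs _ => [|t]; first exact: (measurableT_comp mmax).
  by rewrite ger0_norm // ge_max ler_norm normr_ge0.
transitivity (\int[P]_t (2 * Num.max (X t) 0 - `|X t|)).
  apply: eq_Rintegral => t _; have [x0|/ltW x0] := leP 0 (X t).
    by rewrite ger0_norm // mulr_natl mulr2n addrK.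
  by rewrite mulr0 sub0r ler0_norm // opprK.
rewrite RintegralB //; last exact: rintegrableZ.
rewrite RintegralZl // /Rintegral (ge0_integral_is_normal X_normal mmax max_ge0).
rewrite (ge0_integral_is_normal (f := Num.norm) X_normal) //.
rewrite integral_normal_abs // fineM ?subrr //.
rewrite -(ge0_integral_is_normal X_normal mmax max_ge0).
exact: integrable_fin_num imax.
Qed.

End normal_random_variables.

Section standardized_variables.
Context (disp : measure_display) (T : measurableType disp) (R : realType)
  (P : probability T R).
Implicit Types X : T -> R[i].

Record standardized (rho C8 : R) X : Prop := Standardized {
  standardized_meas : cmeasurable X;
  standardized_int8 : rintegrable P (fun t => normc (X t) ^+ 8);
  standardized_mean : cexpectation P X = 0;
  standardized_var : cexpectation P (fun t => X t * Num.conj (X t)) = 1;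
  standardized_sqr : cexpectation P (fun t => X t * X t) = rho%:C;
  standardized_moment8 : \int[P]_t (normc (X t) ^+ 8) <= C8 }.

Definition second_moment (k : entry_kind) : R :=
  match k with real_entries => 1 | complex_entries => 0 end.

Definition eighth_moment_bound (k : entry_kind) : R :=
  match k with
  | real_entries => centered_normal_moment 1 8
  | complex_entries => 16 * centered_normal_moment 2^-1 8
  end.

Lemma eighth_moment_bound_ge0 k : 0 <= eighth_moment_bound k.
Proof.
have moment_ge0 (v : R) : 0 <= centered_normal_moment v 8.
  apply: fine_ge0; apply: integral_ge0 => x _.
  by rewrite lee_fin (exprM _ 2 4) exprn_ge0 ?sqr_ge0.
by case: k; rewrite /= ?mulr_ge0.
Qed.

Lemma real_normal_standardized (x : T -> R) : is_normal P 0 1 x ->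
  standardized 1 (eighth_moment_bound real_entries) (fun t => (x t)%:C).
Proof.
move=> x_normal; have [mx _] := x_normal.
have normc8 t : normc (x t)%:C ^+ 8 = x t ^+ 8.
  by rewrite normc_real -normrX ger0_norm // (exprM _ 2 4) exprn_ge0 ?sqr_ge0.
have sqrE : (fun t => (x t)%:C * (x t)%:C) = fun t => (x t ^+ 2)%:C.
  by apply/funext => t; rewrite -rmorphM.
split.
- by split.
- by under eq_fun do rewrite normc8; exact: (is_normal_expr_integrable _ x_normal 4).
- by rewrite cexpectation_real (is_normal_mean _ x_normal).
- under eq_fun => t do rewrite [Num.conj _](conjc_real (x t)).
  by rewrite sqrE cexpectation_real (is_normal_variance _ x_normal).
- by rewrite sqrE cexpectation_real (is_normal_variance _ x_normal).
- by under eq_Rintegral do rewrite normc8; rewrite (is_normal_moment x_normal 4).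
Qed.

Lemma normc_expr8_le (z : R[i]) :
  normc z ^+ 8 <= 8 * (complex.Re z ^+ 8 + complex.Im z ^+ 8).
Proof.
by rewrite (exprM _ 2 4) sqr_normcE (exprM (complex.Re z) 2 4)
  (exprM (complex.Im z) 2 4); exact: expr4_add_le.
Qed.

Lemma complex_std_normal_standardized X : is_complex_std_normal P X ->
  standardized 0 (eighth_moment_bound complex_entries) X.
Proof.
move=> [x_normal y_normal xy_indep].
have v_gt0 : 0 < 2^-1 :> R by rewrite invr_gt0.
have [mx _] := x_normal; have [my _] := y_normal.
have x_int := is_normal_expr_integrable v_gt0 x_normal.
have y_int := is_normal_expr_integrable v_gt0 y_normal.
have x1_int := is_normal_integrable v_gt0 x_normal.
have y1_int := is_normal_integrable v_gt0 y_normal.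
have x_var := is_normal_variance v_gt0 x_normal.
have y_var := is_normal_variance v_gt0 y_normal.
have [xy_int xy_mean] := expectation_mul_independent2 xy_indep x1_int y1_int.
have bound_int : rintegrable P
    (fun t => 8 * (complex.Re (X t) ^+ 8 + complex.Im (X t) ^+ 8)).
  by apply: rintegrableZ; apply: rintegrableD; [exact: (x_int 4)|exact: (y_int 4)].
have X_int8 : rintegrable P (fun t => normc (X t) ^+ 8).
  apply: rintegrable_le bound_int _ => [|t].
    by apply: measurable_funX; apply: measurable_normc.
  by rewrite ger0_norm ?exprn_ge0 ?normc_ge0 ?normc_expr8_le.
split=> //.
- apply: complex_eqP; rewrite /cexpectation /=.
    exact: (is_normal_mean v_gt0 x_normal).
  exact: (is_normal_mean v_gt0 y_normal).
- under eq_fun do rewrite mul_conjc sqr_normcE.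
  rewrite cexpectation_real RintegralD //; [|exact: (x_int 1)|exact: (y_int 1)].
  by rewrite x_var y_var (_ : _ + _ = 1) ?rmorph1 //; field.
- apply: complex_eqP; rewrite /cexpectation /=.
    under eq_Rintegral do rewrite ReM -!expr2.
    by rewrite RintegralB ?x_var ?y_var ?subrr //; [exact: (x_int 1)|exact: (y_int 1)].
  under eq_Rintegral do rewrite ImM [X in _ + X]mulrC -mulr2n -mulr_natl.
  by rewrite RintegralZl // xy_mean (is_normal_mean v_gt0 x_normal) mul0r mulr0.
apply: (le_trans (le_Rintegral measurableT X_int8 bound_int _)).
  by move=> t _; exact: normc_expr8_le.
have x8_int : rintegrable P (fun t => complex.Re (X t) ^+ 8) by exact: (x_int 4).
have y8_int : rintegrable P (fun t => complex.Im (X t) ^+ 8) by exact: (y_int 4).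
rewrite RintegralZl //; last exact: rintegrableD.
rewrite RintegralD // (is_normal_moment x_normal 4) (is_normal_moment y_normal 4) /=.
lra.
Qed.

Lemma std_normal_standardized (k : entry_kind) X : is_std_normal P k X ->
  standardized (second_moment k) (eighth_moment_bound k) X.
Proof.
case: k => [[Im0 x_normal]|]; last exact: complex_std_normal_standardized.
have -> : X = fun t => (complex.Re (X t))%:C.
  by apply/funext => t; apply: complex_eqP; rewrite ?Im0.
exact: real_normal_standardized.
Qed.

End standardized_variables.

Section independent_entries.
Context (disp : measure_display) (T : measurableType disp) (R : realType)
  (P : probability T R) (I : finType) (g : I -> T -> R[i]) (rho C8 : R).
Implicit Types (i j k l : I) (J : {set I}).

Definition re_im i (t : T) : R * R := (complex.Re (g i t), complex.Im (g i t)).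

Hypotheses (g_std : forall i, standardized P rho C8 (g i))
  (g_indep : mutually_independent P re_im).

Let g_meas i : cmeasurable (g i). Proof. by have [] := g_std i. Qed.

Lemma measurable_re_im i : measurable_fun setT (re_im i).
Proof. by have [? ?] := g_meas i; apply: measurable_fun_pair. Qed.

Lemma cmeasurable_entry J i : i \in J -> cmeasurable (g i : sub_sigma re_im J -> R[i]).
Proof.
by move=> iJ; have /measurable_fun_pairP[m1 m2] := measurable_sub_sigma (X := re_im) iJ.
Qed.

Definition sqnorm J (t : T) : R := \sum_(i in J) normc (g i t) ^+ 2.

Lemma sqnorm_ge0 J t : 0 <= sqnorm J t.
Proof. by apply: sumr_ge0 => i _; apply: sqr_ge0. Qed.

Lemma normc_entry_le_sqnorm J i t : i \in J -> normc (g i t) ^+ 2 <= sqnorm J t.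
Proof.
by move=> iJ; rewrite /sqnorm (bigD1 i) //= lerDl sumr_ge0 // => j _; apply: sqr_ge0.
Qed.

Lemma sqr_sum_le_card J (x : I -> R) :
  (\sum_(i in J) x i) ^+ 2 <= #|J|%:R * \sum_(i in J) x i ^+ 2.
Proof.
have := cauchy_schwarz_sum (index_enum I) (mem J) (fun=> 1) x.
under eq_bigr do rewrite mul1r.
by under [X in _ <= X * _]eq_bigr do rewrite expr1n; rewrite sumr_const.
Qed.

Lemma sqnorm_expr4_le J t :
  sqnorm J t ^+ 4 <= #|J|%:R ^+ 3 * \sum_(i in J) normc (g i t) ^+ 8.
Proof.
rewrite -[4%N]/(2 * 2)%N exprM.
apply: (@le_trans _ _ ((#|J|%:R * \sum_(i in J) (normc (g i t) ^+ 2) ^+ 2) ^+ 2)).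
  rewrite ler_sqr ?nnegrE ?sqr_ge0 ?sqr_sum_le_card //.
  by rewrite mulr_ge0 // sumr_ge0 // => i _; apply: sqr_ge0.
rewrite exprMn (exprSr _ 2) -mulrA ler_wpM2l ?sqr_ge0 //.
apply: le_trans (sqr_sum_le_card _ _) _; rewrite ler_wpM2l //.
by apply: ler_sum => i _; rewrite -!exprM.
Qed.

Lemma measurable_sqnorm J : measurable_fun setT (sqnorm J).
Proof.
rewrite /sqnorm; under eq_fun do rewrite big_mkcond /=.
apply: measurable_sum => i; case: (i \in J) => //.
by apply: measurable_funX; apply: measurable_normc.
Qed.

Let sum_expr8_integrable J : rintegrable P (fun t => \sum_(i in J) normc (g i t) ^+ 8).
Proof. by apply: rintegrable_sum => i _; exact: standardized_int8 (g_std i). Qed.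

Lemma rintegrable_sqnorm4 J : rintegrable P (fun t => sqnorm J t ^+ 4).
Proof.
apply: (rintegrable_le _ (rintegrableZ (#|J|%:R ^+ 3) (sum_expr8_integrable J))) => [|t].
  by apply: measurable_funX; exact: measurable_sqnorm.
by rewrite ger0_norm ?sqnorm_expr4_le // exprn_ge0 // sqnorm_ge0.
Qed.

Lemma expectation_sqnorm4_le J : \int[P]_t (sqnorm J t ^+ 4) <= #|J|%:R ^+ 4 * C8.
Proof.
apply: (@le_trans _ _ (\int[P]_t (#|J|%:R ^+ 3 * \sum_(i in J) normc (g i t) ^+ 8))).
  apply: le_Rintegral => //; first exact: rintegrable_sqnorm4.
    exact: rintegrableZ.
  by move=> t _; apply: sqnorm_expr4_le.
rewrite RintegralZl //; last exact: sum_expr8_integrable.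
rewrite (exprSr _ 3) -mulrA ler_wpM2l ?exprn_ge0 // Rintegral_sum; last first.
  by move=> i _; exact: standardized_int8 (g_std i).
rewrite mulr_natl -sumr_const; apply: ler_sum => i _.
exact: standardized_moment8 (g_std i).
Qed.

(* The product of the entries listed by [s], conjugated where the boolean is [true]. *)
Definition monomial (s : seq (bool * I)) (t : T) : R[i] :=
  \prod_(x <- s) (if x.1 then Num.conj (g x.2 t) else g x.2 t).

Lemma cmeasurable_monomial J s : all (fun x => x.2 \in J) s ->
  cmeasurable (monomial s : sub_sigma re_im J -> R[i]).
Proof.
rewrite /monomial; elim: s => [_|[b i] s IH /andP[iJ sJ]].
  by under eq_fun do rewrite big_nil; exact: cmeasurable_cst.
under eq_fun do rewrite big_cons /=; apply: cmeasurableM (IH sJ).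
by case: b iJ => /= iJ; [apply: cmeasurableJ|]; exact: cmeasurable_entry.
Qed.

Let normc_monomial_le s t : normc (monomial s t) <= (1 + sqnorm [set: I]%SET t) ^+ size s.
Proof.
rewrite /monomial; elim: s => [|[b i] s IH]; first by rewrite big_nil normc1.
rewrite big_cons normcM exprS ler_pM ?normc_ge0 //=.
rewrite (_ : normc _ = normc (g i t)); last by case: b; rewrite ?normcJ.
rewrite -[leLHS]expr1; apply: le_trans (ler_expr_1D (n := 2) (normc_ge0 _) _) _ => //.
by rewrite lerD2l normc_entry_le_sqnorm // inE.
Qed.

Lemma cintegrable_monomial s : (size s <= 4)%N -> cintegrable P (monomial s).
Proof.
move=> s4; pose q t := sqnorm [set: I]%SET t.
have bound_int : rintegrable P (fun t => 8 * (1 + q t ^+ 4)).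
  by apply: rintegrableZ; apply: rintegrableD;
    [exact: rintegrable_cst|exact: rintegrable_sqnorm4].
apply: (cintegrable_le _ bound_int) => [|t].
  apply: (cmeasurable_sub_sigma measurable_re_im (J := [set: I]%SET)).
  by apply: cmeasurable_monomial; apply/allP => x _; rewrite inE.
apply: le_trans (normc_monomial_le s t) _.
have := expr4_add_le 1 (q t); rewrite expr1n; apply: le_trans.
by apply: ler_weXn2l => //; rewrite lerDl sqnorm_ge0.
Qed.

Lemma expectation_monomial_split i s : (size s <= 4)%N ->
  cexpectation P (monomial s) =
  cexpectation P (monomial [seq x <- s | x.2 == i]) *
  cexpectation P (monomial [seq x <- s | x.2 != i]).
Proof.
move=> s4; set s1 := [seq x <- s | x.2 == i]; set s2 := [seq x <- s | x.2 != i].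
have s1_4 : (size s1 <= 4)%N by rewrite size_filter (leq_trans (count_size _ _)).
have s2_4 : (size s2 <= 4)%N by rewrite size_filter (leq_trans (count_size _ _)).
have disj : [disjoint [set i]%SET & (~: [set i])%SET]%B.
  by rewrite -setI_eq0 finset.setICr.
have [||_ <-] := cexpectation_mul_sub_sigma measurable_re_im g_indep disj _ _
  (cintegrable_monomial s1_4) (cintegrable_monomial s2_4).
- apply: cmeasurable_monomial; rewrite all_filter; apply/allP => x _.
  by apply/implyP => xi; rewrite inE.
- apply: cmeasurable_monomial; rewrite all_filter; apply/allP => x _.
  by apply/implyP => xi; rewrite !inE.
congr cexpectation; apply/funext => t; rewrite /monomial -big_cat /=.
by apply: perm_big; rewrite perm_sym perm_filterC.
Qed.

Lemma expectation_monomial1 x : cexpectation P (monomial [:: x]) = 0.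
Proof.
rewrite /monomial; under eq_fun do rewrite big_seq1.
have g_int : cintegrable P (g x.2).
  have := @cintegrable_monomial [:: (false, x.2)] isT.
  by rewrite /monomial; under eq_fun do rewrite big_seq1.
case: x.1; last exact: standardized_mean (g_std _).
by rewrite cexpectationJ // (standardized_mean (g_std _)) conjC0.
Qed.

Lemma expectation_monomial_lonely i b s : (size s <= 4)%N ->
  [seq x <- s | x.2 == i] = [:: (b, i)] -> cexpectation P (monomial s) = 0.
Proof.
by move=> s4 si; rewrite (expectation_monomial_split i s4) si expectation_monomial1 mul0r.
Qed.

Lemma expectation_monomial2 b c i : cexpectation P (monomial [:: (b, i); (c, i)]) =
  if b (+) c then 1 else rho%:C.
Proof.
rewrite /monomial; under eq_fun do rewrite big_cons big_seq1.
case: b c => -[] /=; last exact: standardized_sqr (g_std i).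
- under eq_fun do rewrite -rmorphM; rewrite cexpectationJ.
    by rewrite (standardized_sqr (g_std i)); exact: conjc_real.
  have := @cintegrable_monomial [:: (false, i); (false, i)] isT.
  by rewrite /monomial; under eq_fun do rewrite big_cons big_seq1.
- by under eq_fun do rewrite mulrC; exact: standardized_var (g_std i).
- exact: standardized_var (g_std i).
Qed.

Lemma expectation_mul2 i j :
  cexpectation P (monomial [:: (false, i); (true, j)]) = (i == j)%:R.
Proof.
have [->|ij] := eqVneq i j; first by rewrite expectation_monomial2.
apply: (expectation_monomial_lonely (i := i) (b := false)) => //=.
by rewrite eqxx eq_sym (negPf ij).
Qed.

(* The excess of the fourth moment over its Gaussian value. *)
Definition excess i : R[i] :=
  cexpectation P (fun t => (normc (g i t) ^+ 4)%:C) - 2 - (rho ^+ 2)%:C.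

Lemma expectation_mul4 i j k l :
  cexpectation P (monomial [:: (false, i); (true, j); (false, k); (true, l)]) =
  ((i == j) && (k == l))%:R + ((i == l) && (j == k))%:R
  + (rho ^+ 2)%:C * ((i == k) && (j == l))%:R
  + excess i * [&& i == j, j == k & k == l]%:R.
Proof.
have [<-|ij] := eqVneq i j; have [<-|kl] := eqVneq k l; rewrite /= ?andbT ?andbF.
- have [<-|ik] := eqVneq i k; last first.
    rewrite (expectation_monomial_split i) //= !eqxx (eq_sym k) (negPf ik) /=.
    by rewrite !expectation_monomial2 /= !(mulr0, addr0) mulr1.
  rewrite /= /excess !mulr1 (_ : monomial _ = fun t => (normc (g i t) ^+ 4)%:C); first by ring.
  apply/funext => t; rewrite /monomial !big_cons big_nil /= mulr1 mulrA mul_conjc.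
  by rewrite -rmorphM -exprD.
- have [ik|ik] := eqVneq i k.
    rewrite ik (negPf kl) /= !(mulr0, addr0).
    apply: (expectation_monomial_lonely (i := l) (b := true)) => //=.
    by rewrite (negPf kl) eqxx.
  rewrite !andbF /= !(mulr0, addr0).
  apply: (expectation_monomial_lonely (i := k) (b := false)) => //=.
  by rewrite (negPf ik) eqxx (eq_sym l) (negPf kl).
- have [ik|ik] := eqVneq i k.
    rewrite -ik (eq_sym j) (negPf ij) /= !(mulr0, addr0).
    apply: (expectation_monomial_lonely (i := j) (b := true)) => //=.
    by rewrite (negPf ij) eqxx.
  rewrite /= !(mulr0, addr0).
  apply: (expectation_monomial_lonely (i := i) (b := false)) => //=.
  by rewrite eqxx !(eq_sym _ i) (negPf ij) (negPf ik).
- have [ik|ik] := eqVneq i k.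
    rewrite -ik in kl *; rewrite (negPf kl) /= mulr0 addr0 !add0r.
    have [jl|jl] := eqVneq j l.
      rewrite -jl (expectation_monomial_split i) //= !eqxx !(eq_sym _ i) (negPf ij) /=.
      by rewrite !expectation_monomial2 /= mulr1 -rmorphM expr2.
    rewrite mulr0; apply: (expectation_monomial_lonely (i := j) (b := true)) => //=.
    by rewrite (negPf ij) eqxx (eq_sym l) (negPf jl).
  rewrite /= !(mulr0, addr0) add0r; have [il|il] := eqVneq i l; last first.
    apply: (expectation_monomial_lonely (i := i) (b := false)) => //=.
    by rewrite eqxx !(eq_sym _ i) (negPf ij) (negPf ik) (negPf il).
  have [jk|jk] := eqVneq j k.
    rewrite -il -jk (expectation_monomial_split i) //= !eqxx !(eq_sym _ i) (negPf ij) /=.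
    by rewrite !expectation_monomial2 /= mulr1.
  apply: (expectation_monomial_lonely (i := j) (b := true)) => //=.
  by rewrite -il (negPf ij) eqxx (eq_sym k) (negPf jk).
Qed.

Lemma normc_excess_le i : normc (excess i) <= 4 + rho ^+ 2 + C8.
Proof.
have expr4_int : rintegrable P (fun t => normc (g i t) ^+ 4).
  apply: (rintegrable_le (Y := fun t => 1 + normc (g i t) ^+ 8)) => [||t].
  - by apply: measurable_funX; apply: measurable_normc.
  - by apply: rintegrableD; [exact: rintegrable_cst|exact: standardized_int8 (g_std i)].
  - by rewrite ger0_norm ?exprn_ge0 ?ler_expr_1D ?normc_ge0.
have expr4_ge0 : 0 <= \int[P]_t (normc (g i t) ^+ 4).
  by apply: Rintegral_ge0 => t _; rewrite exprn_ge0 // normc_ge0.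
have expr4_le : \int[P]_t (normc (g i t) ^+ 4) <= 1 + C8.
  apply: le_trans (lerD (lexx _) (standardized_moment8 (g_std i))).
  rewrite -[X in X + _](Rintegral_prob_cst P) -RintegralD //.
  - apply: le_Rintegral => // [|t _]; last by rewrite ler_expr_1D ?normc_ge0.
    by apply: rintegrableD; [exact: rintegrable_cst|exact: standardized_int8 (g_std i)].
  - exact: rintegrable_cst.
  - exact: standardized_int8 (g_std i).
rewrite /excess cexpectation_real -[2]/(2%:R).
rewrite (_ : 2%:R = (2%:R : R)%:C); last by rewrite rmorph_nat.
rewrite -!rmorphB normc_real ler_norml.
by apply/andP; split; have := sqr_ge0 rho; lra.
Qed.

End independent_entries.

(** * Partial transposes of rank one matrices *)

Section partial_transpose_rank_one.
Context (R : realType) (d : nat).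
Local Notation idx := (@mxtens_index d d).
Local Notation unidx := (@mxtens_unindex d d).
Implicit Types (a b c e : 'I_(d ^ 2)) (g : 'I_(d ^ 2) -> R[i]).

Definition mixed a b : 'I_(d ^ 2) := idx ((unidx a).1, (unidx b).2).

Lemma mixed_eq a b c e : (mixed a b == mixed c e) =
  ((unidx a).1 == (unidx c).1) && ((unidx b).2 == (unidx e).2).
Proof. by rewrite /mixed (can_eq (@mxtens_indexK _ _)) xpair_eqE. Qed.

Lemma mxtens_unindex_eq a b : (a == b) =
  ((unidx a).1 == (unidx b).1) && ((unidx a).2 == (unidx b).2).
Proof.
rewrite -(can_eq (@mxtens_unindexK d d)).
by case: (unidx a) (unidx b) => [? ?] [? ?].
Qed.

Lemma mixed_id a : mixed a a = a.
Proof. by rewrite /mixed -surjective_pairing mxtens_unindexK. Qed.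

Lemma mixed_eqC a b : (mixed a b == mixed b a) = (a == b).
Proof. by rewrite mixed_eq mxtens_unindex_eq; congr (_ && _); exact: eq_sym. Qed.

Lemma mixed_pair_eq a b c e :
  (mixed a b == mixed c e) && (mixed b a == mixed e c) = (a == c) && (b == e).
Proof.
rewrite !mixed_eq (mxtens_unindex_eq a c) (mxtens_unindex_eq b e).
by rewrite andbACA [X in _ && X]andbC andbACA.
Qed.

Lemma sum_mxtens_index (V : nmodType) (F : 'I_(d ^ 2) -> V) :
  \sum_a F a = \sum_i \sum_k F (idx (i, k)).
Proof.
rewrite pair_bigA /= (reindex (idx : 'I_d * 'I_d -> 'I_(d ^ 2))) /=.
  by apply: eq_bigr => -[].
by exists unidx => x _; [exact: mxtens_indexK|exact: mxtens_unindexK].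
Qed.

(* The partial transpose of [v v^*], where [v] is the column with entries [g]. *)
Definition rank1pt g : 'M[R[i]]_(d ^ 2) :=
  \matrix_(a, b) (g (mixed a b) * Num.conj (g (mixed b a))).

Lemma partial_transpose_mixed (A : 'M[R[i]]_(d ^ 2)) a b :
  partial_transpose A a b = A (mixed a b) (mixed b a).
Proof. by rewrite mxE /mixed; case: (unidx a) (unidx b) => [? ?] [? ?]. Qed.

Lemma partial_transpose_gram p (G : 'M[R[i]]_(d ^ 2, p)) (x : R[i]) :
  partial_transpose (x *: (G *m G ^t*)) = x *: \sum_s rank1pt (fun a => G a s).
Proof.
apply/matrixP => a b; rewrite partial_transpose_mixed [RHS]mxE summxE !mxE.
by congr (_ * _); apply: eq_bigr => s _; rewrite !mxE.
Qed.

Lemma rank1pt_hermsymmx g : rank1pt g \is hermsymmx.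
Proof.
by apply/hermsymmxP/matrixP => a b; rewrite !mxE rmorphM /= conjCK mulrC.
Qed.

Lemma frob_rank1pt g : frob (rank1pt g) = \sum_a normc (g a) ^+ 2.
Proof.
have sum_ge0 : 0 <= \sum_a normc (g a) ^+ 2 by apply: sumr_ge0 => a _; apply: sqr_ge0.
apply: (@pexpIrn _ 2); rewrite ?nnegrE ?frob_ge0 // sqr_frob_pair expr2 big_distrlr /=.
rewrite pair_bigA /= [RHS](reindex_inj (h := fun ab => (mixed ab.1 ab.2, mixed ab.2 ab.1))) /=.
  by apply: eq_bigr => -[a b] _ /=; rewrite mxE normcM normcJ exprMn.
move=> [a b] [c e] /eqP; rewrite xpair_eqE mixed_pair_eq => /andP[/eqP /= -> /eqP /= ->].
by [].
Qed.

Definition reshape g : 'M[R[i]]_d := \matrix_(i, k) g (idx (i, k)).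

Lemma sqr_frob_columns m (A : 'M[R[i]]_(d ^ 2, m)) :
  frob A ^+ 2 = \sum_s frob (reshape (fun a => A a s)) ^+ 2.
Proof.
rewrite sqr_frob exchange_big /=; apply: eq_bigr => s _.
by rewrite sum_mxtens_index sqr_frob; do 2!(apply: eq_bigr => ? _); rewrite mxE.
Qed.

Lemma reshape_rank1ptM m g (B : 'M[R[i]]_(d ^ 2, m)) s :
  reshape (fun a => (rank1pt g *m B) a s) =
  reshape g *m ((reshape (fun a => B a s))^T *m ((reshape g) ^t*)^T).
Proof.
apply/matrixP => i k; rewrite mxE [LHS]mxE sum_mxtens_index exchange_big /= [RHS]mxE.
apply: eq_bigr => l _; rewrite [X in _ = _ * X]mxE mulr_sumr; apply: eq_bigr => j _.
by rewrite !mxE /mixed !mxtens_indexK /=; ring.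
Qed.

Lemma frob_rank1ptM m g (B : 'M[R[i]]_(d ^ 2, m)) :
  frob (rank1pt g *m B) <= frob (reshape g *m (reshape g) ^t*) * frob B.
Proof.
set k := frob (reshape g *m _).
apply: ler_of_sqr; first by rewrite mulr_ge0 ?frob_ge0.
rewrite exprMn !sqr_frob_columns mulr_sumr; apply: ler_sum => s _.
rewrite reshape_rank1ptM; apply: le_trans (sqr_frobM_le _ _) _.
rewrite frob_gramC -/k (expr2 k) -mulrA ler_wpM2l ?frob_ge0 //.
rewrite -frob_tr trmx_mul !trmxK; apply: le_trans (sqr_frobM_le _ _) _.
by rewrite trmxCK.
Qed.

End partial_transpose_rank_one.

(** * Removing one summand from a Hermitian matrix *)

Section resolvent_expansion.
Variables (F : comPzRingType) (m : nat) (Z A G : 'M[F]_m) (q : F).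
Hypothesis GE : G = A - q *: (A *m Z *m G).

Lemma mxtrace_mul_resolvent_expansion :
  \tr (Z *m G) = \tr (Z *m A) - q * \tr (Z *m A *m Z *m A)
    + q ^+ 2 * \tr (Z *m (A *m Z) *m (A *m Z *m G)).
Proof.
have ZG : Z *m G = Z *m A - q *: (Z *m A *m Z *m G).
  by rewrite {1}GE mulmxBr -scalemxAr !mulmxA.
have ZAZG : Z *m A *m Z *m G =
    Z *m A *m Z *m A - q *: (Z *m (A *m Z) *m (A *m Z *m G)).
  by rewrite {1}GE mulmxBr -scalemxAr !mulmxA.
by rewrite ZG raddfB /= mxtraceZ ZAZG raddfB /= mxtraceZ; ring.
Qed.

Lemma mxtrace_resolvent_expansion :
  \tr G = \tr A - q * \tr (Z *m (A *m A)) + q ^+ 2 * \tr (A *m Z *m (A *m Z *m G)).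
Proof.
have AZG : A *m Z *m G = A *m Z *m A - q *: (A *m Z *m (A *m Z *m G)).
  by rewrite {1}GE mulmxBr -scalemxAr !mulmxA.
have cyclic : \tr (A *m Z *m A) = \tr (Z *m (A *m A)).
  by rewrite -mulmxA mxtrace_mulC mulmxA.
by rewrite {1}GE raddfB /= mxtraceZ [in LHS]AZG raddfB /= mxtraceZ cyclic; ring.
Qed.

End resolvent_expansion.

Section stieltjes.
Variable R : realType.
Implicit Types (n : nat) (v : R) (z : R[i]).

Definition stieltjes n (H : 'M[R[i]]_n) z : R[i] := n%:R^-1 * \tr (resolvent H z).

(* Vanishes when [m] is the Stieltjes transform at [z] of the centered semicircle law of
   variance [v]. *)
Definition semicircle_defect v z (m : R[i]) : R[i] := 1 + z * m + v%:C * m ^+ 2.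

Definition defect n v (H : 'M[R[i]]_n) z : R[i] := semicircle_defect v z (stieltjes H z).

Lemma semicircle_defect_sub v z m m0 :
  semicircle_defect v z m - semicircle_defect v z m0 = (m - m0) * (z + v%:C * (m + m0)).
Proof. by rewrite /semicircle_defect; ring. Qed.

Lemma normc_stieltjes_le n (H : 'M[R[i]]_n) z : (0 < n)%N -> H \is hermsymmx ->
  0 < complex.Im z -> normc (stieltjes H z) <= (complex.Im z)^-1.
Proof.
move=> n0 hH z0; rewrite normcM normcV normc_nat mulrC ler_pdivrMr ?ltr0n //.
by have := normc_mxtrace_resolvent hH (lt0r_neq0 z0); rewrite gtr0_norm.
Qed.

Definition defect_bound (v b w : R) : R := 1 + w * b + v * b ^+ 2.

Lemma defect_bound_ge0 (v b w : R) : 0 <= v -> 0 <= b -> 0 <= w -> 0 <= defect_bound v b w.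
Proof. by move=> *; rewrite !addr_ge0 // mulr_ge0 // sqr_ge0. Qed.

Lemma ler_defect_bound (v v' b w : R) :
  v <= v' -> defect_bound v b w <= defect_bound v' b w.
Proof. by move=> v_le; rewrite lerD2l ler_wpM2r ?sqr_ge0. Qed.

Lemma normc_defect_le n v (H : 'M[R[i]]_n) z : (0 < n)%N -> 0 <= v -> H \is hermsymmx ->
  0 < complex.Im z -> normc (defect v H z) <= defect_bound v (complex.Im z)^-1 (normc z).
Proof.
move=> n0 v0 hH z0; have m_le := normc_stieltjes_le n0 hH z0.
apply: le_trans (le_normcD _ _) _; apply: lerD.
  apply: le_trans (le_normcD _ _) _; rewrite normc1 lerD2l normcM.
  by rewrite ler_wpM2l ?normc_ge0.
rewrite normcM normc_real ger0_norm // ler_wpM2l // !expr2 normcM.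
by rewrite ler_pM ?normc_ge0.
Qed.

Lemma normc_defect_change n (u v : R) (H : 'M[R[i]]_n) z : (0 < n)%N -> H \is hermsymmx ->
  0 < complex.Im z ->
  normc (defect v H z) <= normc (defect u H z) + `|v - u| * (complex.Im z)^-1 ^+ 2.
Proof.
move=> n0 hH z0; have m_le := normc_stieltjes_le n0 hH z0.
rewrite (_ : defect v H z = defect u H z + (v - u)%:C * stieltjes H z ^+ 2); last first.
  by rewrite /defect /semicircle_defect rmorphB; ring.
apply: le_trans (le_normcD _ _) _; rewrite lerD2l normcM normc_real ler_wpM2l //.
by rewrite !expr2 normcM ler_pM ?normc_ge0.
Qed.

Lemma cmeasurable_defect (d : measure_display) (D : measurableType d) n v
    (H : D -> 'M[R[i]]_n) z :
  (forall t, H t \is hermsymmx) -> complex.Im z != 0 -> mxmeasurable H ->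
  cmeasurable (fun t => defect v (H t) z).
Proof.
move=> hH z0 mH; have mst : cmeasurable (fun t => stieltjes (H t) z).
  apply: cmeasurableM; first exact: cmeasurable_cst.
  by apply: cmeasurable_mxtrace; exact: mxmeasurable_resolvent.
apply: cmeasurableD; last by do 2!apply: cmeasurableM => //; exact: cmeasurable_cst.
apply: cmeasurableD; first exact: cmeasurable_cst.
by apply: cmeasurableM => //; exact: cmeasurable_cst.
Qed.

End stieltjes.

Section leave_one_out.
Variables (R : realType) (n : nat) (z : R[i]) (q kap : R) (H Z : 'M[R[i]]_n).
Hypotheses (n_gt0 : (0 < n)%N) (z_gt0 : 0 < complex.Im z) (q_ge0 : 0 <= q)
  (kap_ge0 : 0 <= kap) (H_herm : H \is hermsymmx) (Z_herm : Z \is hermsymmx)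
  (Z_op : forall B : 'M[R[i]]_n, frob (Z *m B) <= kap * frob B).

Local Notation nC := (n%:R : R[i]).
Local Notation c := (n%:R * q).
Local Notation b := ((complex.Im z)^-1).
Local Notation w := (normc z).
Local Notation H0 := (H - q%:C *: Z).
Local Notation A := (resolvent H0 z).
Local Notation G := (resolvent H z).
Local Notation m := (stieltjes H z).
Local Notation m0 := (stieltjes H0 z).
Local Notation D := (defect c H z).
Local Notation D0 := (defect c H0 z).
Local Notation cubic := (\tr (Z *m (A *m Z) *m (A *m Z *m G))).

Let b_ge0 : 0 <= b. Proof. by rewrite invr_ge0 ltW. Qed.
Let c_ge0 : 0 <= c. Proof. by rewrite mulr_ge0. Qed.
Let Imz_neq0 : complex.Im z != 0. Proof. exact: lt0r_neq0. Qed.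
Let nC_neq0 : nC != 0. Proof. by rewrite pnatr_eq0 -lt0n. Qed.
Let normImz : `|complex.Im z|^-1 = b. Proof. by rewrite gtr0_norm. Qed.

Lemma hermsymmx_leave_one_out : H0 \is hermsymmx.
Proof. exact: rpredB H_herm (hermsymmxZ q Z_herm). Qed.
Let H0_herm := hermsymmx_leave_one_out.

Let resolvent_leave_one_out : G = A - q%:C *: (A *m Z *m G).
Proof.
have sub_H0 : H - H0 = q%:C *: Z by rewrite opprB addrC subrK.
by rewrite {1}(resolvent_sub H_herm H0_herm Imz_neq0) sub_H0 -scalemxAr -scalemxAl.
Qed.

Let frob_AZ : frob (A *m Z) <= b * frob Z.
Proof. by rewrite -normImz; exact: frob_resolventMl. Qed.

Let frob_AZG : frob (A *m Z *m G) <= b ^+ 2 * frob Z.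
Proof.
rewrite expr2 -mulrA; apply: le_trans (ler_wpM2l b_ge0 frob_AZ).
by rewrite -normImz; exact: frob_resolventMr.
Qed.

Let normc_cubic : normc cubic <= kap * b ^+ 3 * frob Z ^+ 2.
Proof.
apply: le_trans (normc_mxtraceM_le _ _) _.
rewrite (_ : kap * b ^+ 3 * _ = (kap * (b * frob Z)) * (b ^+ 2 * frob Z)); last by ring.
by rewrite ler_pM ?frob_ge0 // (le_trans (Z_op _)) // ler_wpM2l.
Qed.

Let normc_mxtrace_ZG : n%:R^-1 * normc (\tr (Z *m G)) <= b * frob Z / Num.sqrt n%:R.
Proof.
have n_pos : 0 < n%:R :> R by rewrite ltr0n.
have trZG_le : normc (\tr (Z *m G)) <= b * frob Z * Num.sqrt n%:R.
  apply: le_trans (normc_mxtraceM_le _ _) _; rewrite [leRHS]mulrAC [leRHS]mulrC.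
  rewrite ler_wpM2l ?frob_ge0 // -normImz; exact: frob_resolvent.
rewrite mulrC ler_pdivrMr //; apply: le_trans trZG_le _.
rewrite -[X in _ <= _ / _ * X](sqr_sqrtr (ler0n R n)) expr2 mulrA divfK //.
by rewrite gt_eqF // sqrtr_gt0.
Qed.

Lemma normc_stieltjes_change : normc (m - m0) <=
  n%:R^-1 * (q * normc (\tr (Z *m (A *m A))) + q ^+ 2 * (b ^+ 3 * frob Z ^+ 2)).
Proof.
have -> : m - m0 = nC^-1 * (- (q%:C * \tr (Z *m (A *m A)))
    + q%:C ^+ 2 * \tr (A *m Z *m (A *m Z *m G))).
  by rewrite /stieltjes (mxtrace_resolvent_expansion resolvent_leave_one_out); ring.
rewrite normcM normcV normc_nat ler_wpM2l ?invr_ge0 //.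
apply: le_trans (le_normcD _ _) _.
rewrite normcN !normcM -expr2 normc_real ger0_norm // lerD2l ler_wpM2l ?sqr_ge0 //.
apply: le_trans (normc_mxtraceM_le _ _) _.
rewrite (_ : b ^+ 3 * _ = b * frob Z * (b ^+ 2 * frob Z)); last by ring.
by rewrite ler_pM ?frob_ge0.
Qed.

Lemma leave_one_out_expansion :
  Num.conj D * (nC^-1 * \tr (Z *m G) + c%:C * m ^+ 2) =
  Num.conj D0 * (nC^-1 * \tr (Z *m A))
  - Num.conj D0 * ((q / n%:R)%:C * (\tr (Z *m A *m Z *m A) - \tr A ^+ 2))
  + (Num.conj (D - D0) * (nC^-1 * \tr (Z *m G) + c%:C * m ^+ 2)
     + Num.conj D0 * ((q ^+ 2 / n%:R)%:C * cubic)
     + Num.conj D0 * (c%:C * ((m - m0) * (m + m0)))).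
Proof.
have cE : c%:C = nC * q%:C by rewrite rmorphM /= rmorph_nat.
have nVE : (n%:R^-1 : R)%:C = nC^-1 by rewrite fmorphV rmorph_nat.
have main : nC^-1 * \tr (Z *m G) + c%:C * m ^+ 2 = nC^-1 * \tr (Z *m A)
    - (q / n%:R)%:C * (\tr (Z *m A *m Z *m A) - \tr A ^+ 2)
    + (q ^+ 2 / n%:R)%:C * cubic + c%:C * ((m - m0) * (m + m0)).
  rewrite (mxtrace_mul_resolvent_expansion resolvent_leave_one_out).
  rewrite !rmorphM /= rmorph_nat fmorphV rmorph_nat /stieltjes; move: nC_neq0 cubic.
  by move: nC q%:C => N Q N0 t3; field.
rewrite rmorphB /=; move: (Num.conj D) (Num.conj D0) main => y y0.
move: (_ + c%:C * m ^+ 2) (nC^-1 * \tr (Z *m A)) ((q / n%:R)%:C * _)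
  ((q ^+ 2 / n%:R)%:C * _) (c%:C * (_ * _)) => Q a e t s QE.
by rewrite (_ : y * Q = y0 * Q + (y - y0) * Q) ?{1}QE; ring.
Qed.

Lemma leave_one_out_le :
  complex.Re (Num.conj D * (nC^-1 * \tr (Z *m G) + c%:C * m ^+ 2)) <=
  complex.Re (Num.conj D0 * (nC^-1 * \tr (Z *m A)))
  - complex.Re (Num.conj D0 * ((q / n%:R)%:C * (\tr (Z *m A *m Z *m A) - \tr A ^+ 2)))
  + (normc (m - m0) * (w + 2 * c * b) * (b * frob Z / Num.sqrt n%:R + c * b ^+ 2)
     + defect_bound c b w * (q ^+ 2 / n%:R * (kap * b ^+ 3 * frob Z ^+ 2))
     + defect_bound c b w * (c * (normc (m - m0) * (2 * b)))).
Proof.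
have m_le := normc_stieltjes_le n_gt0 H_herm z_gt0.
have m0_le := normc_stieltjes_le n_gt0 H0_herm z_gt0.
have D0_le : normc (Num.conj D0) <= defect_bound c b w.
  by rewrite normcJ; exact: normc_defect_le.
have normc_c : normc c%:C = c by rewrite normc_real ger0_norm.
have mm0_le : normc (m + m0) <= 2 * b.
  by apply: le_trans (le_normcD _ _) _; rewrite mulr_natl mulr2n lerD.
rewrite leave_one_out_expansion raddfD raddfB lerD2l; apply: le_trans (Re_le_normc _) _.
apply: le_trans (le_normcD _ _) _; apply: lerD;
  first apply: le_trans (le_normcD _ _) _; first apply: lerD.
- rewrite normcM normcJ semicircle_defect_sub normcM.
  apply: ler_pM; rewrite ?mulr_ge0 ?normc_ge0 //.
    rewrite ler_wpM2l ?normc_ge0 //; apply: le_trans (le_normcD _ _) _.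
    by rewrite lerD2l normcM normc_c (_ : 2 * c * b = c * (2 * b)) ?ler_wpM2l //; ring.
  apply: le_trans (le_normcD _ _) _; apply: lerD; first by rewrite normcM normcV normc_nat.
  by rewrite normcM normc_c ler_wpM2l // !expr2 normcM ler_pM ?normc_ge0.
- rewrite normcM ler_pM ?normc_ge0 // normcM normc_real ger0_norm; last first.
    by rewrite divr_ge0 ?sqr_ge0.
  by rewrite ler_wpM2l // divr_ge0 ?sqr_ge0.
- rewrite normcM ler_pM ?normc_ge0 // normcM normc_c ler_wpM2l //.
  by rewrite normcM ler_wpM2l ?normc_ge0.
Qed.

End leave_one_out.

Lemma sqr_normc_defect_average (R : realType) (n p : nat) (v : R) (z : R[i])
    (Z : 'I_p -> 'M[R[i]]_n) :
  let H := (p%:R^-1)%:C *: \sum_s Z s in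
  (0 < n)%N -> (0 < p)%N -> H \is hermsymmx -> complex.Im z != 0 ->
  normc (defect v H z) ^+ 2 = p%:R^-1 * \sum_s complex.Re (Num.conj (defect v H z) *
    (n%:R^-1 * \tr (Z s *m resolvent H z) + v%:C * stieltjes H z ^+ 2)).
Proof.
move=> H n0 p0 H_herm z0; set D := defect v H z.
have pC_neq0 : p%:R != 0 :> R[i] by rewrite pnatr_eq0 -lt0n.
have nC_neq0 : n%:R != 0 :> R[i] by rewrite pnatr_eq0 -lt0n.
have trHG : n%:R^-1 * \tr (H *m resolvent H z) = 1 + z * stieltjes H z.
  rewrite mulmx_resolvent // mxtraceD mxtrace1 mxtraceZ mulrDr mulVf //.
  by rewrite /stieltjes mulrCA.
have sumE : \sum_s (n%:R^-1 * \tr (Z s *m resolvent H z) + v%:C * stieltjes H z ^+ 2) = p%:R * D.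
  rewrite big_split /= sumr_const card_ord -mulr_sumr -raddf_sum -mulmx_suml.
  rewrite /D /defect /semicircle_defect -trHG -scalemxAl mxtraceZ mulrDr.
  rewrite -(mulr_natl (v%:C * _) p) fmorphV rmorph_nat; congr (_ + _).
  by rewrite mulrCA mulVKf.
rewrite -raddf_sum -mulr_sumr sumE mulrCA [_ * D]mulrC mul_conjc.
rewrite -[p%:R * _](_ : (p%:R * normc D ^+ 2)%:C = _) /=; last by rewrite rmorphM /= rmorph_nat.
by rewrite mulKf // pnatr_eq0 -lt0n.
Qed.

Definition error_constant (R : realFieldType) (c b w : R) : R :=
  (w + 2 * c * b) * (b * (c + c ^+ 2 * b ^+ 3) + c * b ^+ 2 * (c + c ^+ 2 * b ^+ 3))
  + (1 + w * b + c * b ^+ 2) * (c ^+ 2 * b ^+ 3 + 2 * c * b * (c + c ^+ 2 * b ^+ 3)).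

Lemma error_constant_ge0 (R : realFieldType) (c b w : R) :
  0 <= c -> 0 <= b -> 0 <= w -> 0 <= error_constant c b w.
Proof.
by move=> *; rewrite /error_constant;
  repeat (apply: addr_ge0 || apply: mulr_ge0 || apply: exprn_ge0).
Qed.

Lemma ler_error_constant (R : realFieldType) (c c' b w : R) :
  0 <= c -> c <= c' -> 0 <= b -> 0 <= w -> error_constant c b w <= error_constant c' b w.
Proof.
move=> c_ge0 c_le b_ge0 w_ge0; have c'_ge0 := le_trans c_ge0 c_le; rewrite /error_constant.
by repeat (exact: lexx || assumption || exact: ler0n || apply: lerD || apply: ler_pM
  || apply: addr_ge0 || apply: mulr_ge0 || apply: exprn_ge0 || apply: lerXn2r).
Qed.

Section error_terms.
Variables (R : realFieldType) (c b w r x u k dl : R).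
Hypotheses (c_ge0 : 0 <= c) (b_ge0 : 0 <= b) (w_ge0 : 0 <= w) (r_gt0 : 0 < r)
  (r_le1 : r <= 1) (x_ge0 : 0 <= x) (u_ge0 : 0 <= u)
  (dl_le : dl <= r ^+ 4 * (c * u + c ^+ 2 * b ^+ 3 * x ^+ 2)).

Definition size_moments (x u k : R) : R := 1 + x ^+ 4 + u ^+ 2 + k ^+ 2.
Local Notation S := (size_moments x u k).
Local Notation K := (c + c ^+ 2 * b ^+ 3).

Let sqr_le : x ^+ 2 <= S.
Proof.
have := sqr_ge0 (x ^+ 2 - 1); have := sqr_ge0 u; have := sqr_ge0 k.
by have := sqr_ge0 (x ^+ 2); rewrite /size_moments; nra.
Qed.

Let linear_le : u <= S.
Proof.
have := sqr_ge0 (u - 1); have := sqr_ge0 k; have := sqr_ge0 (x ^+ 2).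
by have := sqr_ge0 u; rewrite /size_moments; nra.
Qed.

Let mixed_le : x * u <= S.
Proof.
have := sqr_ge0 (x - u); have := sqr_ge0 (x ^+ 2 - 1); have := sqr_ge0 k.
by have := sqr_ge0 u; rewrite /size_moments; nra.
Qed.

Let cube_le : x ^+ 3 <= S.
Proof.
have := sqr_ge0 (x ^+ 2 - x); have := sqr_ge0 (x ^+ 2 - 1); have := sqr_ge0 k.
by have := sqr_ge0 u; rewrite /size_moments; nra.
Qed.

Let quad_le : k * x ^+ 2 <= S.
Proof.
have := sqr_ge0 (x ^+ 2 - k); have := sqr_ge0 (x ^+ 2); have := sqr_ge0 k.
by have := sqr_ge0 u; rewrite /size_moments; nra.
Qed.

Let S_ge0 : 0 <= S. Proof. exact: le_trans (sqr_ge0 x) sqr_le. Qed.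

Let stieltjes_change_le : dl <= r * (K * S).
Proof.
apply: le_trans dl_le _; apply: ler_pM.
- by rewrite exprn_ge0 // ltW.
- by rewrite addr_ge0 ?mulr_ge0 ?exprn_ge0.
- by rewrite ler_iXnr // ltW.
- by rewrite mulrDl lerD ?ler_wpM2l // mulr_ge0 ?exprn_ge0.
Qed.

Let stieltjes_changeM_le : dl * (b * x * r ^- 2) <= r * (b * (K * S)).
Proof.
have bx_ge0 : 0 <= b * x * r ^- 2 by rewrite !mulr_ge0 // invr_ge0 exprn_ge0 // ltW.
apply: le_trans (ler_wpM2r bx_ge0 dl_le) _.
have -> : r ^+ 4 * (c * u + c ^+ 2 * b ^+ 3 * x ^+ 2) * (b * x * r ^- 2) =
    r ^+ 2 * (b * (c * (x * u) + c ^+ 2 * b ^+ 3 * x ^+ 3)).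
  by field; rewrite gt_eqF.
apply: ler_pM.
- by rewrite exprn_ge0 // ltW.
- by rewrite mulr_ge0 // addr_ge0 // !mulr_ge0 ?exprn_ge0.
- by rewrite ler_iXnr // ltW.
- by rewrite ler_wpM2l // mulrDl lerD ?ler_wpM2l // mulr_ge0 ?exprn_ge0.
Qed.

Lemma error_terms_le :
  dl * (w + 2 * c * b) * (b * x * r ^- 2 + c * b ^+ 2)
  + (1 + w * b + c * b ^+ 2) * (r * (c ^+ 2 * b ^+ 3 * (k * x ^+ 2)))
  + (1 + w * b + c * b ^+ 2) * (c * (dl * (2 * b)))
  <= r * error_constant c b w * S.
Proof.
have wc_ge0 : 0 <= w + 2 * c * b by rewrite addr_ge0 // !mulr_ge0.
have cb_ge0 : 0 <= c * b ^+ 2 by rewrite mulr_ge0 ?sqr_ge0.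
have bound_ge0 : 0 <= 1 + w * b + c * b ^+ 2 by rewrite !addr_ge0 // mulr_ge0.
apply: (@le_trans _ _ ((w + 2 * c * b) * (r * (b * (K * S)) + c * b ^+ 2 * (r * (K * S)))
    + (1 + w * b + c * b ^+ 2) * (r * (c ^+ 2 * b ^+ 3 * S))
    + (1 + w * b + c * b ^+ 2) * (c * (r * (K * S) * (2 * b))))).
  apply: lerD; first apply: lerD.
  - rewrite (mulrC dl) -(mulrA (w + _)) ler_wpM2l // mulrDr lerD // [leLHS]mulrC.
    by rewrite ler_wpM2l.
  - by rewrite ler_wpM2l // ler_wpM2l ?(ltW r_gt0) // ler_wpM2l // mulr_ge0 ?exprn_ge0.
  - by rewrite ler_wpM2l // ler_wpM2l // ler_wpM2r // mulr_ge0.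
by apply: eq_ler; rewrite /error_constant; ring.
Qed.

End error_terms.

Lemma sqrt_natr_sqr (R : rcfType) (d : nat) : Num.sqrt (d ^ 2)%:R = d%:R :> R.
Proof. by rewrite natrX sqrtr_sqr ger0_norm. Qed.

Section leave_one_out_square.
Variables (R : realType) (d p : nat) (z : R[i]) (kap : R) (H Z : 'M[R[i]]_(d ^ 2)).
Hypotheses (d_gt0 : (0 < d)%N) (p_gt0 : (0 < p)%N) (z_gt0 : 0 < complex.Im z)
  (kap_ge0 : 0 <= kap) (H_herm : H \is hermsymmx) (Z_herm : Z \is hermsymmx)
  (Z_op : forall B : 'M[R[i]]_(d ^ 2), frob (Z *m B) <= kap * frob B).

Local Notation n := (d ^ 2)%N.
Local Notation c := (n%:R / p%:R : R).
Local Notation b := ((complex.Im z)^-1 : R).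
Local Notation w := (normc z : R).
Local Notation r := ((Num.sqrt d%:R)^-1 : R).
Local Notation H0 := (H - (p%:R^-1)%:C *: Z).
Local Notation A := (resolvent H0 z).

(* The sizes of [Z], of [\tr (Z A ^ 2)] and of the operator norm of [Z] are normalized so
   that they are all of order one for a column of a Gaussian matrix. *)
Lemma leave_one_out_square_le :
  complex.Re (Num.conj (defect c H z) *
    (n%:R^-1 * \tr (Z *m resolvent H z) + c%:C * stieltjes H z ^+ 2)) <=
  complex.Re (Num.conj (defect c H0 z) * (n%:R^-1 * \tr (Z *m A)))
  - complex.Re (Num.conj (defect c H0 z) *
      ((p%:R^-1 / n%:R)%:C * (\tr (Z *m A *m Z *m A) - \tr A ^+ 2)))
  + r * error_constant c b w * size_moments (frob Z / d%:R ^+ 2)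
      (normc (\tr (Z *m (A *m A))) / d%:R) (kap * r ^+ 3).
Proof.
set rt := (Num.sqrt d%:R)^-1; set cc := c; pose x := frob Z / d%:R ^+ 2.
pose u := normc (\tr (Z *m (A *m A))) / d%:R; pose k := kap * rt ^+ 3.
have n_gt0 : (0 < n)%N by rewrite expn_gt0 d_gt0.
have d_pos : 0 < d%:R :> R by rewrite ltr0n.
have pV_ge0 : 0 <= p%:R^-1 :> R by rewrite invr_ge0.
have c_ge0 : 0 <= cc by rewrite mulr_ge0.
have b_ge0 : 0 <= b by rewrite invr_ge0 ltW.
have rt_gt0 : 0 < rt by rewrite invr_gt0 sqrtr_gt0.
have rt_neq0 : rt != 0 by rewrite gt_eqF.
have rt_le1 : rt <= 1 by rewrite invf_le1 ?sqrtr_gt0 // -[leLHS]sqrtr1 ler_wsqrtr ?ler1n.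
have dE : d%:R = rt ^- 2 by rewrite exprVn sqr_sqrtr ?invrK // ltW.
have nE : n%:R = rt ^- 4 :> R by rewrite natrX dE; field.
have pVE : p%:R^-1 = cc * rt ^+ 4 by rewrite /cc nE; field; rewrite rt_neq0 gt_eqF ?ltr0n.
have xE : frob Z = x * rt ^- 4 by rewrite /x dE; field.
have uE : normc (\tr (Z *m (A *m A))) = u * rt ^- 2 by rewrite /u dE; field.
have kE : kap = k * rt ^- 3 by rewrite /k; field.
have stieltjes_le := normc_stieltjes_change z_gt0 pV_ge0 H_herm Z_herm.
apply: le_trans (leave_one_out_le n_gt0 z_gt0 pV_ge0 kap_ge0 H_herm Z_herm Z_op) _.
rewrite lerD2l.
have x_ge0 : 0 <= x by rewrite divr_ge0 ?frob_ge0.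
have u_ge0 : 0 <= u by rewrite divr_ge0 ?normc_ge0.
have dl_le : normc (stieltjes H z - stieltjes H0 z) <=
    rt ^+ 4 * (cc * u + cc ^+ 2 * b ^+ 3 * x ^+ 2).
  apply: le_trans stieltjes_le _; rewrite nE invrK ler_wpM2l ?exprn_ge0 ?(ltW rt_gt0) //.
  rewrite xE uE pVE; apply: lerD.
    rewrite (_ : _ * (u * _) = cc * u * rt ^+ 2); last by field.
    by apply: ler_piMr; [exact: mulr_ge0|rewrite exprn_ile1 // ltW].
  by apply: eq_ler; field; rewrite rt_neq0 gt_eqF.
apply: le_trans _ (error_terms_le k c_ge0 b_ge0 (normc_ge0 z) rt_gt0 rt_le1 x_ge0 u_ge0 dl_le).
rewrite -/cc sqrt_natr_sqr xE kE pVE nE dE; apply: eq_ler.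
by rewrite /defect_bound; field; rewrite rt_neq0 gt_eqF.
Qed.

End leave_one_out_square.

(** * Random matrices with a Wigner covariance *)

Lemma sum_eq_mull (I : finType) (F : pzSemiRingType) (x : I) (f : I -> F) :
  \sum_y (x == y)%:R * f y = f x.
Proof.
rewrite (bigD1 x) //= eqxx mul1r big1 ?addr0 // => y yx.
by rewrite eq_sym (negPf yx) mul0r.
Qed.

Lemma mxtrace_mulE (F : pzSemiRingType) m n (A : 'M[F]_(m, n)) (B : 'M[F]_(n, m)) :
  \tr (A *m B) = \sum_i \sum_j A i j * B j i.
Proof. by apply: eq_bigr => i _; rewrite mxE. Qed.

Section wick.
Variables (F : comPzRingType) (n : nat) (rho : F) (ex : 'I_n -> F).
Implicit Types (a b c e : 'I_n) (w : 'I_n -> 'I_n -> 'I_n -> 'I_n -> F).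

(* The covariance of a GUE matrix if [rho = 0] and of a GOE matrix if [rho = 1], with a
   correction [ex] on the diagonal. *)
Definition wigner_cov a b c e : F :=
  ((a == e) && (b == c))%:R + rho * ((a == c) && (b == e))%:R
  + ex a * [&& a == b, b == c & c == e]%:R.

Definition wick_contraction w : F :=
  \sum_a (\sum_b (w a b b a + rho * w a b a b) + ex a * w a a a a).

Definition quadratic_form (M : 'M[F]_n) w : F :=
  \sum_a \sum_b \sum_c \sum_e M a b * M c e * w a b c e.

Lemma sum_wigner_cov w :
  \sum_a \sum_b \sum_c \sum_e wigner_cov a b c e * w a b c e = wick_contraction w.
Proof.
apply: eq_bigr => a _; rewrite -[in RHS](sum_eq_mull a (fun b => ex a * w a b b b)).
rewrite -big_split /=; apply: eq_bigr => b _.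
transitivity (\sum_c ((b == c)%:R * w a b c a + rho * ((a == c)%:R * w a b c b)
   + (a == b)%:R * (ex a * ((b == c)%:R * w a b c c)))).
  apply: eq_bigr => c _.
  rewrite -[w a b c a](sum_eq_mull a (w a b c)) -[w a b c b](sum_eq_mull b (w a b c)).
  rewrite -[w a b c c](sum_eq_mull c (w a b c)) !mulr_sumr -!big_split /=.
  by apply: eq_bigr => e _; rewrite /wigner_cov -!mulnb !natrM; ring.
by rewrite !big_split /= sum_eq_mull -mulr_sumr sum_eq_mull -!mulr_sumr sum_eq_mull.
Qed.

Lemma wick_contractionZ (x : F) w :
  wick_contraction (fun a b c e => x * w a b c e) = x * wick_contraction w.
Proof.
rewrite mulr_sumr; apply: eq_bigr => a _; rewrite mulrDr mulr_sumr; congr (_ + _).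
  by apply: eq_bigr => b _; ring.
by ring.
Qed.

Lemma quadratic_formZ (M : 'M[F]_n) (x : F) w :
  quadratic_form M (fun a b c e => x * w a b c e) = x * quadratic_form M w.
Proof.
rewrite mulr_sumr; apply: eq_bigr => a _; rewrite mulr_sumr; apply: eq_bigr => b _.
rewrite mulr_sumr; apply: eq_bigr => c _; rewrite mulr_sumr; apply: eq_bigr => e _.
by rewrite mulrCA.
Qed.

Lemma mxtrace_quadratic_form (Z A : 'M[F]_n) :
  \tr (Z *m A *m Z *m A) = quadratic_form Z (fun a b c e => A b c * A e a).
Proof.
rewrite -!mulmxA mxtrace_mulE; apply: eq_bigr => a _; apply: eq_bigr => b _.
rewrite mxE mulr_sumr; apply: eq_bigr => c _; rewrite mxE !mulr_sumr.
by apply: eq_bigr => e _; ring.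
Qed.

Definition pairing_remainder (B C : 'M[F]_n) : F :=
  \sum_a (\sum_b rho * (B b a * C b a) + ex a * (B a a * C a a)).

Lemma wick_contraction_square (A : 'M[F]_n) :
  wick_contraction (fun a b c e => A b c * A e a) = \tr A ^+ 2 + pairing_remainder A A.
Proof.
rewrite expr2 big_distrlr exchange_big -big_split /=; apply: eq_bigr => a _.
by rewrite big_split /= addrA.
Qed.

End wick.

Section wick_bounds.
Variables (R : realType) (n : nat) (rho C : R) (ex : 'I_n -> R[i]).
Hypotheses (rho01 : 0 <= rho <= 1) (C_ge0 : 0 <= C) (ex_le : forall a, normc (ex a) <= C).
Implicit Types A B Z : 'M[R[i]]_n.

Lemma normc_mxtrace_quadratic_form Z B : Z \is hermsymmx ->
  (normc (\tr (Z *m B)) ^+ 2)%:C =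
  quadratic_form Z (fun a b c e => B b a * Num.conj (B c e)).
Proof.
move=> /hermsymmxP Z_herm; rewrite -mul_conjc.
have -> : Num.conj (\tr (Z *m B)) = \sum_c \sum_e Z c e * Num.conj (B c e).
  rewrite mxtrace_mulE rmorph_sum [RHS]exchange_big; apply: eq_bigr => e _ /=.
  rewrite rmorph_sum; apply: eq_bigr => c _ /=; rewrite rmorphM /=; congr (_ * _).
  by rewrite -[in RHS]Z_herm !mxE.
rewrite mxtrace_mulE mulr_suml; apply: eq_bigr => a _.
rewrite mulr_suml; apply: eq_bigr => b _; rewrite mulr_sumr; apply: eq_bigr => c _.
by rewrite mulr_sumr; apply: eq_bigr => e _; rewrite mulrACA.
Qed.

Lemma wick_contraction_adjoint B :
  wick_contraction rho%:C ex (fun a b c e => B b a * Num.conj (B c e)) =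
  (frob B ^+ 2)%:C + pairing_remainder rho%:C ex B (B ^t*).
Proof.
rewrite -frob_tr sqr_frob rmorph_sum -big_split /=; apply: eq_bigr => a _.
rewrite rmorph_sum addrA -big_split /= !mxE; congr (_ + _).
by apply: eq_bigr => b _; rewrite mul_conjc !mxE.
Qed.

(* Only few of the entries are paired, which makes Frobenius norms sufficient. *)
Lemma normc_pairing_remainder_le A B :
  normc (pairing_remainder rho%:C ex A B) <= (1 + C) * (frob A * frob B).
Proof.
have /andP[rho_ge0 rho_le1] := rho01.
rewrite /pairing_remainder big_split /= mulrDl mul1r.
apply: le_trans (le_normcD _ _) _; apply: lerD.
  apply: le_trans (normc_sum_le _ _ _) _; rewrite -(frob_tr A) -(frob_tr B).
  apply: le_trans (sum_normcM_le _ _); apply: ler_sum => a _.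
  apply: le_trans (normc_sum_le _ _ _) _; apply: ler_sum => b _.
  rewrite !normcM normc_real ger0_norm // !mxE.
  by rewrite ler_piMl // mulr_ge0 ?normc_ge0.
apply: (@le_trans _ _ (\sum_a C * \sum_b normc (A a b) * normc (B a b))).
  apply: le_trans (normc_sum_le _ _ _) _; apply: ler_sum => a _.
  rewrite !normcM (bigD1 a) //=; apply: ler_pM; rewrite ?mulr_ge0 ?normc_ge0 ?ex_le //.
  by rewrite lerDl sumr_ge0 // => b _; rewrite mulr_ge0 ?normc_ge0.
by rewrite -mulr_sumr ler_wpM2l // sum_normcM_le.
Qed.

End wick_bounds.

Section wigner_forms.
Context (disp : measure_display) (T : measurableType disp) (R : realType)
  (P : probability T R).
Context (disp' : measure_display) (T' : measurableType disp') (I : finType)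
  (X : I -> T -> T') (J L : {set I}).
Hypotheses (X_meas : forall i, measurable_fun setT (X i))
  (X_indep : mutually_independent P X) (JL_disjoint : [disjoint J & L]%B).
Variables (n : nat) (Z : T -> 'M[R[i]]_n) (rho : R) (ex : 'I_n -> R[i]).

Definition has_wigner_covariance : Prop :=
  (forall a b, cintegrable P (fun t => Z t a b) /\
     cexpectation P (fun t => Z t a b) = 0) /\
  (forall a b c e, cintegrable P (fun t => Z t a b * Z t c e) /\
     cexpectation P (fun t => Z t a b * Z t c e) = wigner_cov rho%:C ex a b c e).

Hypotheses (Z_meas : mxmeasurable (Z : sub_sigma X J -> _))
  (Z_wigner : has_wigner_covariance).

Let bounded_integrable (F : T -> R[i]) (C : R) :
  cmeasurable (F : sub_sigma X L -> R[i]) -> (forall t, normc (F t) <= C) -> cintegrable P F.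
Proof. by move=> mF; apply: cintegrable_bounded; exact: (cmeasurable_sub_sigma X_meas mF). Qed.

Lemma expectation_linear_form (W : 'I_n -> 'I_n -> T -> R[i]) (C : R) :
  (forall a b, cmeasurable (W a b : sub_sigma X L -> R[i])) ->
  (forall a b t, normc (W a b t) <= C) ->
  cintegrable P (fun t => \sum_a \sum_b Z t a b * W a b t) /\
  cexpectation P (fun t => \sum_a \sum_b Z t a b * W a b t) = 0.
Proof.
move=> W_meas W_le; have [Z_mean _] := Z_wigner.
have ZW a b := cexpectation_mul_sub_sigma X_meas X_indep JL_disjoint (Z_meas a b)
  (W_meas a b) (Z_mean a b).1 (bounded_integrable (W_meas a b) (W_le a b)).
have ZW_int a := cintegrable_sum (index_enum _) xpredT (fun b => (ZW a b).1).
split; first exact: cintegrable_sum.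
rewrite cexpectation_sum // big1 // => a _; rewrite cexpectation_sum; last first.
  by move=> b; exact: (ZW a b).1.
by rewrite big1 // => b _; rewrite (ZW a b).2 (Z_mean a b).2 mul0r.
Qed.

Lemma expectation_quadratic_form (W : T -> 'I_n -> 'I_n -> 'I_n -> 'I_n -> R[i]) (C : R) :
  (forall a b c e, cmeasurable ((fun t => W t a b c e) : sub_sigma X L -> R[i])) ->
  (forall a b c e t, normc (W t a b c e) <= C) ->
  [/\ cintegrable P (fun t => quadratic_form (Z t) (W t)),
      cintegrable P (fun t => wick_contraction rho%:C ex (W t)) &
      cexpectation P (fun t => quadratic_form (Z t) (W t)) =
      cexpectation P (fun t => wick_contraction rho%:C ex (W t))].
Proof.
move=> W_meas W_le; have [_ Z_cov] := Z_wigner.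
have W_int a b c e := bounded_integrable (W_meas a b c e) (W_le a b c e).
have ZW a b c e := cexpectation_mul_sub_sigma X_meas X_indep JL_disjoint
  (cmeasurableM (Z_meas a b) (Z_meas c e)) (W_meas a b c e) (Z_cov a b c e).1 (W_int a b c e).
have quad1 a b c := cintegrable_sum (index_enum _) xpredT (fun e => (ZW a b c e).1).
have quad2 a b := cintegrable_sum (index_enum _) xpredT (quad1 a b).
have quad3 a := cintegrable_sum (index_enum _) xpredT (quad2 a).
have wick1 a b := cintegrableD (W_int a b b a) (cintegrableZ rho%:C (W_int a b a b)).
have wick2 a := cintegrable_sum (index_enum _) xpredT (wick1 a).
have wick3 a := cintegrableD (wick2 a) (cintegrableZ (ex a) (W_int a a a a)).
split; [exact: cintegrable_sum|exact: cintegrable_sum|].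
transitivity (wick_contraction rho%:C ex
    (fun a b c e => cexpectation P (fun t => W t a b c e))).
  rewrite -sum_wigner_cov cexpectation_sum //; apply: eq_bigr => a _.
  rewrite cexpectation_sum //; apply: eq_bigr => b _.
  rewrite cexpectation_sum //; apply: eq_bigr => c _.
  rewrite cexpectation_sum => [|e]; last exact: (ZW a b c e).1.
  by apply: eq_bigr => e _; rewrite (ZW a b c e).2 (Z_cov a b c e).2.
rewrite cexpectation_sum //; apply: eq_bigr => a _.
rewrite cexpectationD //; last exact: cintegrableZ.
rewrite cexpectationZ // cexpectation_sum //; congr (_ + _); apply: eq_bigr => b _.
by rewrite cexpectationD ?cexpectationZ //; exact: cintegrableZ.
Qed.

Variables (om : T -> R[i]) (A : T -> 'M[R[i]]_n) (C0 C1 C : R).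
Hypotheses (om_meas : cmeasurable (om : sub_sigma X L -> R[i]))
  (A_meas : mxmeasurable (A : sub_sigma X L -> _))
  (om_le : forall t, normc (om t) <= C0) (A_le : forall t, frob (A t) <= C1).

Let entry_le t a b : normc (A t a b) <= C1.
Proof. exact: le_trans (normc_entry_le_frob _ _ _) (A_le t). Qed.

Lemma expectation_mul_mxtrace :
  cintegrable P (fun t => om t * \tr (Z t *m A t)) /\
  cexpectation P (fun t => om t * \tr (Z t *m A t)) = 0.
Proof.
have FE t : om t * \tr (Z t *m A t) = \sum_a \sum_b Z t a b * (om t * A t b a).
  rewrite mxtrace_mulE mulr_sumr; apply: eq_bigr => a _; rewrite mulr_sumr.
  by apply: eq_bigr => b _; rewrite mulrCA.
rewrite (funext FE); apply: (@expectation_linear_form _ (C0 * C1)) => [a b|a b t].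
  exact: cmeasurableM.
by rewrite normcM ler_pM ?normc_ge0.
Qed.

Hypotheses (rho01 : 0 <= rho <= 1) (C_ge0 : 0 <= C) (ex_le : forall a, normc (ex a) <= C).

Lemma expectation_mul_mxtrace_square :
  let F t := om t * (\tr (Z t *m A t *m Z t *m A t) - \tr (A t) ^+ 2) in
  cintegrable P F /\ - complex.Re (cexpectation P F) <= C0 * ((1 + C) * (C1 * C1)).
Proof.
pose W t a b c e := om t * (A t b c * A t e a).
have [||quad_int wick_int quad_wick] := @expectation_quadratic_form W (C0 * (C1 * C1)).
- by move=> a b c e; do 2!apply: cmeasurableM => //.
- by move=> a b c e t; rewrite !normcM !ler_pM ?mulr_ge0 ?normc_ge0.
pose Q t := om t * \tr (A t) ^+ 2.
have Q_meas : cmeasurable (Q : sub_sigma X L -> _).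
  have mtr := cmeasurable_mxtrace A_meas.
  by apply: cmeasurableM => //; exact: cmeasurableM.
have Q_int : cintegrable P Q.
  apply: (bounded_integrable Q_meas (C := C0 * (C1 * Num.sqrt n%:R) ^+ 2)) => t.
  have trA_le : normc (\tr (A t)) <= C1 * Num.sqrt n%:R.
    rewrite -[A t]mulmx1 -frob1; apply: le_trans (normc_mxtraceM_le _ _) _.
    by rewrite ler_wpM2r ?frob_ge0.
  by rewrite normcM !expr2 normcM !ler_pM ?mulr_ge0 ?normc_ge0.
move=> F; have -> : F = fun t => quadratic_form (Z t) (W t) + - Q t.
  by apply/funext => t; rewrite /F mulrBr mxtrace_quadratic_form -quadratic_formZ.
have remainderE t : wick_contraction rho%:C ex (W t) + - Q t =
    om t * pairing_remainder rho%:C ex (A t) (A t).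
  by rewrite wick_contractionZ wick_contraction_square /Q; ring.
have rem_int := cintegrableD wick_int (cintegrableN Q_int).
split; first exact: cintegrableD quad_int (cintegrableN Q_int).
rewrite cexpectationD // ?quad_wick -?cexpectationD //; try exact: cintegrableN.
rewrite -raddfN -cexpectationN //; apply: Re_cexpectation_le => [|t].
  exact: cintegrableN.
rewrite remainderE; apply: le_trans (Re_le_normc _) _; rewrite normcN normcM.
rewrite ler_pM ?normc_ge0 //; apply: le_trans (normc_pairing_remainder_le rho01 C_ge0 ex_le _ _) _.
by rewrite ler_wpM2l ?ler_pM ?frob_ge0 ?addr_ge0.
Qed.

Lemma expectation_sqr_mxtrace : (forall t, Z t \is hermsymmx) ->
  rintegrable P (fun t => normc (\tr (Z t *m A t)) ^+ 2) /\
  \int[P]_t (normc (\tr (Z t *m A t)) ^+ 2) <= (2 + C) * (C1 * C1).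
Proof.
move=> Z_herm; pose W t a b c e := A t b a * Num.conj (A t c e).
have [||[quad_int _] wick_int quad_wick] := @expectation_quadratic_form W (C1 * C1).
- by move=> a b c e; apply: cmeasurableM => //; exact: cmeasurableJ.
- by move=> a b c e t; rewrite normcM normcJ ler_pM ?normc_ge0.
have sqrE t : normc (\tr (Z t *m A t)) ^+ 2 = complex.Re (quadratic_form (Z t) (W t)).
  by rewrite -normc_mxtrace_quadratic_form.
split; first by rewrite (funext sqrE).
have := congr1 (@complex.Re R) quad_wick; rewrite {1}/cexpectation /=.
under eq_Rintegral do rewrite -sqrE.
move=> ->; apply: Re_cexpectation_le => // t; apply: le_trans (Re_le_normc _) _.
rewrite wick_contraction_adjoint; apply: le_trans (le_normcD _ _) _.
have rem_le := normc_pairing_remainder_le rho01 C_ge0 ex_le (A t) ((A t) ^t*).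
apply: (@le_trans _ _ ((2 + C) * (frob (A t) * frob (A t)))); last first.
  by rewrite ler_wpM2l ?ler_pM ?frob_ge0 ?addr_ge0.
rewrite frob_trC in rem_le; rewrite normc_real ger0_norm ?sqr_ge0 // expr2.
by move: rem_le; set f := frob (A t) * frob (A t); lra.
Qed.

End wigner_forms.

(** * Gaussian columns *)

Section gaussian_columns.
Context (disp : measure_display) (T : measurableType disp) (R : realType)
  (P : probability T R) (kind : entry_kind) (d p : nat)
  (G : T -> 'M[R[i]]_(d ^ 2, p)).
Hypothesis G_gauss : is_gaussian_matrix P kind G.
Local Notation n := (d ^ 2)%N.
Local Notation rho := (second_moment R kind).
Local Notation C8 := (eighth_moment_bound R kind).
Implicit Types (s : 'I_p) (a b c e : 'I_n) (t : T).

Definition entry (x : 'I_n * 'I_p) t : R[i] := G t x.1 x.2.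

Local Notation ex s a := (excess P entry rho (a, s)).

Lemma entry_standardized x : standardized P rho C8 (entry x).
Proof. exact: std_normal_standardized (G_gauss.1 x.1 x.2). Qed.

Lemma entry_independent : mutually_independent P (re_im entry).
Proof. exact: G_gauss.2. Qed.

Lemma measurable_re_im_entry x : measurable_fun setT (re_im entry x).
Proof. exact: (measurable_re_im entry_standardized x). Qed.

Lemma sqr_second_moment : rho ^+ 2 = rho.
Proof. by case: kind; rewrite /= ?expr1n ?expr0n. Qed.

Lemma second_moment_itv : 0 <= rho <= 1.
Proof. by case: kind; rewrite /= ?lexx ?ler01. Qed.

Definition excess_bound : R := 5 + C8.

Lemma excess_bound_ge0 : 0 <= excess_bound.
Proof. by rewrite addr_ge0 // eighth_moment_bound_ge0. Qed.

Lemma normc_excess_entry_le s a : normc (ex s a) <= excess_bound.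
Proof.
apply: le_trans (normc_excess_le entry_standardized (a, s)) _.
by have /andP[_] := second_moment_itv; rewrite sqr_second_moment /excess_bound; lra.
Qed.

Definition col_set s : {set 'I_n * 'I_p} := [set x | x.2 == s]%SET.
Definition other_cols s : {set 'I_n * 'I_p} := [set x | x.2 != s]%SET.

Lemma card_col_set s : #|col_set s| = n.
Proof.
have -> : col_set s = [set (a, s) | a in 'I_n]%SET.
  apply/setP => -[a s']; rewrite inE /=; apply/eqP/imsetP => [->|[a' _ [_ ->]]] //.
  by exists a.
by rewrite card_imset ?card_ord // => a a' [].
Qed.

Lemma disjoint_col_other s : [disjoint col_set s & other_cols s]%B.
Proof. by apply/pred0P => x /=; rewrite !inE; case: (x.2 == s). Qed.

Lemma sqnorm_col_set s t : sqnorm entry (col_set s) t = \sum_a normc (G t a s) ^+ 2.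
Proof.
rewrite /sqnorm (eq_bigl (fun x : 'I_n * 'I_p => xpredT x.1 && (x.2 == s))); last first.
  by move=> x; rewrite inE.
rewrite -(pair_big xpredT (fun s' => s' == s) (fun a s' => normc (G t a s') ^+ 2)) /=.
by apply: eq_bigr => a _; rewrite big_pred1_eq.
Qed.

Definition centered_col s t : 'M[R[i]]_n := rank1pt (fun a => G t a s) - 1%:M.
Local Notation Z := centered_col.

Lemma centered_col_hermsymmx s t : Z s t \is hermsymmx.
Proof. by rewrite rpredB ?rank1pt_hermsymmx ?hermsymmx1. Qed.

Lemma centered_colE s t a b : Z s t a b =
  entry (mixed a b, s) t * Num.conj (entry (mixed b a, s) t) - (a == b)%:R.
Proof. by rewrite !mxE. Qed.

Lemma mxmeasurable_centered_col (J : {set 'I_n * 'I_p}) s : col_set s \subset J ->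
  mxmeasurable (Z s : sub_sigma (re_im entry) J -> _).
Proof.
move=> /fintype.subsetP sJ a b; under eq_fun do rewrite centered_colE.
apply: cmeasurableD; last exact: cmeasurable_cst.
have aJ c : (c, s) \in J by apply: sJ; rewrite inE.
by apply: cmeasurableM; [|apply: cmeasurableJ]; exact: cmeasurable_entry.
Qed.

Let pairing s a b := [:: (false, (mixed a b, s)); (true, (mixed b a, s))].

Let centered_col_monomial s t a b :
  Z s t a b = monomial entry (pairing s a b) t + - (a == b)%:R.
Proof. by rewrite centered_colE /monomial big_cons big_seq1. Qed.

Let expectation_pairing s a b : cexpectation P (monomial entry (pairing s a b)) = (a == b)%:R.
Proof.
by rewrite (expectation_mul2 entry_standardized entry_independent) xpair_eqE eqxx andbT mixed_eqC.
Qed.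

Let expectation_pairing2 s a b c e :
  cexpectation P (monomial entry (pairing s a b ++ pairing s c e)) =
  (a == b)%:R * (c == e)%:R + wigner_cov rho%:C (fun a => ex s a) a b c e.
Proof.
rewrite (expectation_mul4 entry_standardized entry_independent) !xpair_eqE !eqxx !andbT.
rewrite !mixed_eqC !mixed_pair_eq sqr_second_moment.
have -> : [&& a == b, mixed b a == mixed c e & c == e] = [&& a == b, b == c & c == e].
  have [->|//] := eqVneq a b; have [->|//] := eqVneq c e; last by rewrite !andbF.
  by rewrite /= !andbT !mixed_id.
have -> : ex s (mixed a b) * [&& a == b, b == c & c == e]%:R =
     ex s a * [&& a == b, b == c & c == e]%:R.
  by have [->|] := eqVneq a b; [rewrite mixed_id|rewrite !mulr0].
by rewrite /wigner_cov -mulnb natrM; ring.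
Qed.

(* This is why the limit is semicircular. *)
Lemma centered_col_wigner s : has_wigner_covariance P (Z s) rho (fun a => ex s a).
Proof.
have mono_int := cintegrable_monomial entry_standardized.
split=> [a b|a b c e].
  under eq_fun do rewrite centered_col_monomial.
  have pair_int := @mono_int (pairing s a b) isT; have cst_int := cintegrable_cst P.
  split; first exact: cintegrableD.
  by rewrite cexpectationD // cexpectation_cst expectation_pairing; exact: subrr.
pose F1 := monomial entry (pairing s a b); pose F2 := monomial entry (pairing s c e).
have i1 : cintegrable P F1 by exact: mono_int.
have i2 : cintegrable P F2 by exact: mono_int.
have i4 : cintegrable P (monomial entry (pairing s a b ++ pairing s c e)) by exact: mono_int.
have FE t : Z s t a b * Z s t c e = monomial entry (pairing s a b ++ pairing s c e) t
    + (- (c == e)%:R * F1 t + (- (a == b)%:R * F2 t + (a == b)%:R * (c == e)%:R)).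
  by rewrite !centered_col_monomial /monomial big_cat /= -/(monomial _ _ _) /F1 /F2 /monomial; ring.
under eq_fun do rewrite FE.
have j1 := cintegrableZ (- (c == e)%:R) i1; have j2 := cintegrableZ (- (a == b)%:R) i2.
have j23 := cintegrableD j2 (cintegrable_cst P ((a == b)%:R * (c == e)%:R)).
have j123 := cintegrableD j1 j23; split; first exact: cintegrableD.
rewrite !cexpectationD ?cexpectationZ ?cexpectation_cst //; try exact: cintegrable_cst.
by rewrite expectation_pairing2 !expectation_pairing; ring.
Qed.

Lemma mxmeasurable_centered_colT s : mxmeasurable (Z s).
Proof.
move=> a b; apply: (cmeasurable_sub_sigma measurable_re_im_entry (J := [set: _]%SET)).
by apply: mxmeasurable_centered_col; exact: finset.subsetT.
Qed.

Hypothesis d_gt0 : (0 < d)%N.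

Lemma frob_centered_col_le s t : frob (Z s t) <= sqnorm entry (col_set s) t + d%:R.
Proof.
apply: le_trans (frobD _ _) _.
by rewrite frobN frob1 sqrt_natr_sqr frob_rank1pt sqnorm_col_set.
Qed.

Local Notation xhat s t := (frob (Z s t) / d%:R ^+ 2).

Lemma frob_centered_col_moment s : rintegrable P (fun t => xhat s t ^+ 4) /\
  \int[P]_t (xhat s t ^+ 4) <= 8 * (C8 + 1).
Proof.
have dR : 0 < d%:R :> R by rewrite ltr0n.
pose q t := sqnorm entry (col_set s) t.
have q_int : rintegrable P (fun t => q t ^+ 4) by exact: (rintegrable_sqnorm4 entry_standardized).
have dq_int := rintegrableZ (d%:R ^- 8) q_int.
have bound_int := rintegrableZ 8 (rintegrableD dq_int (rintegrable_cst P 1)).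
have x_le t : xhat s t ^+ 4 <= 8 * (d%:R ^- 8 * q t ^+ 4 + 1).
  rewrite expr_div_n ler_pdivrMr ?exprn_gt0 //.
  apply: (@le_trans _ _ ((q t + d%:R) ^+ 4)).
    by rewrite lerXn2r ?nnegrE ?frob_ge0 ?frob_centered_col_le // addr_ge0 ?sqnorm_ge0.
  apply: le_trans (expr4_add_le _ _) _.
  rewrite -mulrA ler_wpM2l // mulrDl mul1r -exprM; apply: lerD.
    by rewrite mulrAC mulVf ?mul1r // expf_neq0 // gt_eqF.
  by apply: ler_weXn2l => //; rewrite ler1n.
have x_int : rintegrable P (fun t => xhat s t ^+ 4).
  apply: rintegrable_le bound_int _ => [|t].
    apply: measurable_funX; apply: measurable_funM => //.
    by apply: measurable_frob; exact: mxmeasurable_centered_colT.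
  by rewrite ger0_norm // exprn_ge0 // divr_ge0 ?frob_ge0 ?exprn_ge0.
split=> //; apply: le_trans (le_Rintegral measurableT x_int bound_int (fun t _ => x_le t)) _.
rewrite RintegralZl //; last exact: rintegrableD dq_int (rintegrable_cst P 1).
rewrite ler_wpM2l // (RintegralD measurableT dq_int (rintegrable_cst P 1)).
rewrite Rintegral_prob_cst lerD2r RintegralZl // mulrC ler_pdivrMr ?exprn_gt0 //.
apply: le_trans (expectation_sqnorm4_le entry_standardized _) _.
by rewrite card_col_set natrX -exprM mulrC.
Qed.

Definition col_block s t : 'M[R[i]]_d := reshape (fun a => G t a s).
Local Notation M := col_block.

Definition col_opnorm_bound s t : R := frob (M s t *m (M s t) ^t*) + 1.

Lemma col_opnorm_bound_ge0 s t : 0 <= col_opnorm_bound s t.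
Proof. by rewrite addr_ge0 ?frob_ge0. Qed.

Lemma frob_centered_colM s t (B : 'M[R[i]]_n) :
  frob (Z s t *m B) <= col_opnorm_bound s t * frob B.
Proof.
rewrite mulmxBl mul1mx mulrDl mul1r; apply: le_trans (frobD _ _) _.
by rewrite frobN lerD2r frob_rank1ptM.
Qed.

Let gram_word s (i j k l : 'I_d) : seq (bool * ('I_n * 'I_p)) :=
  [:: (false, (mxtens_index (i, k), s)); (true, (mxtens_index (j, k), s));
      (false, (mxtens_index (j, l), s)); (true, (mxtens_index (i, l), s))].

Let sqr_frob_col_gram s t : (frob (M s t *m (M s t) ^t*) ^+ 2)%:C =
  \sum_i \sum_j \sum_k \sum_l monomial entry (gram_word s i j k l) t.
Proof.
rewrite sqr_frob_gram; do 4!(apply: eq_bigr => ? _).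
by rewrite /monomial /gram_word !big_cons big_nil !mxE /= mulr1 !mulrA.
Qed.

Let normc_expectation_gram_word s i j k l :
  normc (cexpectation P (monomial entry (gram_word s i j k l))) <=
  (i == j)%:R + (k == l)%:R + (1 + excess_bound) * ((i == j)%:R * (k == l)%:R).
Proof.
have /andP[rho0 rho1] := second_moment_itv.
rewrite (expectation_mul4 entry_standardized entry_independent) !xpair_eqE !eqxx !andbT.
rewrite !(can_eq (@mxtens_indexK _ _)) !xpair_eqE !eqxx !andbT /= (eq_sym j i).
rewrite sqr_second_moment !andbb.
have -> : [&& i == j, k == l & i == j] = (i == j) && (k == l) by rewrite andbCA andbb andbC.
rewrite -mulnb natrM.
have -> : (i == j)%:R + (k == l)%:R + (1 + excess_bound) * ((i == j)%:R * (k == l)%:R) =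
  (i == j)%:R + (k == l)%:R + (i == j)%:R * (k == l)%:R
  + excess_bound * ((i == j)%:R * (k == l)%:R) by ring.
apply: le_trans (le_normcD _ _) _; apply: lerD.
  apply: le_trans (le_normcD _ _) _; apply: lerD.
    by apply: le_trans (le_normcD _ _) _; rewrite !normc_nat.
  by rewrite !normcM !normc_nat normc_real ger0_norm // ler_piMl // mulr_ge0.
by rewrite !normcM !normc_nat ler_wpM2r ?mulr_ge0 ?normc_excess_entry_le.
Qed.

Lemma sum4_delta (C : R) : \sum_(i < d) \sum_(j < d) \sum_(k < d) \sum_(l < d)
    ((i == j)%:R + (k == l)%:R + C * ((i == j)%:R * (k == l)%:R)) =
  2 * d%:R ^+ 3 + C * d%:R ^+ 2.
Proof.
have sum_delta (x : 'I_d) : \sum_(y < d) (x == y)%:R = 1 :> R.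
  by rewrite -[RHS](sum_eq_mull x (fun=> 1)); apply: eq_bigr => y _; rewrite mulr1.
have sum_cst (x : R) : \sum_(y < d) x = x * d%:R by rewrite sumr_const card_ord mulr_natr.
transitivity (\sum_(i < d) \sum_(j < d) ((i == j)%:R * (d%:R ^+ 2 + C * d%:R) + d%:R)).
  do 2!(apply: eq_bigr => ? _); move: (_ == _)%:R => x.
  transitivity (\sum_(k < d) (x * d%:R + 1 + C * x)).
    by apply: eq_bigr => k _; rewrite !big_split /= -!mulr_sumr sum_delta mulr1 sum_cst.
  by rewrite sum_cst; ring.
under eq_bigr do rewrite big_split /= -mulr_suml sum_delta sum_cst.
by rewrite sum_cst; ring.
Qed.

Lemma expectation_sqr_col_gram s :
  rintegrable P (fun t => frob (M s t *m (M s t) ^t*) ^+ 2) /\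
  \int[P]_t (frob (M s t *m (M s t) ^t*) ^+ 2) <= (3 + excess_bound) * d%:R ^+ 3.
Proof.
have word_int i j k l : cintegrable P (monomial entry (gram_word s i j k l)).
  exact: (cintegrable_monomial entry_standardized).
have int1 i j k := cintegrable_sum (index_enum _) xpredT (word_int i j k).
have int2 i j := cintegrable_sum (index_enum _) xpredT (int1 i j).
have int3 i := cintegrable_sum (index_enum _) xpredT (int2 i).
have [int4 _] := cintegrable_sum (index_enum _) xpredT int3.
have gramE t : frob (M s t *m (M s t) ^t*) ^+ 2 =
    complex.Re (\sum_i \sum_j \sum_k \sum_l monomial entry (gram_word s i j k l) t).
  by rewrite -sqr_frob_col_gram.
split; first by rewrite (funext gramE).
rewrite (funext gramE) -[leLHS]/(complex.Re (cexpectation P (fun t =>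
  \sum_i \sum_j \sum_k \sum_l monomial entry (gram_word s i j k l) t))).
apply: le_trans (Re_le_normc _) _.
apply: (@le_trans _ _ (\sum_(i < d) \sum_(j < d) \sum_(k < d) \sum_(l < d)
  ((i == j)%:R + (k == l)%:R + (1 + excess_bound) * ((i == j)%:R * (k == l)%:R)))).
  rewrite cexpectation_sum //; apply: le_trans (normc_sum_le _ _ _) _; apply: ler_sum => i _.
  rewrite cexpectation_sum //; apply: le_trans (normc_sum_le _ _ _) _; apply: ler_sum => j _.
  rewrite cexpectation_sum //; apply: le_trans (normc_sum_le _ _ _) _; apply: ler_sum => k _.
  by rewrite cexpectation_sum //; apply: le_trans (normc_sum_le _ _ _) _; apply: ler_sum.
have d1 : 1 <= d%:R :> R by rewrite ler1n.
rewrite sum4_delta (_ : (3 + _) * _ = 2 * d%:R ^+ 3 + (1 + excess_bound) * d%:R ^+ 3); last by ring.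
by rewrite lerD2l ler_wpM2l ?(addr_ge0 _ excess_bound_ge0) // ler_weXn2l.
Qed.

Local Notation r := ((Num.sqrt d%:R)^-1 : R).

Let r_expr6 : (r ^+ 3) ^+ 2 = d%:R ^- 3.
Proof. by rewrite exprAC exprVn sqr_sqrtr // exprVn. Qed.

Lemma col_opnorm_bound_moment s :
  rintegrable P (fun t => (col_opnorm_bound s t * r ^+ 3) ^+ 2) /\
  \int[P]_t ((col_opnorm_bound s t * r ^+ 3) ^+ 2) <= 2 * (4 + excess_bound).
Proof.
have dR : 0 < d%:R :> R by rewrite ltr0n.
have [gram_int gram_le] := expectation_sqr_col_gram s.
have scaled_int := rintegrableZ (2 * d%:R ^- 3) gram_int.
have bound_int := rintegrableD scaled_int (rintegrable_cst P 2).
have opnorm_le t : (col_opnorm_bound s t * r ^+ 3) ^+ 2 <=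
    2 * d%:R ^- 3 * frob (M s t *m (M s t) ^t*) ^+ 2 + 2.
  have d3_le1 : d%:R ^- 3 <= 1 :> R by rewrite invf_le1 ?exprn_gt0 // exprn_ege1 // ler1n.
  rewrite exprMn r_expr6; apply: le_trans (ler_wpM2r _ (sqr_add_le _ _)) _.
    by rewrite invr_ge0 exprn_ge0.
  rewrite expr1n mulrDr mulr1 mulrDl mulrAC lerD2l.
  by rewrite ler_piMr.
have opnorm_int : rintegrable P (fun t => (col_opnorm_bound s t * r ^+ 3) ^+ 2).
  apply: rintegrable_le bound_int _ => [|t]; last by rewrite ger0_norm ?sqr_ge0.
  apply: measurable_funX; apply: measurable_funM => //; apply: measurable_funD => //.
  have M_meas : mxmeasurable (M s).
    move=> i j; under eq_fun do rewrite mxE.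
    exact: (standardized_meas (entry_standardized (_, _))).
  by apply/measurable_frob/mxmeasurableM => //; exact: mxmeasurable_trC.
split=> //.
apply: le_trans (le_Rintegral measurableT opnorm_int bound_int (fun t _ => opnorm_le t)) _.
rewrite (RintegralD measurableT scaled_int (rintegrable_cst P 2)) Rintegral_prob_cst RintegralZl //.
apply: (@le_trans _ _ (2 * d%:R ^- 3 * ((3 + excess_bound) * d%:R ^+ 3) + 2)).
  by rewrite lerD2r ler_wpM2l // mulr_ge0 // invr_ge0 exprn_ge0.
apply: eq_ler; field.
by rewrite gt_eqF.
Qed.

End gaussian_columns.

(** * The second moment of the defect *)

Section defect_second_moment.
Context (disp : measure_display) (T : measurableType disp) (R : realType)
  (P : probability T R) (kind : entry_kind) (d p : nat)
  (G : T -> 'M[R[i]]_(d ^ 2, p)) (z : R[i]).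
Hypotheses (G_gauss : is_gaussian_matrix P kind G)
  (d_gt0 : (0 < d)%N) (p_gt0 : (0 < p)%N) (z_gt0 : 0 < complex.Im z).
Local Notation n := (d ^ 2)%N.
Local Notation nC := (n%:R : R[i]).
Local Notation q := (p%:R^-1 : R).
Local Notation b := ((complex.Im z)^-1 : R).
Local Notation w := (normc z : R).
Local Notation r := ((Num.sqrt d%:R)^-1 : R).
Local Notation c := (n%:R / p%:R : R).
Local Notation C8 := (eighth_moment_bound R kind).
Local Notation exb := (excess_bound R kind).
Local Notation Z := (centered_col G).

Definition centered_average t : 'M[R[i]]_n := (p%:R^-1)%:C *: \sum_s Z s t.
Local Notation H := centered_average.
Local Notation H0 s t := (H t - q%:C *: Z s t).
Local Notation A s t := (resolvent (H0 s t) z).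
Local Notation D t := (defect c (H t) z).
Local Notation D0 s t := (defect c (H0 s t) z).

Lemma centered_average_hermsymmx t : H t \is hermsymmx.
Proof. by rewrite hermsymmxZ // rpred_sum // => s _; exact: centered_col_hermsymmx. Qed.

Let H0_herm s t : H0 s t \is hermsymmx.
Proof.
exact: hermsymmx_leave_one_out (centered_average_hermsymmx t) (centered_col_hermsymmx G s t).
Qed.

Lemma mxmeasurable_centered_average : mxmeasurable H.
Proof.
apply: mxmeasurableZ; apply: mxmeasurable_sum => s _.
exact: mxmeasurable_centered_colT G_gauss s.
Qed.

Let n_gt0 : (0 < n)%N. Proof. by rewrite expn_gt0 d_gt0. Qed.
Let Imz_neq0 : complex.Im z != 0. Proof. exact: lt0r_neq0. Qed.
Let b_ge0 : 0 <= b. Proof. by rewrite invr_ge0 ltW. Qed.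
Let c_ge0 : 0 <= c. Proof. by rewrite divr_ge0. Qed.
Let d_pos : 0 < d%:R :> R. Proof. by rewrite ltr0n. Qed.
Let p_pos : 0 < p%:R :> R. Proof. by rewrite ltr0n. Qed.
Let r_gt0 : 0 < r. Proof. by rewrite invr_gt0 sqrtr_gt0. Qed.
Let exb_ge0 : 0 <= exb. Proof. exact: excess_bound_ge0. Qed.
Let exb_b_ge0 : 0 <= (1 + exb) * b ^+ 2.
Proof. by rewrite mulr_ge0 ?sqr_ge0 // (addr_ge0 ler01 exb_ge0). Qed.

Let mxmeasurable_H0 s :
  mxmeasurable ((fun t => H0 s t) : sub_sigma (re_im (entry G)) (other_cols d s) -> _).
Proof.
have H0E t : H0 s t = q%:C *: \sum_(s' | s' != s) Z s' t.
  by rewrite /H (bigD1 s) //= scalerDr addrC addKr.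
rewrite (funext H0E); apply: mxmeasurableZ; apply: mxmeasurable_sum => s' s's.
by apply: mxmeasurable_centered_col; apply/fintype.subsetP => x; rewrite !inE => /eqP ->.
Qed.

Let mxmeasurable_A s :
  mxmeasurable ((fun t => A s t) : sub_sigma (re_im (entry G)) (other_cols d s) -> _).
Proof. exact: mxmeasurable_resolvent. Qed.

Let cmeasurable_D0 s (x : R[i]) : cmeasurable
  ((fun t => Num.conj (D0 s t) * x) : sub_sigma (re_im (entry G)) (other_cols d s) -> R[i]).
Proof.
apply: cmeasurableM; last exact: cmeasurable_cst.
by apply: cmeasurableJ; exact: cmeasurable_defect.
Qed.

Let normc_D0 s (x : R[i]) t :
  normc (Num.conj (D0 s t) * x) <= defect_bound c b w * normc x.
Proof. by rewrite normcM normcJ ler_wpM2r ?normc_ge0 //; exact: normc_defect_le. Qed.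

Let frob_A s t : frob (A s t) <= b * d%:R.
Proof.
by have := frob_resolvent (H0_herm s t) Imz_neq0; rewrite gtr0_norm // sqrt_natr_sqr.
Qed.

Let frob_AA s t : frob (A s t *m A s t) <= b * (b * d%:R).
Proof.
apply: le_trans (ler_wpM2l b_ge0 (frob_A s t)).
by have := frob_resolventMl (A s t) (H0_herm s t) Imz_neq0; rewrite gtr0_norm.
Qed.

Let re_im_meas x : measurable_fun setT (re_im (entry G) x).
Proof. exact: measurable_re_im_entry G_gauss x. Qed.

Let Z_meas s : mxmeasurable (Z s : sub_sigma (re_im (entry G)) (col_set d s) -> _).
Proof. by apply: mxmeasurable_centered_col; exact: fintype.subxx. Qed.

Let first_order s t := Num.conj (D0 s t) * (nC^-1 * \tr (Z s t *m A s t)).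

Lemma expectation_first_order s :
  cintegrable P (first_order s) /\ cexpectation P (first_order s) = 0.
Proof.
have -> : first_order s = fun t => Num.conj (D0 s t) * nC^-1 * \tr (Z s t *m A s t).
  by apply/funext => t; rewrite /first_order mulrA.
exact: (expectation_mul_mxtrace re_im_meas (entry_independent G_gauss)
  (disjoint_col_other d s) (Z_meas s) (centered_col_wigner G_gauss s)
  (cmeasurable_D0 s nC^-1) (mxmeasurable_A s) (normc_D0 s nC^-1) (frob_A s)).
Qed.

Let second_order s t := Num.conj (D0 s t) *
  ((q / n%:R)%:C * (\tr (Z s t *m A s t *m Z s t *m A s t) - \tr (A s t) ^+ 2)).

Lemma expectation_second_order s : cintegrable P (second_order s) /\
  - complex.Re (cexpectation P (second_order s)) <=
    defect_bound c b w * (q * ((1 + exb) * b ^+ 2)).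
Proof.
have -> : second_order s = fun t => Num.conj (D0 s t) * (q / n%:R)%:C *
    (\tr (Z s t *m A s t *m Z s t *m A s t) - \tr (A s t) ^+ 2).
  by apply/funext => t; rewrite /second_order mulrA.
have [F_int F_le] := expectation_mul_mxtrace_square re_im_meas (entry_independent G_gauss)
  (disjoint_col_other d s) (Z_meas s) (centered_col_wigner G_gauss s)
  (cmeasurable_D0 s (q / n%:R)%:C) (mxmeasurable_A s) (normc_D0 s (q / n%:R)%:C) (frob_A s)
  (second_moment_itv R kind) exb_ge0 (normc_excess_entry_le G_gauss s).
split=> //; apply: le_trans F_le _.
rewrite normc_real ger0_norm ?mulr_ge0 ?invr_ge0 // natrX; apply: eq_ler.
by field; rewrite !gt_eqF.
Qed.

Local Notation trZAA s t := (\tr (Z s t *m (A s t *m A s t))).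

Lemma expectation_sqr_trZAA s : rintegrable P (fun t => (normc (trZAA s t) / d%:R) ^+ 2) /\
  \int[P]_t ((normc (trZAA s t) / d%:R) ^+ 2) <= (2 + exb) * b ^+ 4.
Proof.
have [u_int u_le] := expectation_sqr_mxtrace re_im_meas (entry_independent G_gauss)
  (disjoint_col_other d s) (Z_meas s) (centered_col_wigner G_gauss s)
  (mxmeasurableM (mxmeasurable_A s) (mxmeasurable_A s)) (frob_AA s)
  (second_moment_itv R kind) exb_ge0 (normc_excess_entry_le G_gauss s)
  (centered_col_hermsymmx G s).
under eq_fun do rewrite expr_div_n mulrC.
split; first exact: rintegrableZ.
rewrite RintegralZl // mulrC ler_pdivrMr ?exprn_gt0 //; apply: le_trans u_le _.
by apply: eq_ler; ring.
Qed.

Let moments s t := size_moments (frob (Z s t) / d%:R ^+ 2) (normc (trZAA s t) / d%:R)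
  (col_opnorm_bound G s t * r ^+ 3).

Definition size_moments_bound : R :=
  1 + 8 * (C8 + 1) + (2 + exb) * b ^+ 4 + 2 * (4 + exb).

Lemma size_moments_bound_ge0 : 0 <= size_moments_bound.
Proof. by rewrite !addr_ge0 ?mulr_ge0 ?exprn_ge0 ?addr_ge0 ?eighth_moment_bound_ge0. Qed.

Lemma expectation_size_moments s : rintegrable P (moments s) /\
  \int[P]_t moments s t <= size_moments_bound.
Proof.
have [x_int x_le] := frob_centered_col_moment G_gauss d_gt0 s.
have [u_int u_le] := expectation_sqr_trZAA s.
have [k_int k_le] := col_opnorm_bound_moment G_gauss d_gt0 s.
have int1 := rintegrableD (rintegrable_cst P 1) x_int; have int2 := rintegrableD int1 u_int.
split; first exact: rintegrableD int2 k_int.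
rewrite /moments /size_moments (RintegralD measurableT int2 k_int).
rewrite (RintegralD measurableT int1 u_int) (RintegralD measurableT (rintegrable_cst P 1) x_int).
by rewrite Rintegral_prob_cst !lerD.
Qed.

Let column_term s t := complex.Re (Num.conj (D t) *
  (nC^-1 * \tr (Z s t *m resolvent (H t) z) + c%:C * stieltjes (H t) z ^+ 2)).

Let column_bound s t := complex.Re (first_order s t) + -1 * complex.Re (second_order s t)
  + (r * error_constant c b w) * moments s t.

Let column_term_le s t : column_term s t <= column_bound s t.
Proof.
apply: le_trans (leave_one_out_square_le d_gt0 p_gt0 z_gt0 (col_opnorm_bound_ge0 G s t)
  (centered_average_hermsymmx t) (centered_col_hermsymmx G s t) (frob_centered_colM G s t)) _.
by rewrite /column_bound mulN1r.
Qed.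

Let expectation_column_bound s : rintegrable P (column_bound s) /\
  \int[P]_t column_bound s t <= defect_bound c b w * (q * ((1 + exb) * b ^+ 2))
    + (r * error_constant c b w) * size_moments_bound.
Proof.
have [[int1 _] E1] := expectation_first_order s.
have [[int2 _] E2] := expectation_second_order s.
have [int3 E3] := expectation_size_moments s.
have int2' := rintegrableZ (-1) int2; have int12 := rintegrableD int1 int2'.
have int3' := rintegrableZ (r * error_constant c b w) int3.
split; first exact: rintegrableD int12 int3'.
rewrite /column_bound (RintegralD measurableT int12 int3') (RintegralD measurableT int1 int2').
rewrite (RintegralZl _ measurableT int2) (RintegralZl _ measurableT int3).
move/(congr1 (@complex.Re R)): E1 => /= E1; rewrite [X in X + _ + _]E1 add0r mulN1r.
apply: lerD; first exact: E2.
by rewrite ler_wpM2l // mulr_ge0 ?error_constant_ge0 ?normc_ge0 // ltW.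
Qed.

Definition defect_moment_constant (x : R) : R :=
  defect_bound x b w * (x * ((1 + exb) * b ^+ 2)) + error_constant x b w * size_moments_bound.

Let pV_le : q <= c * r.
Proof.
have qE : q = c * r ^+ 4.
  by rewrite (exprM _ 2 2) exprVn sqr_sqrtr ?ltW // exprVn -natrX; field; rewrite !gt_eqF.
rewrite [leLHS]qE; apply: ler_wpM2l => //; apply: ler_iXnr (ltW r_gt0) _ => //.
by rewrite invf_le1 ?sqrtr_gt0 // -[leLHS]sqrtr1 ler_wsqrtr ?ler1n.
Qed.

Lemma expectation_sqr_defect_le : rintegrable P (fun t => normc (D t) ^+ 2) /\
  \int[P]_t (normc (D t) ^+ 2) <= defect_moment_constant c * r.
Proof.
have D_int : rintegrable P (fun t => normc (D t) ^+ 2).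
  apply: (rintegrable_le _ (rintegrable_cst P (defect_bound c b w ^+ 2))) => [|t].
    apply: measurable_funX; apply: measurable_normc.
    apply: cmeasurable_defect => //; first exact: centered_average_hermsymmx.
    exact: mxmeasurable_centered_average.
  rewrite ger0_norm ?sqr_ge0 //; apply: lerXn2r; rewrite ?nnegrE ?normc_ge0 //.
    exact: defect_bound_ge0 (normc_ge0 _).
  by apply: normc_defect_le => //; exact: centered_average_hermsymmx.
split=> //; have sum_int : rintegrable P (fun t => \sum_s column_bound s t).
  by apply: rintegrable_sum => s _; have [] := expectation_column_bound s.
apply: le_trans (le_Rintegral measurableT D_int (rintegrableZ q sum_int) _) _ => [t _|].
  rewrite (sqr_normc_defect_average _ n_gt0 p_gt0 (centered_average_hermsymmx t) Imz_neq0).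
  by rewrite ler_wpM2l ?invr_ge0 //; apply: ler_sum => s _; exact: column_term_le.
rewrite RintegralZl // Rintegral_sum; last by move=> s _; have [] := expectation_column_bound s.
rewrite mulrC ler_pdivrMr // mulr_natr -[X in _ *+ X]card_ord -sumr_const.
apply: ler_sum => s _; have [_ /le_trans] := expectation_column_bound s; apply.
rewrite [leRHS]mulrDl; apply: lerD; last first.
  by apply: eq_ler; ring.
rewrite -mulrA ler_wpM2l ?defect_bound_ge0 ?normc_ge0 //.
by rewrite [leRHS]mulrAC ler_wpM2r.
Qed.

Lemma ler_defect_moment_constant (x y : R) :
  0 <= x -> x <= y -> defect_moment_constant x <= defect_moment_constant y.
Proof.
move=> x_ge0 x_le; have y_ge0 := le_trans x_ge0 x_le.
have w_ge0 : 0 <= w by exact: normc_ge0.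
apply: lerD; last by rewrite ler_wpM2r ?size_moments_bound_ge0 ?ler_error_constant.
apply: ler_pM; rewrite ?ler_defect_bound ?ler_wpM2r //; first exact: defect_bound_ge0.
exact: mulr_ge0.
Qed.

End defect_second_moment.

(** * The semicircle law *)

Lemma sqr_half_angle (R : realFieldType) (S Q x : R) : 0 < S -> 0 < Q ->
  S ^+ 2 = Q ^+ 2 + x ^+ 2 -> 1 + (x / (S + Q)) ^+ 2 = 2 * S / (S + Q).
Proof.
move=> S_gt0 Q_gt0 pythagoras; have SQ_neq0 : S + Q != 0 by rewrite gt_eqF ?addr_gt0.
rewrite expr_div_n (_ : x ^+ 2 = S ^+ 2 - Q ^+ 2); last by rewrite pythagoras; ring.
by field.
Qed.

Section semicircle_primitive.
Variables (R : realType) (v : R).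
Hypothesis v_gt0 : 0 < v.
Local Notation s := (2 * Num.sqrt v).
Local Notation root x := (Num.sqrt (4 * v - x ^+ 2)).
Local Notation density x := ((2 * pi * v)^-1 * root x).
Implicit Types x y : R.

(* A primitive of the centered density; [2 * atan (x / (s + root x))] is
   [asin (x / s)], but continuous up to and beyond the edges. *)
Definition semicircle_primitive x : R :=
  (2 * pi * v)^-1 * (2^-1 * (x * root x) + 4 * v * atan (x / (s + root x))).
Local Notation F := semicircle_primitive.

Let s_gt0 : 0 < s. Proof. by rewrite mulr_gt0 // sqrtr_gt0. Qed.

Let s_root_gt0 x : 0 < s + root x. Proof. by rewrite ltr_pwDl // sqrtr_ge0. Qed.

Lemma sqr_semicircle_edge : s ^+ 2 = 4 * v.
Proof. by rewrite exprMn sqr_sqrtr ?(ltW v_gt0) //; ring. Qed.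

Lemma semicircle_root_arg x : 4 * v - x ^+ 2 = (s - x) * (s + x).
Proof. by rewrite -sqr_semicircle_edge; ring. Qed.

Lemma continuous_semicircle_root : continuous (fun x => root x).
Proof.
move=> x; apply: (@continuous_comp _ _ _ (fun x => 4 * v - x ^+ 2)); last first.
  exact: sqrt_continuous.
by apply: cvgB; [exact: cvg_cst|exact: exprn_continuous].
Qed.

Lemma continuous_semicircle_primitive : continuous F.
Proof.
move=> x; have root_cvg := @continuous_semicircle_root x.
apply: cvgM; first exact: cvg_cst.
apply: cvgD; first by apply: cvgM; [exact: cvg_cst|apply: cvgM => //; exact: cvg_id].
apply: cvgM; first exact: cvg_cst.
apply: (@continuous_comp _ _ _ (fun x => x / (s + root x))); last exact: continuous_atan.
apply: cvgM; first exact: cvg_id.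
apply: cvgV; first by rewrite gt_eqF.
by apply: cvgD => //; exact: cvg_cst.
Qed.

Section interior.
Variable x : R.
Hypothesis x_itv : - s < x < s.

Let arg_gt0 : 0 < 4 * v - x ^+ 2.
Proof.
have /andP[s_x x_s] := x_itv.
by rewrite semicircle_root_arg mulr_gt0 // ?subr_gt0 // -ltrBlDl sub0r.
Qed.

Let root_gt0 : 0 < root x. Proof. by rewrite sqrtr_gt0. Qed.

Let sqr_edge : s ^+ 2 = root x ^+ 2 + x ^+ 2.
Proof. by rewrite sqr_sqrtr ?ltW // sqr_semicircle_edge subrK. Qed.

Lemma is_derive_semicircle_root : is_derive x 1 (fun x => root x) (- x / root x).
Proof.
have arg_diff : is_derive x 1 (fun x => 4 * v - x ^+ 2) (- (2 * x)).
  by apply: is_derive_eq; rewrite /GRing.scale /=; ring.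
apply: (is_derive_eq (@is_derive1_comp R Num.sqrt (fun x => 4 * v - x ^+ 2) x _ _
  (is_derive1_sqrt arg_gt0) arg_diff)).
by field; rewrite gt_eqF.
Qed.

Lemma is_derive_semicircle_angle :
  is_derive x 1 (fun x => atan (x / (s + root x))) (2 * root x)^-1.
Proof.
have sum_diff : is_derive x 1 (fun x => s + root x) (- x / root x).
  apply: (is_derive_eq (is_deriveD (is_derive_cst s x (1 : R)) is_derive_semicircle_root)).
  by rewrite add0r.
have inv_diff := @is_deriveV R (fun x => s + root x) x _ _ (lt0r_neq0 (s_root_gt0 x)) sum_diff.
have ratio_diff := is_deriveM (is_derive_id x (1 : R)) inv_diff.
apply: (is_derive_eq (@is_derive1_comp R (@atan R) (fun x => x / (s + root x)) x _ _
  (is_derive1_atan (x / (s + root x))) ratio_diff)).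
rewrite (sqr_half_angle s_gt0 root_gt0 sqr_edge) /GRing.scale /=.
have := s_root_gt0 x; move: sqr_edge root_gt0 s_gt0; move: (root x) s => Q S SQ Q_gt0 S_gt0 SQ_gt0.
have x2E : x * x = S ^+ 2 - Q ^+ 2 by rewrite SQ -expr2; ring.
have -> : x * (- (S + Q) ^- 2 * (- x / Q)) + (S + Q)^-1 * 1 = S / (Q * (S + Q)).
  transitivity (x * x / (Q * (S + Q) ^+ 2) + (S + Q)^-1); first by field; rewrite !gt_eqF.
  by rewrite x2E; field; rewrite !gt_eqF.
by field; rewrite !gt_eqF.
Qed.

Lemma is_derive_semicircle_primitive : is_derive x 1 F (density x).
Proof.
have chord_diff := is_deriveM (is_derive_id x (1 : R)) is_derive_semicircle_root.
apply: (is_derive_eq (is_deriveZ (2 * pi * v)^-1 (is_deriveD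
  (is_deriveZ 2^-1 chord_diff) (is_deriveZ (4 * v) is_derive_semicircle_angle)))).
have := sqr_edge; rewrite /GRing.scale /= sqr_semicircle_edge; move: root_gt0.
move: (root x) => Q Q_gt0 sqr_edgeQ; congr (_ * _).
by rewrite sqr_edgeQ; field; rewrite gt_eqF.
Qed.

End interior.

Lemma semicircle_primitive_edge : F s = 2^-1.
Proof.
rewrite /F sqr_semicircle_edge subrr sqrtr0 mulr0 mulr0 add0r addr0 divff ?gt_eqF //.
by rewrite atan1; have := pi_gt0 R; move: (pi : R) => p p_gt0; field; rewrite !gt_eqF.
Qed.

Lemma semicircle_primitiveN x : F (- x) = - F x.
Proof. by rewrite /F sqrrN !mulNr atanN; ring. Qed.

Lemma semicircle_root_modulus x y : - s <= x <= s -> - s <= y <= s -> x <= y ->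
  root y <= root x + Num.sqrt (2 * s * (y - x)).
Proof.
move=> /andP[s_x x_s] /andP[s_y y_s] x_y.
have arg_ge0 u : - s <= u -> u <= s -> 0 <= 4 * v - u ^+ 2.
  by move=> *; rewrite semicircle_root_arg mulr_ge0 // ?subr_ge0 // -lerBlDl sub0r.
have incr_ge0 : 0 <= 2 * s * (y - x) by rewrite mulr_ge0 ?subr_ge0 // mulr_ge0 // ltW.
apply: ler_of_sqr; first by rewrite addr_ge0 ?sqrtr_ge0.
rewrite sqrrD !sqr_sqrtr ?arg_ge0 //.
have cross_ge0 : 0 <= root x * Num.sqrt (2 * s * (y - x)) *+ 2.
  by rewrite mulrn_wge0 // mulr_ge0 // sqrtr_ge0.
have : x ^+ 2 - y ^+ 2 <= 2 * s * (y - x).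
  rewrite (_ : x ^+ 2 - y ^+ 2 = (- x - y) * (y - x)); last by ring.
  by rewrite ler_wpM2r ?subr_ge0 //; move: s_x s_y; lra.
by move: cross_ge0; lra.
Qed.

Lemma semicircle_primitive_step x y : - s <= x -> x < y -> y <= s ->
  F y - F x <= (y - x) * (density x + (2 * pi * v)^-1 * Num.sqrt (2 * s * (y - x))).
Proof.
move=> s_x x_y y_s.
have [u + ->] : exists2 u, u \in `]x, y[%R & F y - F x = density u * (y - x).
  apply: MVT => //; last first.
    by apply: continuous_subspaceT => ?; exact: continuous_semicircle_primitive.
  move=> u; rewrite in_itv /= => /andP[x_u u_y]; apply: is_derive_semicircle_primitive.
  by rewrite (le_lt_trans s_x x_u) (lt_le_trans u_y y_s).
rewrite in_itv /= => /andP[x_u u_y].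
rewrite mulrC; apply: ler_wpM2l; first by rewrite subr_ge0 ltW.
rewrite -mulrDr ler_wpM2l //; first by rewrite invr_ge0 ltW // !mulr_gt0 // pi_gt0.
apply: le_trans (semicircle_root_modulus _ _ (ltW x_u)) _.
- by rewrite s_x ltW // (lt_le_trans x_y).
- by rewrite (le_trans s_x (ltW x_u)) (le_trans (ltW u_y) y_s).
rewrite lerD2l; apply: ler_wsqrtr; apply: ler_wpM2l; last by rewrite lerD2r ltW.
by rewrite mulr_ge0 // ltW.
Qed.

End semicircle_primitive.

Section poisson_kernel.
Variables (R : realType) (eta : R).
Hypothesis eta_gt0 : 0 < eta.
Implicit Types x y : R.

Definition poisson_kernel y : R := eta / (y ^+ 2 + eta ^+ 2).
Local Notation K := poisson_kernel.

Let den_gt0 y : 0 < y ^+ 2 + eta ^+ 2.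
Proof. by rewrite ltr_wpDl ?sqr_ge0 // exprn_gt0. Qed.

Lemma Im_inv_sub x E : complex.Im ((x%:C - (E +i* eta))^-1) = K (x - E).
Proof. by rewrite /GRing.inv /= /K sub0r sqrrN mulNr opprK. Qed.

Lemma poisson_kernel_ge0 y : 0 <= K y.
Proof. by rewrite divr_ge0 // ltW. Qed.

Lemma poisson_kernelN y : K (- y) = K y.
Proof. by rewrite /K sqrrN. Qed.

Lemma poisson_kernel_far y dl : 0 < dl -> dl <= `|y| -> K y <= eta / dl ^+ 2.
Proof.
move=> dl_gt0 dl_y; rewrite ler_wpM2l ?(ltW eta_gt0) // lef_pV2 ?posrE ?exprn_gt0 //.
rewrite ler_wpDr ?sqr_ge0 // -[y ^+ 2]real_normK ?num_real //.
by apply: lerXn2r; rewrite ?nnegrE // ltW.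
Qed.

(* [K x - K y = eta (y - x) (y + x) / (...)], and [eta |y| <= (y ^+ 2 + eta ^+ 2) / 2]. *)
Lemma poisson_kernel_lipschitz x y : x <= y -> K x <= K y + (y - x) / eta ^+ 2.
Proof.
move=> xy; rewrite -lerBlDl.
have -> : K x - K y = (y - x) * (eta * (y + x) / ((x ^+ 2 + eta ^+ 2) * (y ^+ 2 + eta ^+ 2))).
  by rewrite /K; field; rewrite !gt_eqF.
apply: ler_wpM2l; rewrite ?subr_ge0 //.
rewrite ler_pdivrMr ?mulr_gt0 // [leRHS]mulrC ler_pdivlMr ?exprn_gt0 //.
have amgm u : 2 * (eta * u) <= u ^+ 2 + eta ^+ 2.
  by rewrite -subr_ge0 (_ : _ - _ = (u - eta) ^+ 2) ?sqr_ge0 //; ring.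
have := amgm x; have := amgm y; have := sqr_ge0 x; have := sqr_ge0 y.
have : 0 <= eta ^+ 2 by exact: sqr_ge0.
rewrite mulrDr.
move: (x ^+ 2) (y ^+ 2) (eta ^+ 2) (eta * x) (eta * y) => X Y e a b e_ge0 Y_ge0 X_ge0 bY aX.
have ab_le : a + b <= e + (X + Y) / 2 by lra.
apply: (@le_trans _ _ ((e + (X + Y) / 2) * e)); first by rewrite ler_wpM2r // addrC.
rewrite -subr_ge0 (_ : _ - _ = X * Y + (X * e + Y * e) / 2); last by field.
by rewrite addr_ge0 ?mulr_ge0 // addr_ge0 // mulr_ge0.
Qed.

Section primitive.
Variable x : R.

Let A y := atan ((y - x) / eta).

Let is_derive_A y : is_derive y 1 A (K (y - x)).
Proof.
have scaled_diff : is_derive y 1 (fun y => (y - x) / eta) eta^-1.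
  by apply: is_derive_eq; rewrite /GRing.scale /=; ring.
apply: (is_derive_eq (@is_derive1_comp R (@atan R) (fun y => (y - x) / eta) y _ _
  (is_derive1_atan ((y - x) / eta)) scaled_diff)).
by rewrite /K; have := den_gt0 (y - x); move: (y - x) => u u_den; field; rewrite !gt_eqF.
Qed.

Lemma poisson_kernel_step (y h : R) : 0 < h ->
  h * K (x - y) <= A (y + h) - A y + h * (h / eta ^+ 2).
Proof.
move=> h_gt0; have y_yh : y < y + h by rewrite ltrDl.
have A_cont : {within `[y, y + h], continuous A}.
  apply: continuous_subspaceT => u.
  by apply/differentiable_continuous/derivable1_diffP; have [] := is_derive_A u.
have [u] := @MVT R A (fun u => K (u - x)) _ _ y_yh (fun u _ => is_derive_A u) A_cont.
rewrite in_itv /= => /andP[y_u u_yh] ->; rewrite addrAC subrr add0r.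
rewrite [K (u - x) * h]mulrC -mulrDr ler_wpM2l ?(ltW h_gt0) // -poisson_kernelN opprB.
apply: le_trans (poisson_kernel_lipschitz (y := u - x) _) _; first by rewrite lerD2r ltW.
by rewrite lerD2l ler_wpM2r ?invr_ge0 ?sqr_ge0 //; lra.
Qed.

Lemma poisson_kernel_sum (a h : R) (N : nat) : 0 < h ->
  \sum_(k < N) h * K (x - (a + k%:R * h)) <= pi + N%:R * h * (h / eta ^+ 2).
Proof.
move=> h_gt0; pose node (k : nat) := a + k%:R * h.
apply: (@le_trans _ _ (\sum_(k < N) (A (node k.+1) - A (node k) + h * (h / eta ^+ 2)))).
  apply: ler_sum => k _; rewrite /node -natr1 mulrDl mul1r addrA.
  exact: poisson_kernel_step.
rewrite big_split /= sumr_const card_ord -[X in _ + X <= _]mulr_natl -mulrA lerD2r.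
rewrite -(big_mkord xpredT (fun k => A (node k.+1) - A (node k))).
rewrite (telescope_sumr (fun k => A (node k))) //.
have := atan_ltpi2 ((node N - x) / eta); have := atan_gtNpi2 ((node 0 - x) / eta).
by rewrite /A; lra.
Qed.

End primitive.

End poisson_kernel.

Section empirical.
Variables (R : realType) (v : R).
Implicit Types (n : nat) (z : R[i]) (I : set R).

Definition empirical n (x : 'I_n -> R) I : R := n%:R^-1 * \sum_i \1_I (x i).

Definition empirical_stieltjes n (x : 'I_n -> R) z : R[i] :=
  n%:R^-1 * \sum_i ((x i)%:C - z)^-1.

Definition small_defects (tau : R) (zs : seq R[i]) n (x : 'I_n -> R) : Prop :=
  {in zs, forall z, normc (semicircle_defect v z (empirical_stieltjes x z)) <= tau}.

Definition forced_by_small_defects (Q : forall n, ('I_n -> R) -> Prop) : Prop :=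
  exists (zs : seq R[i]) (tau : R), [/\ 0 < tau, {in zs, forall z, 0 < complex.Im z} &
    forall n (x : 'I_n -> R), (0 < n)%N -> small_defects tau zs x -> Q n x].

Lemma forced_by_small_defectsT (Q : forall n, ('I_n -> R) -> Prop) :
  (forall n (x : 'I_n -> R), (0 < n)%N -> Q n x) -> forced_by_small_defects Q.
Proof. by move=> Q_holds; exists [::], 1; split => // n x n_gt0 _; exact: Q_holds. Qed.

Lemma forced_by_small_defectsW (Q Q' : forall n, ('I_n -> R) -> Prop) :
  (forall n (x : 'I_n -> R), (0 < n)%N -> Q n x -> Q' n x) ->
  forced_by_small_defects Q -> forced_by_small_defects Q'.
Proof.
move=> QQ' [zs [tau [tau_gt0 zs_gt0 forceQ]]]; exists zs, tau; split => // n x n_gt0 small.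
exact/QQ'/forceQ.
Qed.

Lemma forced_by_small_defectsI (Q1 Q2 : forall n, ('I_n -> R) -> Prop) :
  forced_by_small_defects Q1 -> forced_by_small_defects Q2 ->
  forced_by_small_defects (fun n x => Q1 n x /\ Q2 n x).
Proof.
move=> [zs1 [t1 [t1_gt0 zs1_gt0 force1]]] [zs2 [t2 [t2_gt0 zs2_gt0 force2]]].
exists (zs1 ++ zs2), (Num.min t1 t2); split; first by rewrite lt_min t1_gt0.
  by move=> z; rewrite mem_cat => /orP[/zs1_gt0|/zs2_gt0].
move=> n x n_gt0 small; split; [apply: force1|apply: force2] => // z z_in.
  by apply: le_trans (small z _) _; rewrite ?mem_cat ?z_in // ge_min lexx.
by apply: le_trans (small z _) _; rewrite ?mem_cat ?z_in ?orbT // ge_min lexx orbT.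
Qed.

Lemma empirical_le n (x : 'I_n -> R) (c : R) I I' :
  (forall i, I (x i) -> I' (c + x i)) -> empirical x I <= empirical (fun i => c + x i) I'.
Proof.
move=> II'; rewrite ler_wpM2l ?invr_ge0 //; apply: ler_sum => i _.
by rewrite !indicE ler_nat; case: (boolP (x i \in I)) => // /set_mem/II'/mem_set ->.
Qed.

Lemma Im_empirical_stieltjes n (x : 'I_n -> R) E eta :
  complex.Im (empirical_stieltjes x (E +i* eta)) =
  n%:R^-1 * \sum_i poisson_kernel eta (x i - E).
Proof.
rewrite /empirical_stieltjes (_ : n%:R^-1 = (n%:R^-1 : R)%:C); last first.
  by rewrite (fmorphV (real_complex R)) rmorph_nat.
rewrite Im_realM raddf_sum; congr (_ * _).
by apply: eq_bigr => i _; exact: Im_inv_sub.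
Qed.

(* With [w := 2 v m + z], the defect [D] satisfies [w ^+ 2 = z ^+ 2 - 4 v + 4 v D];
   only the real part of this equation matters. *)
Lemma Im_ge_semicircle_root (E eta : R) (m : R[i]) :
  0 < v -> 0 < eta -> 0 <= complex.Im m ->
  normc (semicircle_defect v (E +i* eta) m) <= eta ^+ 2 / (4 * v) ->
  Num.sqrt (4 * v - E ^+ 2) <= 2 * v * complex.Im m + eta.
Proof.
move=> v_gt0 eta_gt0 m_ge0; rewrite ler_pdivlMr ?mulr_gt0 // mulrC => defect_le.
have Re_defect_le : 4 * v * complex.Re (semicircle_defect v (E +i* eta) m) <= eta ^+ 2.
  by apply: le_trans defect_le; rewrite ler_wpM2l ?Re_le_normc // mulr_ge0 // ltW.
apply: ler_of_sqr; first by rewrite addr_ge0 ?(ltW eta_gt0) // mulr_ge0 // mulr_ge0 // ltW.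
have [root0|root_ge0] := ltP (4 * v - E ^+ 2) 0; first by rewrite ltr0_sqrtr // expr0n sqr_ge0.
rewrite sqr_sqrtr //; move: Re_defect_le {defect_le}.
rewrite /semicircle_defect; case: m m_ge0 => a b /= b_ge0; rewrite -subr_ge0 => Re_defect_le.
rewrite -subr_ge0 (_ : _ - _ = (2 * v * a + E) ^+ 2 + (eta ^+ 2 - 4 * v *
  (1 + (E * a - eta * b) + (v * (a * a - b * b) - 0 * (a * b + b * a))))); last by ring.
exact: addr_ge0 (sqr_ge0 _) Re_defect_le.
Qed.

End empirical.

Section grid.
Variables (R : realType) (v a b dl eta : R) (N : nat).
Local Notation s := (2 * Num.sqrt v).
Local Notation F := (semicircle_primitive v).
Local Notation l := (b - a).
Local Notation h := ((b - a) / N%:R).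
Hypotheses (v_gt0 : 0 < v) (s_a : - s <= a) (a_b : a < b) (b_s : b <= s)
  (dl_gt0 : 0 < dl) (eta_gt0 : 0 < eta) (N_gt0 : (0 < N)%N).

Definition grid_node (k : nat) : R := a + k%:R * h.
Local Notation E := grid_node.

Let l_gt0 : 0 < l. Proof. by rewrite subr_gt0. Qed.
Let h_gt0 : 0 < h. Proof. by rewrite divr_gt0 ?ltr0n. Qed.
Let Nh : N%:R * h = l. Proof. by rewrite mulrC divfK // pnatr_eq0 -lt0n. Qed.

Lemma grid_nodeS k : E k.+1 = E k + h.
Proof. by rewrite /E -natr1 mulrDl mul1r addrA. Qed.

Lemma grid_node_itv k : (k <= N)%N -> a <= E k <= b.
Proof.
move=> k_N; rewrite lerDl mulr_ge0 ?(ltW h_gt0) //= -lerBrDl -[leRHS]Nh.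
by rewrite ler_wpM2r ?(ltW h_gt0) // ler_nat.
Qed.

Lemma grid_step (m : R[i]) k : (k < N)%N -> 0 <= complex.Im m ->
  normc (semicircle_defect v (E k +i* eta) m) <= eta ^+ 2 / (4 * v) ->
  F (E k.+1) - F (E k) <=
  pi^-1 * (h * complex.Im m) + h * ((2 * pi * v)^-1 * (eta + Num.sqrt (2 * s * h))).
Proof.
move=> k_N m_ge0 small.
have [/andP[a_E _] /andP[_ E_b]] := (grid_node_itv (ltnW k_N), grid_node_itv k_N).
have step : E k.+1 - E k = h by rewrite grid_nodeS addrAC subrr add0r.
have step_gt0 : E k < E k.+1 by rewrite -subr_gt0 step.
apply: le_trans (semicircle_primitive_step v_gt0 (le_trans s_a a_E) step_gt0 (le_trans E_b b_s)) _.
rewrite step -mulrDr; have cst_ge0 : 0 <= (2 * pi * v)^-1 :> R.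
  by rewrite invr_ge0 !mulr_ge0 ?pi_ge0 // ltW.
have -> : pi^-1 * (h * complex.Im m) = h * ((2 * pi * v)^-1 * (2 * v * complex.Im m)).
  by have := pi_gt0 R; move: (pi : R) h => p q p_gt0; field; rewrite !gt_eqF.
rewrite -mulrDr -mulrDr addrA; do 2!rewrite ler_wpM2l ?(ltW h_gt0) //.
by rewrite lerD2r Im_ge_semicircle_root.
Qed.

Lemma grid_poisson_kernel_le y :
  pi^-1 * \sum_(k < N) h * poisson_kernel eta (y - E k) <=
  \1_(`]a - dl, b + dl[%classic) y + pi^-1 * (l * (h / eta ^+ 2 + eta / dl ^+ 2)).
Proof.
have piV_ge0 : 0 <= pi^-1 :> R by rewrite invr_ge0 pi_ge0.
have terms_ge0 : 0 <= h / eta ^+ 2 /\ 0 <= eta / dl ^+ 2.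
  by split; rewrite divr_ge0 ?sqr_ge0 // ltW.
have [near_ge0 far_ge0] := terms_ge0.
rewrite indicE; case: (boolP (y \in _)) => [_|y_far].
  apply: (@le_trans _ _ (pi^-1 * (pi + l * (h / eta ^+ 2)))).
    by rewrite ler_wpM2l // -[X in _ + X * _]Nh; exact: poisson_kernel_sum.
  rewrite mulrDr mulVf ?gt_eqF ?pi_gt0 // lerD2l ler_wpM2l // ler_wpM2l ?(ltW l_gt0) //.
  by rewrite lerDl.
rewrite add0r ler_wpM2l //; apply: (@le_trans _ _ (\sum_(k < N) h * (eta / dl ^+ 2))).
  apply: ler_sum => k _; rewrite ler_wpM2l ?(ltW h_gt0) //; apply: poisson_kernel_far => //.
  rewrite leNgt; apply: contra y_far => y_near; rewrite inE /= in_itv /=.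
  have /andP[a_E E_b] := grid_node_itv (ltnW (ltn_ord k)).
  by move: y_near; rewrite ltr_norml => /andP[]; move: a_E E_b; lra.
rewrite sumr_const card_ord -[_ *+ N]mulr_natl mulrA Nh ler_wpM2l ?(ltW l_gt0) //.
by rewrite lerDr.
Qed.

Definition grid_error : R :=
  pi^-1 * (l * (h / eta ^+ 2 + eta / dl ^+ 2))
  + l * ((2 * pi * v)^-1 * (eta + Num.sqrt (2 * s * h))).

Lemma grid_bound n (x : 'I_n -> R) : (0 < n)%N ->
  small_defects v (eta ^+ 2 / (4 * v)) [seq (E k +i* eta) | k <- iota 0 N] x ->
  F b - F a - grid_error <= empirical x `]a - dl, b + dl[.
Proof.
move=> n_gt0 small; have n_pos : 0 < n%:R :> R by rewrite ltr0n.
pose m k := empirical_stieltjes x (E k +i* eta).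
rewrite lerBlDr addrA; pose C := h * ((2 * pi * v)^-1 * (eta + Num.sqrt (2 * s * h))).
apply: (@le_trans _ _ (\sum_(k < N) (pi^-1 * (h * complex.Im (m k)) + C))).
  have -> : F b - F a = \sum_(k < N) (F (E k.+1) - F (E k)).
    rewrite -(big_mkord xpredT (fun k => F (E k.+1) - F (E k))).
    by rewrite (telescope_sumr (F \o E)) //= /E mul0r addr0 Nh subrKC.
  apply: ler_sum => k _; apply: grid_step => //; last first.
    by apply: small; apply/mapP; exists (k : nat); rewrite ?mem_iota /=.
  rewrite Im_empirical_stieltjes mulr_ge0 ?invr_ge0 ?(ltW n_pos) // sumr_ge0 // => i _.
  exact: poisson_kernel_ge0.
have CE : \sum_(k < N) C = l * ((2 * pi * v)^-1 * (eta + Num.sqrt (2 * s * h))).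
  by rewrite sumr_const card_ord -[LHS]mulr_natl [LHS]mulrA Nh.
rewrite big_split /= CE lerD2r.
have -> : \sum_(k < N) pi^-1 * (h * complex.Im (m k)) = n%:R^-1 *
    \sum_i (pi^-1 * \sum_(k < N) h * poisson_kernel eta (x i - E k)).
  under eq_bigr do rewrite /m Im_empirical_stieltjes !mulr_sumr.
  rewrite exchange_big mulr_sumr; apply: eq_bigr => i _ /=.
  by rewrite !mulr_sumr; apply: eq_bigr => k _; ring.
rewrite [leRHS](_ : _ = n%:R^-1 * \sum_i (\1_(`]a - dl, b + dl[%classic) (x i) +
    pi^-1 * (l * (h / eta ^+ 2 + eta / dl ^+ 2)))); last first.
  rewrite big_split /= sumr_const card_ord [RHS]mulrDr; congr (_ + _).
  by rewrite -[X in _ = _ * X]mulr_natl mulKf ?gt_eqF.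
rewrite ler_wpM2l ?invr_ge0 ?(ltW n_pos) //.
by apply: ler_sum => i _; exact: grid_poisson_kernel_le.
Qed.

End grid.

(* The choice [eta = 1 / K], [N = K ^ 4] makes the error of order [1 / K]. *)
Lemma grid_error_le (R : realType) (v a b dl e : R) :
  0 < v -> a < b -> 0 < dl -> 0 < e ->
  exists2 K : nat, (0 < K)%N & grid_error v a b dl K%:R^-1 (K ^ 4) <= e.
Proof.
move=> v_gt0 a_b dl_gt0 e_gt0; set l := b - a.
have l_ge0 : 0 <= l by rewrite subr_ge0 ltW.
pose S := 2 * (2 * Num.sqrt v); have S_ge0 : 0 <= S by rewrite !mulr_ge0 // sqrtr_ge0.
pose C1 := pi^-1 * (l * (l + dl ^- 2)); pose C2 := l * ((2 * pi * v)^-1 * (1 + Num.sqrt (S * l))).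
pose K := (Num.truncn ((C1 + C2) / e)).+1; exists K => //.
have K_pos : 0 < K%:R :> R by rewrite ltr0n.
apply: (@le_trans _ _ (K%:R^-1 * (C1 + C2))); last first.
  by rewrite mulrC ler_pdivrMr // mulrC -ler_pdivrMr // ltW // truncnS_gt.
have V_gt0 : 0 < K%:R^-1 :> R by rewrite invr_gt0.
have V_le1 : K%:R^-1 <= 1 :> R by rewrite invf_le1 // ler1n.
rewrite /grid_error -/l -/S natrX -exprVn; move: (K%:R^-1 : R) V_gt0 V_le1 => u u_gt0 u_le1.
have u2_le : u ^+ 2 <= u by rewrite ler_iXnr // ltW.
rewrite [leRHS]mulrDr; apply: lerD.
  rewrite [leRHS]mulrCA ler_wpM2l ?invr_ge0 ?pi_ge0 // [leRHS]mulrCA ler_wpM2l //.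
  rewrite mulrDr lerD2r (_ : _ / _ = l * u ^+ 2); last by field; rewrite gt_eqF.
  by rewrite [leRHS]mulrC ler_wpM2l.
rewrite [leRHS]mulrCA ler_wpM2l // [leRHS]mulrCA ler_wpM2l //.
  by rewrite invr_ge0 !mulr_ge0 ?pi_ge0 // ltW.
rewrite mulrDr mulr1 lerD2l mulrA sqrtrM ?mulr_ge0 // (exprM u 2 2) sqrtr_sqr ger0_norm ?sqr_ge0 //.
by rewrite mulrC ler_wpM2r ?sqrtr_ge0.
Qed.

Lemma semicircle_forces_mass (R : realType) (v a b dl e : R) :
  0 < v -> - (2 * Num.sqrt v) <= a -> a < b -> b <= 2 * Num.sqrt v -> 0 < dl -> 0 < e ->
  forced_by_small_defects v (fun n x =>
    semicircle_primitive v b - semicircle_primitive v a - e <= empirical x `]a - dl, b + dl[).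
Proof.
move=> v_gt0 s_a a_b b_s dl_gt0 e_gt0.
have [K K_gt0 error_le] := grid_error_le v_gt0 a_b dl_gt0 e_gt0.
have eta_gt0 : 0 < K%:R^-1 :> R by rewrite invr_gt0 ltr0n.
exists [seq (grid_node a b (K ^ 4) k +i* K%:R^-1) | k <- iota 0 (K ^ 4)], (K%:R^-1 ^+ 2 / (4 * v)).
split; first by rewrite divr_gt0 ?exprn_gt0 // mulr_gt0.
  by move=> z /mapP[k _ ->].
move=> n x n_gt0 small; apply: le_trans (lerB (lexx _) error_le) _.
by apply: grid_bound => //; rewrite expn_gt0 K_gt0.
Qed.

Section semicircle_mass.
Context (R : realType) (m v : R).
Hypothesis v_gt0 : 0 < v.
Local Notation s := (2 * Num.sqrt v).
Local Notation F := (semicircle_primitive v).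
Local Notation f := (semicircle_pdf m v).
Local Notation mu := (@lebesgue_measure R).

Let g (x : R) : R := (2 * pi * v)^-1 * Num.sqrt (4 * v - (x - m) ^+ 2).
Let J : set R := `[m - s, m + s]%classic.

Let s_gt0 : 0 < s. Proof. by rewrite mulr_gt0 // sqrtr_gt0. Qed.

Let semicircle_pdfE : f = g \_ J.
Proof.
apply/funext => x; rewrite /semicircle_pdf patchE.
by have -> : (x \in J) = (x \in `[m - s, m + s]%R) by rewrite /J mem_setE.
Qed.

Let g_ge0 x : 0 <= g x.
Proof. by rewrite mulr_ge0 ?sqrtr_ge0 // invr_ge0 ltW // !mulr_gt0 // pi_gt0. Qed.

Let continuous_shift : continuous (fun x : R => x - m).
Proof. by move=> x; apply: cvgB; [exact: cvg_id|exact: cvg_cst]. Qed.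

Let continuous_g : continuous g.
Proof.
move=> x; apply: cvgM; first exact: cvg_cst.
apply: (@continuous_comp _ _ _ (fun x : R => x - m) (fun x => Num.sqrt (4 * v - x ^+ 2))).
  exact: continuous_shift.
exact: continuous_semicircle_root.
Qed.

Let measurable_g (D : set R) : measurable_fun D g.
Proof. by apply: (@measurable_funS _ _ _ _ setT) => //; exact: continuous_measurable_fun. Qed.

Lemma semicircle_pdf_ge0 x : 0 <= f x.
Proof. by rewrite semicircle_pdfE patchE; case: ifP. Qed.

Lemma measurable_semicircle_pdf : measurable_fun setT (EFin \o f).
Proof.
apply/measurable_EFinP; rewrite semicircle_pdfE.
by apply/(measurable_restrict _ _ _).1 => //; exact: measurable_itv.
Qed.

Let integral_support (I : set R) :
  (\int[mu]_(x in I) (f x)%:E = \int[mu]_(x in I `&` J) (g x)%:E)%E.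
Proof.
rewrite integral_mkcondr; apply: eq_integral => x _.
by rewrite semicircle_pdfE !patchE; case: ifP.
Qed.

Let integral_g a b : m - s <= a -> a <= b -> b <= m + s ->
  (\int[mu]_(x in `[a, b]) (g x)%:E = (F (b - m) - F (a - m))%:E)%E.
Proof.
move=> s_a; rewrite le_eqVlt => /orP[/eqP <- _|a_b b_s].
  by rewrite set_itv1 integral_set1 subrr.
have F_diff x : x \in `]a, b[%R -> is_derive x 1 (fun x => F (x - m)) (g x).
  rewrite in_itv /= => /andP[a_x x_b].
  have shift_diff : is_derive x 1 (fun x : R => x - m) 1.
    by apply: is_derive_eq; rewrite subr0.
  have x_itv : - s < x - m < s by move: s_a a_x x_b b_s; lra.
  apply: (is_derive_eq (@is_derive1_comp R F (fun x => x - m) x _ _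
    (is_derive_semicircle_primitive v_gt0 x_itv) shift_diff)).
  by rewrite mulr1.
have F_cont : continuous (fun x => F (x - m)).
  move=> x; apply: (@continuous_comp _ _ _ (fun x : R => x - m) F).
    exact: continuous_shift.
  exact: continuous_semicircle_primitive.
rewrite (@continuous_FTC2 R g (fun x => F (x - m)) a b) //.
- exact: continuous_subspaceT.
- split; first by move=> x /F_diff[].
    by apply: cvg_at_right_filter; exact: F_cont.
  by apply: cvg_at_left_filter; exact: F_cont.
- by move=> x /F_diff x_diff; rewrite derive1E derive_val.
Qed.

Lemma semicircle_setT : semicircle m v setT = 1%E.
Proof.
rewrite /semicircle integral_support setTI integral_g //; last first.
  by rewrite lerD2l (ge0_cp (ltW s_gt0)).
have shiftK x : m + x - m = x by rewrite addrAC subrr add0r.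
rewrite !shiftK semicircle_primitiveN semicircle_primitive_edge //.
by congr (_%:E); lra.
Qed.

Lemma semicircle_ge0 (I : set R) : (0 <= semicircle m v I)%E.
Proof. by apply: integral_ge0 => x _; rewrite lee_fin semicircle_pdf_ge0. Qed.

Lemma semicircleU (A B : set R) : measurable A -> measurable B -> [disjoint A & B] ->
  (semicircle m v (A `|` B) = semicircle m v A + semicircle m v B)%E.
Proof.
move=> mA mB AB; apply: ge0_integral_setU => //.
  by apply: measurable_funS measurable_semicircle_pdf.
by move=> x _; rewrite lee_fin semicircle_pdf_ge0.
Qed.

Lemma semicircle_fin_num (I : set R) : measurable I -> semicircle m v I \is a fin_num.
Proof.
move=> mI; rewrite ge0_fin_numE ?semicircle_ge0 //.
apply: (@le_lt_trans _ _ 1%E); last exact: ltry.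
rewrite -semicircle_setT; apply: ge0_subset_integral => //.
  exact: measurable_semicircle_pdf.
by move=> x _; rewrite lee_fin semicircle_pdf_ge0.
Qed.

Lemma fine_semicircle_le (I : set R) a b : measurable I ->
  m - s <= a -> a <= b -> b <= m + s ->
  (forall x, (I `&` `[m - s, m + s]) x -> a <= x <= b) ->
  fine (semicircle m v I) <= F (b - m) - F (a - m).
Proof.
move=> mI s_a a_b b_s I_itv; rewrite -lee_fin fineK ?semicircle_fin_num //.
rewrite -integral_g // /semicircle integral_support.
apply: ge0_subset_integral => //.
- by apply: measurableI => //; exact: measurable_itv.
- by apply/measurable_EFinP; exact: measurable_g.
- by move=> x _; rewrite lee_fin.
Qed.

End semicircle_mass.

Lemma continuous_shrink (R : realType) (F : R -> R) (a b e : R) :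
  continuous F -> a < b -> 0 < e -> exists dl : R,
  [/\ 0 < dl, a + dl < b - dl & F b - F a - e <= F (b - dl) - F (a + dl)].
Proof.
move=> F_cont a_b e_gt0; have e2_gt0 : 0 < e / 2 by exact: divr_gt0.
have [ra /= ra_gt0 near_a] := (nbhs_ballP _ _).1 ((cvgrPdist_le _ _).1 (F_cont a) _ e2_gt0).
have [rb /= rb_gt0 near_b] := (nbhs_ballP _ _).1 ((cvgrPdist_le _ _).1 (F_cont b) _ e2_gt0).
pose dl := Num.min (Num.min ra rb) (b - a) / 4.
have dl_gt0 : 0 < dl by rewrite divr_gt0 // !lt_min ra_gt0 rb_gt0 subr_gt0.
have [dl_ra dl_rb dl_ab] : [/\ dl < ra, dl < rb & 2 * dl < b - a].
  have : 4 * dl <= Num.min (Num.min ra rb) (b - a) by rewrite mulrC divfK.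
  by rewrite !le_min => /andP[/andP[]]; split; lra.
exists dl; split=> //; first by lra.
have := near_a (a + dl); have := near_b (b - dl).
rewrite /ball /= opprB addrCA subrr addr0 opprD addNKr normrN gtr0_norm // !ler_distl.
by move=> /(_ dl_rb)/andP[_ Fb] /(_ dl_ra)/andP[Fa _]; lra.
Qed.

Section interval_mass.
Variables (R : realType) (m v : R).
Hypothesis v_gt0 : 0 < v.
Local Notation s := (2 * Num.sqrt v).
Local Notation mass I := (fine (semicircle m v I)).
Local Notation F := (semicircle_primitive v).
Implicit Types (I : set R) (e : R).

Let s_gt0 : 0 < s. Proof. by rewrite mulr_gt0 // sqrtr_gt0. Qed.

Lemma forced_mass_lower_bound e I : is_interval I -> 0 < e ->
  forced_by_small_defects v (fun n x => mass I - e <= empirical (fun i => m + x i) I).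
Proof.
move=> I_itv e_gt0; have mI := is_interval_measurable I_itv.
have forced_null : mass I <= 0 ->
    forced_by_small_defects v (fun n x => mass I - e <= empirical (fun i => m + x i) I).
  move=> null; apply: forced_by_small_defectsT => n x _; apply: (@le_trans _ _ 0); first by lra.
  by rewrite mulr_ge0 ?invr_ge0 // sumr_ge0.
pose S := I `&` `[m - s, m + s].
have S_itv x : S x -> m - s <= x <= m + s by move=> [_]; rewrite /= in_itv.
have [[x0 Sx0]|/set0P/negP/negPn/eqP S0] := pselect (S !=set0); last first.
  apply: forced_null; rewrite -(subrr (F (m - s - m))); apply: fine_semicircle_le => //.
    by rewrite lerD2l (ge0_cp (ltW s_gt0)).
  by move=> x; rewrite -/S S0.
have S_lb : has_lbound S by exists (m - s) => x /S_itv/andP[].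
have S_ub : has_ubound S by exists (m + s) => x /S_itv/andP[].
have S_hull x : S x -> inf S <= x <= sup S by move=> Sx; rewrite ge_inf // ub_le_sup.
have s_inf : m - s <= inf S by apply: lb_le_inf => [|x /S_itv/andP[]//]; exists x0.
have sup_s : sup S <= m + s by apply: ge_sup => [|x /S_itv/andP[]//]; exists x0.
have /andP[inf_x0 x0_sup] := S_hull _ Sx0; have inf_sup := le_trans inf_x0 x0_sup.
have mass_le := fine_semicircle_le v_gt0 mI s_inf inf_sup sup_s S_hull.
move: inf_sup; rewrite le_eqVlt => /orP[/eqP inf_eq_sup|inf_sup].
  by apply: forced_null; rewrite (le_trans mass_le) // inf_eq_sup subrr.
have S_interval : is_interval S.
  move=> x y [Ix /= xJ] [Iy /= yJ] u x_u_y; split; first exact: I_itv x_u_y.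
  exact: (interval_is_interval (i := `[m - s, m + s]) xJ yJ x_u_y).
have S_interior x : inf S < x < sup S -> I x.
  by move=> x_itv; have /interior_subset[] : S° x by rewrite interval_bounded_interior.
have [dl [dl_gt0 dl_lt F_dl]] : exists dl : R, [/\ 0 < dl,
    inf S - m + dl < sup S - m - dl & F (sup S - m) - F (inf S - m) - e / 2 <=
    F (sup S - m - dl) - F (inf S - m + dl)].
  apply: continuous_shrink; rewrite ?ltrD2r ?divr_gt0 //.
  exact: continuous_semicircle_primitive.
have s_l : - s <= inf S - m + dl by move: s_inf dl_gt0; lra.
have r_s : sup S - m - dl <= s by move: sup_s dl_gt0; lra.
have e2_gt0 : 0 < e / 2 by exact: divr_gt0.
have forced := semicircle_forces_mass v_gt0 s_l dl_lt r_s dl_gt0 e2_gt0.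
apply: forced_by_small_defectsW forced => n x _ mass_ge.
apply: le_trans (le_trans mass_ge (empirical_le _)); first by move: mass_le F_dl; lra.
by move=> i /=; rewrite in_itv /= => /andP[? ?]; apply: S_interior; lra.
Qed.

Let below I : set R := [set x | forall y, I y -> x < y].
Let above I : set R := [set x | forall y, I y -> y < x].

Let is_interval_below I : is_interval (below I).
Proof. by move=> x y _ y_below z /andP[_ z_y] t It; exact: le_lt_trans z_y (y_below t It). Qed.

Let is_interval_above I : is_interval (above I).
Proof. by move=> x y x_above _ z /andP[x_z _] t It; exact: lt_le_trans (x_above t It) x_z. Qed.

Lemma interval_trichotomy I x : is_interval I -> I !=set0 ->
  [\/ [/\ below I x, ~ I x & ~ above I x], [/\ ~ below I x, I x & ~ above I x] |
      [/\ ~ below I x, ~ I x & above I x]].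
Proof.
move=> I_itv [x0 Ix0]; have [Ix|nIx] := pselect (I x).
  by constructor 2; split=> // h; have := h x Ix; rewrite ltxx.
have [x_below|x_nbelow] := pselect (below I x).
  constructor 1; split=> // x_above.
  by have := lt_trans (x_below _ Ix0) (x_above _ Ix0); rewrite ltxx.
constructor 3; split=> // y Iy; rewrite ltNge; apply/negP => x_y; apply: x_nbelow => z Iz.
rewrite ltNge; apply/negP => z_x; apply: nIx; apply: (I_itv z y) => //.
by rewrite z_x x_y.
Qed.

Section nonempty.
Variable I : set R.
Hypotheses (I_itv : is_interval I) (I_neq0 : I !=set0).

Let trichotomy x := @interval_trichotomy I x I_itv I_neq0.

Lemma mass_trichotomy : mass (below I) + mass I + mass (above I) = 1.
Proof.
have mL := is_interval_measurable (is_interval_below (I := I)).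
have mU := is_interval_measurable (is_interval_above (I := I)).
have mI := is_interval_measurable I_itv.
have finLI : (semicircle m v (below I) + semicircle m v I)%E \is a fin_num.
  by rewrite fin_numD !semicircle_fin_num.
rewrite -fineD ?semicircle_fin_num // -fineD ?semicircle_fin_num // -!semicircleU //; last 3 first.
- exact: measurableU.
- by apply/eqP/seteqP; split => // x [[] Ax Bx]; case: (trichotomy x) => -[]; tauto.
- by apply/eqP/seteqP; split => // x [Ax Bx]; case: (trichotomy x) => -[]; tauto.
rewrite (_ : _ `|` _ = setT) ?semicircle_setT //.
by apply/seteqP; split => // x _; case: (trichotomy x) => -[] //=; tauto.
Qed.

Lemma empirical_trichotomy n (x : 'I_n -> R) : (0 < n)%N ->
  empirical x (below I) + empirical x I + empirical x (above I) = 1.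
Proof.
move=> n_gt0; rewrite -!mulrDr -!big_split /= (eq_bigr (fun=> 1)) => [|i _].
  by rewrite sumr_const card_ord mulVf // pnatr_eq0 -lt0n.
rewrite !indicE; case: (trichotomy (x i)) => -[xL xI xU].
- by rewrite (mem_set xL) (memNset xI) (memNset xU) !addr0.
- by rewrite (memNset xL) (mem_set xI) (memNset xU) addr0 add0r.
- by rewrite (memNset xL) (memNset xI) (mem_set xU) !add0r.
Qed.

End nonempty.

(* The upper bound follows from the lower bounds for the two components of the
   complement, since both laws have total mass [1]. *)
Lemma forced_mass_close e I : is_interval I -> 0 < e ->
  forced_by_small_defects v (fun n x => `|empirical (fun i => m + x i) I - mass I| <= e).
Proof.
move=> I_itv e_gt0.
have [I_neq0|/set0P/negP/negPn/eqP ->] := pselect (I !=set0); last first.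
  apply: forced_by_small_defectsT => n x _; rewrite /semicircle integral_set0 /= subr0 /empirical.
  by rewrite big1 ?mulr0 ?normr0 ?ltW // => i _; rewrite indicE in_set0.
have e2_gt0 : 0 < e / 2 by exact: divr_gt0.
have below_forced := forced_mass_lower_bound (is_interval_below (I := I)) e2_gt0.
have above_forced := forced_mass_lower_bound (is_interval_above (I := I)) e2_gt0.
have I_forced := forced_mass_lower_bound I_itv e2_gt0.
apply: forced_by_small_defectsW
  (forced_by_small_defectsI below_forced (forced_by_small_defectsI I_forced above_forced)).
move=> n x n_gt0 [below_ge [I_ge above_ge]].
have := mass_trichotomy I_itv I_neq0.
have := empirical_trichotomy I_itv I_neq0 (fun i => m + x i) n_gt0.
by rewrite ler_norml => *; apply/andP; split; lra.
Qed.

End interval_mass.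

(** * Spectra of random Hermitian matrices *)

Section conj_diag.
Variables (K : fieldType) (n : nat) (U : 'M[K]_n).
Hypothesis U_unit : U \in unitmx.
Implicit Type D : 'I_n -> K.

Definition conj_diag D : 'M[K]_n := invmx U *m diag_mx (\row_j D j) *m U.

Lemma conj_diag_cst z : conj_diag (fun=> z) = z%:M.
Proof.
rewrite /conj_diag (_ : diag_mx _ = z%:M); last first.
  by rewrite -diag_const_mx; congr diag_mx; apply/rowP => j; rewrite !mxE.
by rewrite -mulmxA mul_scalar_mx -scalemxAr mulVmx // scalemx1.
Qed.

Lemma conj_diagD D1 D2 : conj_diag (fun j => D1 j + D2 j) = conj_diag D1 + conj_diag D2.
Proof.
have -> : conj_diag (fun j => D1 j + D2 j) =
    invmx U *m (diag_mx (\row_j D1 j) + diag_mx (\row_j D2 j)) *m U.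
  by rewrite -raddfD; congr (_ *m diag_mx _ *m _); apply/rowP => j; rewrite !mxE.
by rewrite mulmxDr mulmxDl.
Qed.

Lemma conj_diagM D1 D2 : conj_diag (fun j => D1 j * D2 j) = conj_diag D1 *m conj_diag D2.
Proof.
have -> : conj_diag (fun j => D1 j * D2 j) =
    invmx U *m (diag_mx (\row_j D1 j) *m diag_mx (\row_j D2 j)) *m U.
  by rewrite mulmx_diag; congr (_ *m diag_mx _ *m _); apply/rowP => j; rewrite !mxE.
by rewrite /conj_diag !mulmxA mulmxK.
Qed.

Lemma conj_diag_unit D : (forall j, D j != 0) -> conj_diag D \in unitmx.
Proof.
move=> D_neq0; suff : conj_diag D *m conj_diag (fun j => (D j)^-1) = 1%:M.
  by move=> /mulmx1_unit[].
by rewrite -conj_diagM -conj_diag_cst; congr conj_diag; apply/funext => j; rewrite mulfV.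
Qed.

Lemma conj_diagV D : (forall j, D j != 0) ->
  conj_diag (fun j => (D j)^-1) = invmx (conj_diag D).
Proof.
move=> D_neq0; rewrite -[LHS](mulKmx (conj_diag_unit D_neq0)) -conj_diagM.
rewrite (_ : (fun j => _) = fun=> 1) ?conj_diag_cst ?mulmx1 //.
by apply/funext => j; rewrite mulfV.
Qed.

Lemma mxtrace_conj_diag D : \tr (conj_diag D) = \sum_j D j.
Proof.
rewrite /conj_diag mxtrace_mulC mulmxA mulmxV // mul1mx mxtrace_diag.
by apply: eq_bigr => j _; rewrite mxE.
Qed.

Lemma conj_diagE D a b : conj_diag D a b = \sum_j D j * (invmx U a j * U j b).
Proof.
rewrite /conj_diag mul_mx_diag mxE; apply: eq_bigr => j _.
by rewrite !mxE; ring.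
Qed.

End conj_diag.

Section functional_calculus.
Variables (R : realType) (n : nat) (A : 'M[R[i]]_n).
Implicit Types (f g : R -> R) (z : R[i]).

Definition eigval (j : 'I_n) : R := complex.Re (spectral_diag A 0 j).

Definition spectral_apply f : 'M[R[i]]_n :=
  conj_diag (spectralmx A) (fun j => (f (eigval j))%:C).

Let U_unit := spectral_unit A.

Lemma spectral_apply_cst (x : R) : spectral_apply (fun=> x) = x%:C%:M.
Proof. exact: conj_diag_cst. Qed.

Lemma spectral_applyD f g :
  spectral_apply (fun x => f x + g x) = spectral_apply f + spectral_apply g.
Proof. by rewrite -conj_diagD; congr conj_diag; apply/funext => j; rewrite rmorphD. Qed.

Lemma spectral_applyM f g :
  spectral_apply (fun x => f x * g x) = spectral_apply f *m spectral_apply g.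
Proof.
rewrite /spectral_apply -(conj_diagM U_unit); congr conj_diag.
by apply/funext => j; rewrite rmorphM.
Qed.

Lemma spectral_apply_unit f : (forall x, f x != 0) -> spectral_apply f \in unitmx.
Proof. by move=> f_neq0; apply: conj_diag_unit => // j; rewrite fmorph_eq0. Qed.

Lemma spectral_applyV f : (forall x, f x != 0) ->
  spectral_apply (fun x => (f x)^-1) = invmx (spectral_apply f).
Proof.
move=> f_neq0; rewrite /spectral_apply -(conj_diagV U_unit) => [|j]; last by rewrite fmorph_eq0.
by congr conj_diag; apply/funext => j; rewrite fmorphV.
Qed.

Lemma mxtrace_spectral_apply f : \tr (spectral_apply f) = (\sum_j f (eigval j))%:C.
Proof. by rewrite mxtrace_conj_diag // rmorph_sum. Qed.

Hypothesis A_herm : A \is hermsymmx.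

Lemma spectral_apply_id : spectral_apply id = A.
Proof.
have /orthomx_spectralP := hermitian_normalmx A_herm.
suff -> : spectral_diag A = \row_j (eigval j)%:C by [].
apply/rowP => j; rewrite mxE; have /mxOverP/(_ 0 j) := hermitian_spectral_diag_real A_herm.
by rewrite /eigval; case: (spectral_diag A 0 j) => a b /=; rewrite complex_real => /eqP ->.
Qed.

Lemma mxtrace_resolvent_eigval (x : R) z : complex.Im z != 0 ->
  \tr (resolvent (A - x%:C%:M) z) = \sum_j ((eigval j - x)%:C - z)^-1.
Proof.
move=> z_neq0; pose D j := (eigval j - x)%:C - z.
have shiftE : conj_diag (spectralmx A) D = A - x%:C%:M - z%:M.
  rewrite -[A in RHS]spectral_apply_id -addrA -opprD -raddfD -raddfN /=.
  rewrite -(conj_diag_cst U_unit) -conj_diagD; congr conj_diag; apply/funext => j.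
  by rewrite /D rmorphB opprD addrA.
rewrite -(mxtrace_conj_diag U_unit) /resolvent -shiftE (conj_diagV U_unit) // => j.
by apply: contra z_neq0 => /eqP/(congr1 (@complex.Im R))/eqP; rewrite raddfB /= sub0r oppr_eq0.
Qed.

End functional_calculus.

(* A rational function with [tilt (- y) = (tilt y)^-1] and [tilt y < 1] for [0 < y];
   its powers turn the sign function into a limit of rational functions. *)
Definition tilt (R : realFieldType) (y : R) : R := (1 + (1 - y) ^+ 2) / (1 + (1 + y) ^+ 2).

Section tilt.
Variable R : realType.
Implicit Type y : R.

Let den_gt0 y : 0 < 1 + y ^+ 2. Proof. by rewrite ltr_pwDl // sqr_ge0. Qed.

Lemma tilt_gt0 y : 0 < tilt y.
Proof. by rewrite divr_gt0. Qed.

Lemma tiltN y : tilt (- y) = (tilt y)^-1.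
Proof. by rewrite /tilt opprK invf_div. Qed.

Lemma tilt_lt1 y : 0 < y -> tilt y < 1.
Proof. by move=> y_gt0; rewrite ltr_pdivrMr // mul1r; nra. Qed.

Lemma cvg_tilt_sgr y : 2 / (1 + tilt y ^+ k) - 1 @[k --> \oo] --> Num.sg y.
Proof.
have cvg_pos u : 0 < u -> 2 / (1 + tilt u ^+ k) - 1 @[k --> \oo] --> (1 : R).
  move=> u_gt0; have limE : 2 / (1 + 0) - 1 = 1 :> R by rewrite addr0 divr1; ring.
  rewrite -[X in _ --> X]limE.
  apply: cvgB; last exact: cvg_cst.
  apply: cvgM; first exact: cvg_cst.
  apply: cvgV; first by rewrite addr0.
  apply: cvgD; first exact: cvg_cst.
  by apply: cvg_expr; rewrite gtr0_norm ?tilt_gt0 ?tilt_lt1.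
case: (ltgtP y 0) => [y_lt0|y_gt0|->].
- rewrite ltr0_sg //; have -> : (fun k => 2 / (1 + tilt y ^+ k) - 1) =
      (fun k => - (2 / (1 + tilt (- y) ^+ k) - 1)).
    apply/funext => k; rewrite tiltN exprVn.
    have : 0 < tilt y ^+ k by rewrite exprn_gt0 ?tilt_gt0.
    by move: (tilt y ^+ k) => q q_gt0; field; rewrite !gt_eqF ?addr_gt0.
  by apply: cvgN; apply: cvg_pos; rewrite oppr_gt0.
- by rewrite gtr0_sg //; exact: cvg_pos.
rewrite sgr0; apply: cvg_near_cst; apply: nearW => k.
by rewrite /tilt subr0 addr0 divff ?gt_eqF // expr1n; field.
Qed.

End tilt.

Section measurable_spectrum.
Context (disp : measure_display) (T : measurableType disp) (R : realType) (n : nat)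
  (Y : T -> 'M[R[i]]_n).
Hypotheses (Y_meas : mxmeasurable Y) (Y_herm : forall t, Y t \is hermsymmx).
Implicit Types (f g : R -> R) (A : set R) (a x y : R).

Let admissible f := mxmeasurable (fun t => spectral_apply (Y t) f).

Let admissible_cst x : admissible (fun=> x).
Proof.
rewrite /admissible (funext (fun t => spectral_apply_cst (Y t) x)).
exact: mxmeasurable_cst.
Qed.

Let admissible_id : admissible id.
Proof. by rewrite /admissible (funext (fun t => spectral_apply_id (Y_herm t))). Qed.

Let admissibleD f g : admissible f -> admissible g -> admissible (fun x => f x + g x).
Proof.
move=> mf mg; rewrite /admissible (funext (fun t => spectral_applyD (Y t) f g)).
exact: (mxmeasurableD mf mg).
Qed.

Let admissibleM f g : admissible f -> admissible g -> admissible (fun x => f x * g x).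
Proof.
move=> mf mg; rewrite /admissible (funext (fun t => spectral_applyM (Y t) f g)).
exact: (mxmeasurableM mf mg).
Qed.

Let admissibleB f g : admissible f -> admissible g -> admissible (fun x => f x - g x).
Proof.
move=> mf mg; rewrite (_ : (fun x => _) = fun x => f x + -1 * g x).
  exact: admissibleD mf (admissibleM (admissible_cst (-1)) mg).
by apply/funext => x; rewrite mulN1r.
Qed.

Let admissibleX f k : admissible f -> admissible (fun x => f x ^+ k).
Proof.
move=> mf; elim: k => [|k IH]; first exact: admissible_cst.
rewrite (_ : (fun x => _) = fun x => f x * f x ^+ k); first exact: admissibleM mf IH.
by apply/funext => x; rewrite exprS.
Qed.

Let admissibleV f : (forall x, f x != 0) -> admissible f -> admissible (fun x => (f x)^-1).
Proof.
move=> f_neq0 mf; rewrite /admissible (funext (fun t => spectral_applyV (Y t) f_neq0)).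
by apply: mxmeasurable_invmx => // t; exact: spectral_apply_unit.
Qed.

Let admissible_cvg (h : nat -> R -> R) f : (forall k, admissible (h k)) ->
  (forall x, h k x @[k --> \oo] --> f x) -> admissible f.
Proof.
move=> mh h_f a b.
pose coef t j := invmx (spectralmx (Y t)) a j * spectralmx (Y t) j b.
have limit_meas (phi : R[i] -> R) :
    (forall g t, phi (spectral_apply (Y t) g a b) = \sum_j g (eigval (Y t) j) * phi (coef t j)) ->
    (forall k, measurable_fun setT (fun t => phi (spectral_apply (Y t) (h k) a b))) ->
    measurable_fun setT (fun t => phi (spectral_apply (Y t) f a b)).
  move=> phiE mphi; rewrite (funext (phiE f)).
  apply: (@measurable_fun_cvg _ _ _ _
    (fun k t => \sum_j h k (eigval (Y t) j) * phi (coef t j))) => [k|t _].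
    by rewrite -(funext (phiE (h k))).
  apply: cvg_big => [|j _]; first exact: add_continuous.
  by apply: cvgM; [exact: h_f|exact: cvg_cst].
split; apply: limit_meas.
- by move=> g t; rewrite conj_diagE raddf_sum; apply: eq_bigr => j _; exact: Re_realM.
- by move=> k; exact: (mh k a b).1.
- by move=> g t; rewrite conj_diagE raddf_sum; apply: eq_bigr => j _; exact: Im_realM.
- by move=> k; exact: (mh k a b).2.
Qed.

Let admissible_affine x y : admissible (fun u => x + y * u).
Proof. exact: admissibleD (admissible_cst x) (admissibleM (admissible_cst y) admissible_id). Qed.

Let admissible_tilt a : admissible (fun x => tilt (x - a)).
Proof.
have quad_meas x y : admissible (fun u => 1 + (x + y * u) ^+ 2).
  exact: admissibleD (admissible_cst 1) (admissibleX 2 (admissible_affine x y)).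
have quad_neq0 x y u : 1 + (x + y * u) ^+ 2 != 0 :> R by rewrite gt_eqF // ltr_pwDl // sqr_ge0.
rewrite (_ : (fun x => _) = fun x => (1 + (1 + a + -1 * x) ^+ 2) * (1 + (1 - a + 1 * x) ^+ 2)^-1).
  exact: admissibleM (quad_meas _ _) (admissibleV (quad_neq0 _ _) (quad_meas _ _)).
by apply/funext => x; rewrite /tilt; congr ((1 + _ ^+ 2) / (1 + _ ^+ 2)); ring.
Qed.

Let admissible_sgr a : admissible (fun x => Num.sg (x - a)).
Proof.
apply: (@admissible_cvg (fun k x => 2 * (1 + tilt (x - a) ^+ k)^-1 - 1)) => [k|x]; last first.
  exact: cvg_tilt_sgr.
have den_neq0 x : 1 + tilt (x - a) ^+ k != 0 by rewrite gt_eqF // addr_gt0 // exprn_gt0 // tilt_gt0.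
have den_meas := admissibleD (admissible_cst 1) (admissibleX k (admissible_tilt a)).
exact: admissibleB (admissibleM (admissible_cst 2) (admissibleV den_neq0 den_meas))
  (admissible_cst 1).
Qed.

Let admissible_ray a : admissible \1_(`[a, +oo[).
Proof.
pose S x : R := Num.sg (x - a).
rewrite (_ : \1_ _ = fun x => 1 + 2^-1 * (S x - S x ^+ 2)).
  have sgr_meas := admissible_sgr a.
  exact: admissibleD (admissible_cst 1) (admissibleM (admissible_cst 2^-1)
    (admissibleB sgr_meas (admissibleX 2 sgr_meas))).
apply/funext => x; rewrite indicE mem_setE in_itv /= andbT /S -subr_ge0.
by case: (ltgtP (x - a) 0) => [/[dup] ? /ltr0_sg ->|/gtr0_sg ->|->]; rewrite ?sgr0 /=; field.
Qed.

Let admissible_setC A : admissible \1_A -> admissible \1_(~` A).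
Proof.
move=> mA; rewrite (_ : \1_ _ = fun x => 1 - \1_A x).
  exact: admissibleB (admissible_cst 1) mA.
by apply/funext => x; rewrite !indicE in_setC; case: (_ \in A); rewrite ?subrr ?subr0.
Qed.

Let admissible_setI A B : admissible \1_A -> admissible \1_B -> admissible \1_(A `&` B).
Proof. by move=> mA mB; rewrite indicI; exact: (admissibleM mA mB). Qed.

Let admissible_bigcup (F : (set R)^nat) :
  (forall k, admissible \1_(F k)) -> admissible \1_(\bigcup_k F k).
Proof.
move=> mF; apply: (@admissible_cvg (fun k => \1_(\big[setU/set0]_(i < k) F i))) => [k|x].
  elim: k => [|k IH]; first by rewrite big_ord0 indic0; exact: admissible_cst.
  rewrite big_ord_recr /= -[_ `|` _]setCK setCU.
  exact: admissible_setC (admissible_setI (admissible_setC IH) (admissible_setC (mF k))).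
apply: cvg_near_cst; have [[i _ Fix]|x_notin] := pselect ((\bigcup_k F k) x).
  near=> k; rewrite !indicE !mem_set //; first by exists i.
  by rewrite -bigcup_mkord; exists i => //=; near: k; exact: nbhs_infty_gt.
apply: nearW => k; rewrite !indicE !memNset // => x_in; apply: x_notin.
exact: bigsetU_bigcup x_in.
Unshelve. all: by end_near. Qed.

Let admissible_indic A : measurable A -> admissible \1_A.
Proof.
have -> : @measurable _ R = <<s @RGenCInfty.G R >> by exact: RGenCInfty.measurableE.
apply: (@smallest_sub _ (sigma_algebra setT) _ (fun A => admissible \1_A)) => [|_ [a ->]];
  last exact: admissible_ray.
split=> [|B mB|F mF]; [|rewrite setTD; exact: admissible_setC|exact: admissible_bigcup].
by rewrite /= indic0; exact: admissible_cst.
Qed.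

Lemma measurable_empirical_spectral_measure A : measurable A ->
  measurable_fun setT (fun t => empirical_spectral_measure (Y t) A).
Proof.
move=> mA; have [mtr _] := cmeasurable_mxtrace (admissible_indic mA).
apply: measurable_funM => //; apply: eq_measurable_fun mtr => t _.
by rewrite mxtrace_spectral_apply.
Qed.

End measurable_spectrum.

(** * Convergence *)

Section union_bound.
Context (disp : measure_display) (T : measurableType disp) (R : realType)
  (P : probability T R).

Lemma probability_le_Rintegral (A : set T) (X : T -> R) :
  measurable A -> rintegrable P X -> (forall t, 0 <= X t) ->
  (forall t, A t -> 1 <= X t) -> (P A <= (\int[P]_t X t)%:E)%E.
Proof.
move=> mA X_int X_ge0 X_ge1.
rewrite -[A in P A]setIT -(integral_indic P measurableT mA) fineK; last exact: integrable_fin_num.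
apply: ge0_le_integral => //.
- by apply/measurable_EFinP; exact: measurable_indic.
- by have /integrableP[] := X_int.
by move=> t _; rewrite lee_fin indicE; case: (boolP (t \in A)) => // /set_mem/X_ge1.
Qed.

Lemma chebyshev_union_bound (I : eqType) (s : seq I) (A : set T) (X : I -> T -> R)
    (x : R) (C : I -> R) : measurable A -> 0 < x ->
  {in s, forall i, rintegrable P (fun t => X i t ^+ 2)} ->
  {in s, forall i, \int[P]_t (X i t ^+ 2) <= C i} ->
  (forall t, A t -> exists2 i, i \in s & x < X i t) ->
  (P A <= (\sum_(i <- s) x ^- 2 * C i)%:E)%E.
Proof.
move=> mA x_gt0 X_int X_le A_X; pose Y i t := x ^- 2 * X i t ^+ 2.
have Y_int i : i \in s -> rintegrable P (Y i) by move=> /X_int; exact: rintegrableZ.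
have Y_ge0 i t : 0 <= Y i t by rewrite mulr_ge0 ?sqr_ge0 // invr_ge0 sqr_ge0.
apply: (@le_trans _ _ (\int[P]_t (\sum_(i <- s | i \in s) Y i t))%:E).
  apply: probability_le_Rintegral => //; first exact: rintegrable_sum.
    by move=> t; exact: sumr_ge0.
  move=> t /A_X[i i_s x_X]; rewrite -big_seq (big_rem i i_s) /= ler_wpDr ?sumr_ge0 //.
  rewrite /Y mulrC ler_pdivlMr ?exprn_gt0 // mul1r ler_sqr ?nnegrE ?ltW //.
  exact: lt_trans x_X.
rewrite lee_fin Rintegral_sum // [leRHS]big_seq; apply: ler_sum => i i_s.
rewrite RintegralZl //; last exact: X_int.
by rewrite ler_wpM2l ?X_le // invr_ge0 sqr_ge0.
Qed.

End union_bound.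

Lemma stieltjes_eigval (R : realType) n (A : 'M[R[i]]_n) (x : R) z :
  A \is hermsymmx -> complex.Im z != 0 ->
  stieltjes (A - x%:C%:M) z = empirical_stieltjes (fun j => eigval A j - x) z.
Proof. by move=> A_herm z_neq0; rewrite /stieltjes mxtrace_resolvent_eigval. Qed.

Lemma small_defects_eigval (R : realType) n (A : 'M[R[i]]_n) (x v c tau : R) zs :
  (0 < n)%N -> A \is hermsymmx -> {in zs, forall z, 0 < complex.Im z} ->
  `|v - c| * (\sum_(z <- zs) (complex.Im z)^-1 ^+ 2) <= tau / 2 ->
  {in zs, forall z, normc (defect c (A - x%:C%:M) z) <= tau / 2} ->
  small_defects v tau zs (fun j => eigval A j - x).
Proof.
move=> n_gt0 A_herm zs_gt0 v_c small z z_zs; have z_gt0 := zs_gt0 z z_zs.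
have H_herm : A - x%:C%:M \is hermsymmx by rewrite rpredB ?hermsymmx_real_scalar.
rewrite -stieltjes_eigval ?gt_eqF //.
apply: le_trans (normc_defect_change c v n_gt0 H_herm z_gt0) _.
rewrite [tau]splitr lerD ?small // (le_trans _ v_c) // ler_wpM2l //.
by rewrite (big_rem z z_zs) /= lerDl sumr_ge0 // => u _; exact: sqr_ge0.
Qed.

Lemma partial_transpose_wishart (disp : measure_display) (T : measurableType disp)
    (R : realType) (d p : nat) (G : T -> 'M[R[i]]_(d ^ 2, p)) t : (0 < p)%N ->
  partial_transpose (p%:R^-1 *: (G t *m (G t) ^t*)) = centered_average G t + 1%:M.
Proof.
move=> p_gt0; have pC_neq0 : p%:R != 0 :> R[i] by rewrite pnatr_eq0 -lt0n.
rewrite partial_transpose_gram /centered_average sumrB sumr_const card_ord scalerBr.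
rewrite (fmorphV (real_complex R)) rmorph_nat.
by rewrite -(scaler_nat p (1%:M : 'M[R[i]]_(d ^ 2))) scalerA mulVf // scale1r subrK.
Qed.

Section wishart_event.
Context (disp : measure_display) (T : measurableType disp) (R : realType)
  (P : probability T R) (kind : entry_kind) (d p : nat) (W : T -> 'M[R[i]]_(d ^ 2)).
Hypotheses (W_wishart : is_wishart P kind p W) (d_gt0 : (0 < d)%N) (p_gt0 : (0 < p)%N).
Variables (v c' tau eps mass : R) (zs : seq R[i]) (I : set R).
Local Notation c := ((d ^ 2)%:R / p%:R : R).
Hypotheses (c_le : c <= c') (mI : measurable I) (tau_gt0 : 0 < tau)
  (zs_gt0 : {in zs, forall z, 0 < complex.Im z})
  (v_c : `|v - c| * (\sum_(z <- zs) (complex.Im z)^-1 ^+ 2) <= tau / 2)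
  (mass_close : forall x : 'I_(d ^ 2) -> R, small_defects v tau zs x ->
     `|empirical (fun i => 1 + x i) I - mass| <= eps).

Lemma wishart_event_bound :
  (P [set t | (eps < `| empirical_spectral_measure (partial_transpose (W t)) I - mass |)%R] <=
   ((\sum_(z <- zs) (tau / 2) ^- 2 * defect_moment_constant kind z c') / Num.sqrt d%:R)%:E)%E.
Proof.
have [G G_gauss WE] := W_wishart; pose Y t := partial_transpose (W t).
have YE t : Y t = centered_average G t + 1%:M by rewrite /Y WE partial_transpose_wishart.
have Y_herm t : Y t \is hermsymmx.
  by rewrite YE rpredD ?centered_average_hermsymmx ?hermsymmx1.
have Y_meas : mxmeasurable Y.
  rewrite (funext YE); apply: mxmeasurableD; last exact: mxmeasurable_cst.
  exact: mxmeasurable_centered_average G_gauss.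
have centerE t : centered_average G t = Y t - (1 : R)%:C%:M by rewrite YE rmorph1 addrK.
pose D z t := normc (defect c (centered_average G t) z).
rewrite mulr_suml; under eq_bigr do rewrite -mulrA.
apply: (@chebyshev_union_bound _ _ _ _ _ _ _ D); rewrite ?divr_gt0 //.
- have dist_meas : measurable_fun setT
      (fun t => `|empirical_spectral_measure (Y t) I - mass|).
    apply: measurableT_comp => //; apply: measurable_funB => //.
    exact: measurable_empirical_spectral_measure.
  have := dist_meas measurableT _ (measurable_itv `]eps, +oo[); rewrite setTI.
  by congr (measurable _); apply/seteqP; split => t /=; rewrite in_itv /= andbT.
- by move=> z /zs_gt0 z_gt0; have [] := expectation_sqr_defect_le G_gauss d_gt0 p_gt0 z_gt0.
- move=> z /zs_gt0 z_gt0; have [_ /le_trans] := expectation_sqr_defect_le G_gauss d_gt0 p_gt0 z_gt0.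
  by apply; rewrite ler_wpM2r ?invr_ge0 ?sqrtr_ge0 // ler_defect_moment_constant // divr_ge0.
move=> t /= far; apply: contrapT => no_large; move: far; rewrite ltNge => /negP; apply.
have n_gt0 : (0 < d ^ 2)%N by rewrite expn_gt0 d_gt0.
have small : small_defects v tau zs (fun j => eigval (Y t) j - 1).
  apply: small_defects_eigval v_c _ => // z z_zs; rewrite -centerE leNgt.
  by apply/negP => large; apply: no_large; exists z.
have := mass_close small; congr (`|_ * _ - _| <= _).
by apply: eq_bigr => j _; rewrite subrKC.
Qed.

End wishart_event.

Section asymptotics.
Variable R : realType.

Lemma cvg_invn : (n%:R^-1 : R) @[n --> \oo] --> (0 : R).
Proof.
apply/gtr0_cvgV0; last exact: cvgr_idn.
by near=> n; rewrite ltr0n; near: n; exact: nbhs_infty_gt.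
Unshelve. all: by end_near. Qed.

Lemma cvg_inv_sqrtn : (Num.sqrt n%:R : R)^-1 @[n --> \oo] --> (0 : R).
Proof.
rewrite (_ : (fun n => _) = fun n => Num.sqrt (n%:R^-1 : R)); last first.
  by apply/funext => n; rewrite sqrtrV.
rewrite -[X in _ --> X]sqrtr0.
exact: (cvg_comp _ _ cvg_invn (@sqrt_continuous R 0)).
Qed.

Lemma cvg_truncn_ratio (a : R) : 0 < a ->
  (n ^ 2)%:R / (Num.truncn (a * n%:R ^+ 2))%:R @[n --> \oo] --> a^-1.
Proof.
move=> a_gt0.
rewrite (_ : (fun n => _) = fun n => ((Num.truncn (a * n%:R ^+ 2))%:R / n%:R ^+ 2)^-1); last first.
  by apply/funext => n; rewrite invf_div natrX.
apply: cvgV; first by rewrite gt_eqF.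
apply: (@squeeze_cvgr _ _ _ _ (fun n => a - n%:R^-1 * n%:R^-1) (fun=> a)).
- near=> n; have n_gt0 : 0 < n%:R :> R by rewrite ltr0n; near: n; exact: nbhs_infty_gt.
  have an_ge0 : 0 <= a * n%:R ^+ 2 by rewrite mulr_ge0 ?sqr_ge0 // ltW.
  have /andP[trunc_le lt_trunc] := truncn_itv an_ge0.
  rewrite ler_pdivlMr ?exprn_gt0 // ler_pdivrMr ?exprn_gt0 // trunc_le andbT mulrBl.
  rewrite (_ : _ * _ * n%:R ^+ 2 = 1); last by field; rewrite gt_eqF.
  by move: lt_trunc; rewrite -natr1; lra.
- rewrite -[X in _ --> X]subr0 -[X in _ - X](mulr0 0).
  by apply: cvgB; [exact: cvg_cst|apply: cvgM; exact: cvg_invn].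
- exact: cvg_cst.
Unshelve. all: by end_near. Qed.

Lemma near_truncn_gt0 (a : R) : 0 < a ->
  \forall n \near \oo, (0 < Num.truncn (a * n%:R ^+ 2))%N.
Proof.
move=> a_gt0; have aV_gt0 : 0 < a^-1 by rewrite invr_gt0.
near=> n; have : 0 < (n ^ 2)%:R / (Num.truncn (a * n%:R ^+ 2))%:R :> R.
  by near: n; apply: (cvgr_gt _ (cvg_truncn_ratio a_gt0)).
by rewrite lt0n; apply: contraTneq => ->; rewrite invr0 mulr0 ltxx.
Unshelve. all: by end_near. Qed.

Lemma near_dist_mul_le (f : nat -> R) (l S e : R) : f n @[n --> \oo] --> l -> 0 < e ->
  \forall n \near \oo, `|l - f n| * S <= e.
Proof.
move=> f_l e_gt0; have : `|l - f n| * S @[n --> \oo] --> `|l - l| * S.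
  by apply: cvgM; [apply: cvg_norm; apply: cvgB => //; exact: cvg_cst|exact: cvg_cst].
by move=> /cvgr_le; apply; rewrite subrr normr0 mul0r.
Qed.

End asymptotics.

Theorem theorem1 (R : realType) (alpha : R) (alpha_gt0 : 0 < alpha)
  (kind : entry_kind)
  (disp : nat -> measure_display)
  (T : forall d : nat, measurableType (disp d))
  (P : forall d : nat, probability (T d) R)
  (W : forall d : nat, T d -> 'M[R[i]]_(d ^ 2))
  (W_wishart : forall d : nat, (0 < d)%N ->
     (1 <= Num.truncn (alpha * d%:R ^+ 2))%N ->
     is_wishart (P d) kind (Num.truncn (alpha * d%:R ^+ 2)) (W d))
  (I : set R) (I_interval : is_interval I)
  (eps : R) (eps_gt0 : 0 < eps) :
  P d [set t | eps < `| empirical_spectral_measure (partial_transpose (W d t)) I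
                        - fine (semicircle 1 alpha^-1 I) | ]
    @[d --> \oo] --> 0%E.
Proof.
have v_gt0 : 0 < alpha^-1 by rewrite invr_gt0.
have [zs [tau [tau_gt0 zs_gt0 mass_close]]] := forced_mass_close 1 v_gt0 I_interval eps_gt0.
have c_cvg := cvg_truncn_ratio alpha_gt0.
pose C := \sum_(z <- zs) (tau / 2) ^- 2 * defect_moment_constant kind z (2 * alpha^-1).
apply: (@squeeze_cvge _ _ _ _ (fun=> 0%E) _ (fun d => (C / Num.sqrt d%:R)%:E)).
- near=> d; rewrite measure_ge0 /=.
  have d_gt0 : (0 < d)%N by near: d; exact: nbhs_infty_gt.
  have p_gt0 : (0 < Num.truncn (alpha * d%:R ^+ 2))%N.
    by near: d; exact: near_truncn_gt0.
  apply: (wishart_event_bound (W_wishart d d_gt0 p_gt0) d_gt0 p_gt0 (v := alpha^-1)) => //.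
  + by near: d; apply: (cvgr_le _ c_cvg); lra.
  + exact: is_interval_measurable.
  + by near: d; apply: near_dist_mul_le c_cvg _; exact: divr_gt0.
  + by move=> x; apply: mass_close; rewrite expn_gt0 d_gt0.
- exact: cvg_cst.
- apply: cvg_EFin; first exact: nearW.
  by rewrite -[X in _ --> X](mulr0 C); apply: cvgM; [exact: cvg_cst|exact: cvg_inv_sqrtn].
Unshelve. all: by end_near. Qed.
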